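(* Let $H$ be a graph and let $\epsilon>0$. There is a deterministic algorithm which, given a graph $G$ on $n$ vertices, runs in time $O_H(\epsilon^{-O(1)}n^{\omega+o(1)}+\epsilon^{-O(e(H))}n)$ and outputs the number of copies of $H$ in $G$ up to an additive error of at most $\epsilon n^{v(H)}$.
   Context: $v(H)$ and $e(H)$ denote the numbers of vertices and edges of $H$. $\omega<2.373$ denotes the matrix multiplication exponent (two $n\times n$ matrices can be multiplied in time $n^{\omega+o(1)}$). The subscript $H$ in $O_H$ means the implied constants may depend on $H$; the constants in the exponents $O(1)$, $O(e(H))$ are absolute. *)

(* Defs.v *)
From HB Require Import structures.
From mathcomp Require Import all_boot all_order all_algebra.
From mathcomp Require Import classical_sets reals topology normedtype.
From mathcomp Require Import sequences exp.

Set Implicit Arguments.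
Unset Strict Implicit.
Unset Printing Implicit Defensive.

Import Order.TTheory GRing.Theory Num.Theory.
Import numFieldNormedType.Exports.

Local Open Scope ring_scope.

(** * Graphs and copies *)

Record graph (T : finType) := Graph {
  adj : rel T;
  adj_sym : symmetric adj;
  adj_irr : irreflexive adj }.

Definition edges (T : finType) (G : graph T) : {set {set T}} :=
  [set [set p.1; p.2] | p : T * T & adj G p.1 p.2].

(* A copy of H in G is a (not necessarily induced) subgraph (U, F) of G
   that is isomorphic to H; automorphic embeddings give the same copy. *)
Definition is_copy (S T : finType) (H : graph S) (G : graph T)
    (K : {set T} * {set {set T}}) : bool :=
  (K.2 \subset edges G) &&
  [exists f : {ffun S -> T},
    [&& injectiveb f, K.1 == [set f x | x : S]
      & K.2 == [set [set f x | x in e] | e : {set S} in edges H]]].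

Definition copies (S T : finType) (H : graph S) (G : graph T) : nat :=
  #|[set K | is_copy H G K]|.

(** * Random access machines with logarithmic cost *)

(* Registers can only be addressed directly, heap cells only indirectly: a
   program mentions finitely many registers, and the heap is free for the
   input, which therefore never collides with the work space. *)
Inductive instr :=
  | IConst of nat & int  (* R_i := z *)
  | IAdd of nat & nat & nat  (* R_i := R_j + R_k *)
  | ISub of nat & nat & nat
  | IMul of nat & nat & nat
  | IDiv of nat & nat & nat  (* Euclidean quotient, 0 for divisor 0 *)
  | ILoad of nat & nat  (* R_i := heap[|R_j|] *)
  | IStore of nat & nat  (* heap[|R_i|] := R_j *)
  | IJpos of nat & nat.  (* if R_i > 0 goto instruction l *)

Definition program := seq instr.

Record state := State { pc : nat; reg : nat -> int; heap : nat -> int }.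

Definition upd (f : nat -> int) (i : nat) (v : int) : nat -> int :=
  fun j => if j == i then v else f j.

Definition step (I : instr) (s : state) : state :=
  let r := reg s in
  let h := heap s in
  let set_reg i v := State (pc s).+1 (upd r i v) h in
  match I with
  | IConst i z => set_reg i z
  | IAdd i j k => set_reg i (r j + r k)
  | ISub i j k => set_reg i (r j - r k)
  | IMul i j k => set_reg i (r j * r k)
  | IDiv i j k => set_reg i (r j %/ r k)%Z
  | ILoad i j => set_reg i (h `|r j|%N)
  | IStore i j => State (pc s).+1 r (upd h `|r i|%N (r j))
  | IJpos i l => State (if 0 < r i then l else (pc s).+1) r h
  end.

Definition bitlen (m : nat) : nat := (trunc_log 2 m).+1.

(* Logarithmic cost criterion: an instruction costs the total bit length of
   the addresses and of the operands it handles. *)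
Definition cost (I : instr) (s : state) : nat :=
  let val i := (bitlen i + bitlen `|reg s i|)%N in
  match I with
  | IConst i z => (bitlen i + bitlen `|z|)%N
  | IAdd i j k | ISub i j k | IMul i j k | IDiv i j k =>
      (bitlen i + val j + val k)%N
  | ILoad i j => (bitlen i + val j + bitlen `|heap s `|reg s j|%N|)%N
  | IStore i j => (val i + val j)%N
  | IJpos i _ => val i
  end.

(* [exec P s t s']: started in s, P halts (by leaving the program text) in
   state s', after running for time t. *)
Inductive exec (P : program) : state -> nat -> state -> Prop :=
  | exec_halt s : onth P (pc s) = None -> exec P s 0 s
  | exec_step s I t s' : onth P (pc s) = Some I ->
      exec P (step I s) t s' -> exec P s (cost I s + t) s'.

Definition init (regs cells : seq int) : state :=
  State 0 (nth 0 regs) (nth 0 cells).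

Definition rowmajor (n : nat) (A : 'M[int]_n) : seq int :=
  [seq A i j | i <- enum 'I_n, j <- enum 'I_n].

Definition adjmx (n : nat) (G : graph 'I_n) : 'M[int]_n :=
  \matrix_(i, j) (adj G i j)%:R.

(** * The matrix multiplication exponent *)

(* Two n x n integer matrices can be multiplied in time n^(omega + o(1)), up
   to a factor polynomial in the bit length b of their entries. Minimality of
   omega is not required: a bound n^(omega + o(1)) for some admissible omega
   only becomes weaker as omega grows. *)
Definition matmul_exponent (R : realType) (omega : R) : Prop :=
  exists (P : program) (C : R) (c : nat) (o : nat -> R),
    (o n @[n --> \oo] --> (0 : R))%classic /\
    forall (n b : nat) (A B : 'M[int]_n), (0 < n)%N ->
      (forall i j, (`|A i j| < 2 ^ b)%N /\ (`|B i j| < 2 ^ b)%N) ->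
      exists (t : nat) (s : state),
        [/\ exec P (init [:: n%:Z] (rowmajor A ++ rowmajor B)) t s,
            mkseq (heap s) (n * n) = rowmajor (A *m B)
          & t%:R <= C * b.+1%:R ^+ c * n%:R `^ (omega + o n)].

(* Main.v *)
Require Import Defs.
From HB Require Import structures.
From mathcomp Require Import classical_sets reals topology normedtype.
From mathcomp Require Import sequences exp.
From mathcomp Require Import all_boot all_order all_algebra.
From mathcomp Require Import zify ring lra.
Import Order.TTheory GRing.Theory Num.Theory.
Import numFieldNormedType.Exports.

Set Implicit Arguments.
Unset Strict Implicit.
Unset Printing Implicit Defensive.

(** A copy of [H] is an injective homomorphism up to automorphism, and isolated
    vertices of [H] only contribute a falling factorial, so it suffices to
    estimate the average over [x_0, ..., x_(v-1)] in [V(G)] of a product of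
    0/1 kernels [F_ab(x_a, x_b)]: adjacency when [ab] is an edge of [H],
    distinctness otherwise. No regularity partition is needed. The average over
    [x_a] is replaced, one coordinate [a] after the other, by the average over a
    list [S_a] of [k = O(1/eps^2)] vertices. By Cauchy-Schwarz the error of such a
    replacement is at most the distance, in the feature space of the product of
    codegree kernels

      kap_a(x, y) = prod_(b != a) sum_z F_ab(x, z) F_ab(y, z)
      ([z] ranging over [S_b] for [b < a], over [V(G)] for [b > a]),

    between the mean of [V(G)] and the mean of [S_a]. Choosing the elements of
    [S_a] greedily (kernel herding) makes this distance at most [k^(-1/2)]: the
    cross term added by a new element is nonpositive on average over [V(G)],
    hence for the minimizer. The codegrees of [G] come from a single matrix
    product, everything else costs [poly(k) n^2] and a final sum over [k^v]
    tuples, with [v <= 2 e(H)].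

    The product of [A] and [A + (n+1) I] is [A^2 + (n+1) A], whose entries encode
    both [A] and the codegrees: the multiplication program may overwrite the whole
    heap, including its input. *)

Local Open Scope nat_scope.

Local Arguments bitlen : simpl never.

(** * Execution of program fragments *)

(** Taking [k = m * m] samples makes each of the [v] replacements cost at most [1 / m]. Here [m] is
    a constant multiple of [E = ceil(1 / eps)], the constant absorbing [v], the bound on the
    placements of isolated vertices, and a factor 2 lost in rounding the output to an integer.

    The obstacle in the running time is that [omega] is only some admissible exponent, so
    [n^2 <= n^(omega + o(1))], up to a constant, is not given: it is extracted from the
    multiplication program, which must change [n^2] cells on a suitable input. Polylogarithmic
    factors go into the exponent through [n^(1 / sqrt(ln n)) = exp(sqrt(ln n))].

    The herding takes [O(k^3 n^2)] units with [k = O(E^2)], and a unit costs at most a constant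
    times [bitlen n * E], whence the exponent 7. The final sum gives [E^(2 v + 1)], and
    [2 v + 1 <= 5 e(H)] once [v > 0]; its factor [bitlen n] is paid by the factor [n] of the second
    term. *)

Inductive reach (Q : program) : state -> nat -> state -> Prop :=
  | reach_refl s : reach Q s 0 s
  | reach_step s I t s' : onth Q (pc s) = Some I ->
      reach Q (step I s) t s' -> reach Q s (cost I s + t) s'.

Lemma reach_trans Q s1 t1 s2 t2 s3 :
  reach Q s1 t1 s2 -> reach Q s2 t2 s3 -> reach Q s1 (t1 + t2) s3.
Proof.
elim=> [//|s I t s' sI _ IH] /IH r3.
by rewrite -addnA; apply: reach_step.
Qed.

Lemma exec_reach Q s t s' :
  reach Q s t s' -> onth Q (pc s') = None -> exec Q s t s'.
Proof.
elim=> [s0 /exec_halt//|s0 I t0 s1 sI _ IH] /IH e1.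
exact: exec_step.
Qed.

Definition goes (Q : program) (s : state) (T : nat) (s' : state) : Prop :=
  exists2 t, reach Q s t s' & t <= T.

Lemma goes_refl Q s T : goes Q s T s.
Proof. by exists 0 => //; apply: reach_refl. Qed.

Lemma goes_trans Q s1 T1 s2 T2 s3 :
  goes Q s1 T1 s2 -> goes Q s2 T2 s3 -> goes Q s1 (T1 + T2) s3.
Proof.
move=> [t1 r1 l1] [t2 r2 l2]; exists (t1 + t2); last exact: leq_add.
exact: reach_trans r1 r2.
Qed.

Lemma goes_le Q s T1 T2 s' : goes Q s T1 s' -> T1 <= T2 -> goes Q s T2 s'.
Proof. by move=> [t r l] l2; exists t => //; apply: leq_trans l l2. Qed.

Lemma goes_step Q s I T s' :
  onth Q (pc s) = Some I -> cost I s <= T -> s' = step I s -> goes Q s T s'.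
Proof.
move=> sI cT ->; exists (cost I s) => //.
by rewrite -[cost I s]addn0; apply: reach_step sI _; apply: reach_refl.
Qed.

Definition code_at (Q : program) (p : nat) (c : program) : Prop :=
  exists Q1 Q2, Q = Q1 ++ c ++ Q2 /\ size Q1 = p.

Lemma code_at_cat Q p c1 c2 : code_at Q p (c1 ++ c2) ->
  code_at Q p c1 /\ code_at Q (p + size c1) c2.
Proof.
move=> [Q1 [Q2 [-> <-]]]; split.
  by exists Q1, (c2 ++ Q2); rewrite -!catA.
by exists (Q1 ++ c1), Q2; rewrite size_cat -!catA.
Qed.

Lemma code_at_cons Q p I c : code_at Q p (I :: c) ->
  onth Q p = Some I /\ code_at Q p.+1 c.
Proof.
move=> cd; split.
  by case: cd => [Q1 [Q2 [-> <-]]]; rewrite onth_cat ltnn subnn.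
by case: (@code_at_cat Q p [:: I] c cd) => _; rewrite addn1.
Qed.

Lemma bitlen_le m b : m <= 2 ^ b -> bitlen m <= b.+1.
Proof.
by move=> mb; rewrite /bitlen ltnS -(@trunc_expnK 2 b) //; apply: leq_trunc_log.
Qed.

Lemma ltn_bitlen m : m < 2 ^ bitlen m.
Proof. exact: trunc_log_ltn. Qed.

Lemma bitlen_gt0 m : 0 < bitlen m.
Proof. by []. Qed.

Lemma leq_bitlen m1 m2 : m1 <= m2 -> bitlen m1 <= bitlen m2.
Proof. by move=> le12; rewrite /bitlen ltnS; apply: leq_trunc_log. Qed.

(** * A structured language over the machine *)

Inductive binop := Badd | Bsub | Bmul | Bdiv.

Inductive expr :=
  | EC of int
  | EV of nat
  | EO of binop & expr & expr
  | EL of expr.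

Inductive com :=
  | CSkip
  | CAsn of nat & expr
  | CSt of expr & expr
  | CSeq of com & com
  | CIf of expr & com
  | CWhile of expr & com.

Record ast := Ast { vr : nat -> int; hp : nat -> int }.

Definition bop (o : binop) (x y : int) : int :=
  match o with
  | Badd => x + y
  | Bsub => x - y
  | Bmul => x * y
  | Bdiv => (x %/ y)%Z
  end%R.

Fixpoint ev (e : expr) (a : ast) : int :=
  match e with
  | EC z => z
  | EV i => vr a i
  | EO o e1 e2 => bop o (ev e1 a) (ev e2 a)
  | EL e1 => hp a `|ev e1 a|
  end.

(* Only the values read are bounded: every intermediate result is then at most
   a power of [W] that depends on [e] alone. *)
Fixpoint esafe (W : nat) (e : expr) (a : ast) : Prop :=
  match e with
  | EC z => `|z| <= W
  | EV i => `|vr a i| <= W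
  | EO _ e1 e2 => esafe W e1 a /\ esafe W e2 a
  | EL e1 => esafe W e1 a /\ `|hp a `|ev e1 a| | <= W
  end.

Definition setv (a : ast) (i : nat) (z : int) : ast := Ast (upd (vr a) i z) (hp a).
Definition seth (a : ast) (i : nat) (z : int) : ast := Ast (vr a) (upd (hp a) i z).

Inductive runw (W : nat) (e : expr) (body : ast -> nat -> ast -> Prop) :
    ast -> nat -> ast -> Prop :=
  | runw_stop a : esafe W e a -> (ev e a <= 0)%R -> runw W e body a 1 a
  | runw_loop a u1 a1 u2 a2 : esafe W e a -> (0 < ev e a)%R ->
      body a u1 a1 -> runw W e body a1 u2 a2 ->
      runw W e body a (u1 + u2).+1 a2.

(* Unit cost per atomic statement or test; a unit is worth [O(bitlen W)]
   machine time, see [ccom_correct]. *)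
Fixpoint run (W : nat) (c : com) (a : ast) (u : nat) (a' : ast) : Prop :=
  match c with
  | CSkip => u = 0 /\ a' = a
  | CAsn i e => [/\ esafe W e a, u = 1 & a' = setv a i (ev e a)]
  | CSt e1 e2 =>
      [/\ esafe W e1 a, esafe W e2 a, u = 1 & a' = seth a `|ev e1 a| (ev e2 a)]
  | CSeq c1 c2 => exists u1 a1 u2,
      [/\ run W c1 a u1 a1, run W c2 a1 u2 a' & u = u1 + u2]
  | CIf e c1 => esafe W e a /\
      (if (0 < ev e a)%R then exists2 u1, run W c1 a u1 a' & u = u1.+1
       else u = 1 /\ a' = a)
  | CWhile e c1 => runw W e (run W c1) a u a'
  end.

Section Compile.

(* Variables and temporaries live in interleaved registers from [T0] on; the
   registers below [T0] are left to the matrix multiplication program. *)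
Variable T0 : nat.

Definition vreg (i : nat) : nat := T0 + i.*2.
Definition treg (d : nat) : nat := (T0 + d.*2).+1.

Arguments treg : simpl never.
Arguments vreg : simpl never.

Definition iop (o : binop) : nat -> nat -> nat -> instr :=
  match o with Badd => IAdd | Bsub => ISub | Bmul => IMul | Bdiv => IDiv end.

Fixpoint cexp (e : expr) (d : nat) : program :=
  match e with
  | EC z => [:: IConst (treg d) z]
  | EV i => [:: IConst (treg d) 0; IAdd (treg d) (treg d) (vreg i)]
  | EO o e1 e2 =>
      cexp e1 d ++ cexp e2 d.+1 ++ [:: iop o (treg d) (treg d) (treg d.+1)]
  | EL e1 => cexp e1 d ++ [:: ILoad (treg d) (treg d)]
  end.

(* The jump is taken when [1 - e] is positive, that is when [e] is not. *)
Definition ctest (e : expr) (l : nat) : program :=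
  cexp (EO Bsub (EC 1) e) 0 ++ [:: IJpos (treg 0) l].
Definition tsize (e : expr) : nat := (size (cexp (EO Bsub (EC 1) e) 0)).+1.
Arguments ctest : simpl never.
Arguments tsize : simpl never.

Fixpoint ccom (c : com) (p : nat) : program :=
  match c with
  | CSkip => [::]
  | CAsn i e =>
      cexp e 0 ++ [:: IConst (vreg i) 0; IAdd (vreg i) (vreg i) (treg 0)]
  | CSt e1 e2 => cexp e1 0 ++ cexp e2 1 ++ [:: IStore (treg 0) (treg 1)]
  | CSeq c1 c2 => ccom c1 p ++ ccom c2 (p + size (ccom c1 p))
  | CIf e c1 =>
      let cb := ccom c1 (p + tsize e) in
      ctest e (p + tsize e + size cb) ++ cb
  | CWhile e c1 =>
      let cb := ccom c1 (p + tsize e) in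
      ctest e (p + tsize e + size cb + 2) ++
      cb ++ [:: IConst (treg 0) 1; IJpos (treg 0) p]
  end.

Lemma ccom_if e c p : ccom (CIf e c) p =
  ctest e (p + tsize e + size (ccom c (p + tsize e))) ++ ccom c (p + tsize e).
Proof. by []. Qed.

Lemma ccom_while e c p : ccom (CWhile e c) p =
  ctest e (p + tsize e + size (ccom c (p + tsize e)) + 2) ++
  ccom c (p + tsize e) ++ [:: IConst (treg 0) 1; IJpos (treg 0) p].
Proof. by []. Qed.

Definition sim (a : ast) (s : state) : Prop :=
  (forall i, reg s (vreg i) = vr a i) /\ (forall i, heap s i = hp a i).

Definition untouched (d : nat) (s s' : state) : Prop :=
  (forall r, (forall d', d <= d' -> r != treg d') -> reg s' r = reg s r) /\
  heap s' = heap s.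

Lemma vreg_treg i d : (vreg i == treg d) = false.
Proof. by apply/eqP; rewrite /vreg /treg; lia. Qed.

Lemma vreg_inj i j : (vreg i == vreg j) = (i == j).
Proof. by apply/eqP/eqP; rewrite /vreg; lia. Qed.

Lemma treg_inj i j : (treg i == treg j) = (i == j).
Proof. by apply/eqP/eqP; rewrite /treg; lia. Qed.

Lemma size_ctest e l : size (ctest e l) = tsize e.
Proof. by rewrite /ctest size_cat addn1. Qed.

Lemma untouched_trans d1 d2 d s1 s2 s3 : d <= d1 -> d <= d2 ->
  untouched d1 s1 s2 -> untouched d2 s2 s3 -> untouched d s1 s3.
Proof.
move=> l1 l2 [r1 h1] [r2 h2]; split; last by rewrite h2.
move=> r rd; rewrite r2 ?r1 // => d' ld; apply: rd.
  exact: leq_trans ld.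
exact: leq_trans ld.
Qed.

Lemma untouched_sim d a s s' : untouched d s s' -> sim a s -> sim a s'.
Proof.
move=> [r h] [sr sh]; split=> i; last by rewrite h.
by rewrite r // => d' _; rewrite vreg_treg.
Qed.

Lemma untouched_treg d d' s s' : untouched d s s' -> d' < d ->
  reg s' (treg d') = reg s (treg d').
Proof.
move=> [r _] ld; apply: r => d2 ld2; rewrite treg_inj.
by apply/eqP => E; move: ld; rewrite E ltnNge ld2.
Qed.

Lemma untouched_low d s s' r : untouched d s s' -> r < T0 ->
  reg s' r = reg s r.
Proof. by move=> [rr _] lr; apply: rr => d' _; rewrite /treg; apply/eqP; lia. Qed.

Fixpoint esize (e : expr) : nat :=
  match e with
  | EO _ e1 e2 => esize e1 + esize e2
  | _ => 1
  end.

Lemma esize_gt0 e : 0 < esize e.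
Proof. by elim: e => //= o e1 h1 e2 h2; rewrite addn_gt0 h1. Qed.

Lemma leq_absz_div (x y : int) : (`|(x %/ y)%Z| <= `|x|)%N.
Proof.
have := divz_eq x y.
case: (eqVneq y 0%R) => [->|y0]; first by rewrite divz0.
have := modz_ge0 x y0; have := ltz_mod x y0.
have : (0 < `|y|%R)%R by rewrite normr_gt0.
move: (x %/ y)%Z (x %% y)%Z => q r; nia.
Qed.

(** Since [0 < B], both operand bounds are at least 2, so their product also dominates sums and
    differences, and quotients do not grow. One bound, multiplicative over the leaves, thus covers
    all four operations. *)
Lemma ev_bound B W e a : 0 < B -> W <= 2 ^ B -> esafe W e a ->
  `|ev e a| <= 2 ^ (B * esize e).
Proof.
move=> B0 WB; elim: e => [z|i|o e1 IH1 e2 IH2|e1 IH1] /=;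
  rewrite ?muln1.
- by move=> h; apply: leq_trans h WB.
- by move=> h; apply: leq_trans h WB.
- move=> [/IH1 h1 /IH2 h2].
  have g1 : 2 <= 2 ^ (B * esize e1).
    by rewrite -[X in X <= _]expn1 leq_exp2l // muln_gt0 B0 esize_gt0.
  have g2 : 2 <= 2 ^ (B * esize e2).
    by rewrite -[X in X <= _]expn1 leq_exp2l // muln_gt0 B0 esize_gt0.
  rewrite mulnDr expnD.
  have := leq_absz_div (ev e1 a) (ev e2 a).
  move: (2 ^ _) (2 ^ _) g1 g2 h1 h2 => X Y; case: o => /=; nia.
- by move=> [_ h]; apply: leq_trans h WB.
Qed.

Lemma bitlen_ev B W e a : 0 < B -> W <= 2 ^ B -> esafe W e a ->
  bitlen `|ev e a| <= (esize e).+1 * B.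
Proof.
move=> B0 WB sf; apply: leq_trans (bitlen_le (ev_bound B0 WB sf)) _; lia.
Qed.

Lemma cost_op o i j k s : cost (iop o i j k) s =
  bitlen i + (bitlen j + bitlen `|reg s j|) + (bitlen k + bitlen `|reg s k|).
Proof. by case: o. Qed.

Lemma step_op o i j k s : step (iop o i j k) s =
  State (pc s).+1 (upd (reg s) i (bop o (reg s j) (reg s k))) (heap s).
Proof. by case: o. Qed.

Lemma cexp_correct e d : exists K, forall B W Q s a,
  0 < B -> W <= 2 ^ B -> code_at Q (pc s) (cexp e d) -> sim a s ->
  esafe W e a ->
  exists s', [/\ goes Q s (K * B) s', pc s' = pc s + size (cexp e d),
    reg s' (treg d) = ev e a & untouched d s s'].
Proof.
have untd d0 s p v : untouched d0 s (State p (upd (reg s) (treg d0) v) (heap s)).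
  by split=> // r /(_ d0 (leqnn _)) /negPf /= rd; rewrite /upd rd.
elim: e d => [z|i|o e1 IH1 e2 IH2|e1 IH1] d /=.
- exists (bitlen (treg d) + 2) => B W Q s a B0 WB /code_at_cons[c0 _] sm sf.
  exists (step (IConst (treg d) z) s); split=> //=.
  + apply: (goes_step c0) => //=.
    have := bitlen_ev (e := EC z) (a := a) B0 WB sf => /=; nia.
  + by rewrite addn1.
  + by rewrite /upd eqxx.
- exists (bitlen (treg d) + 1 + bitlen (treg d) + bitlen (treg d) + 1 + bitlen (vreg
  i) + 2).
  move=> B W Q s a B0 WB /code_at_cons[c0 /code_at_cons[c1 _]] sm sf.
  (* The machine has no move instruction: a copy clears the target and adds to it. *)
  pose s1 := step (IConst (treg d) 0) s.
  exists (step (IAdd (treg d) (treg d) (vreg i)) s1); split=> //=.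
  + apply: (@goes_le _ _ ((bitlen (treg d) + 1) +
      (bitlen (treg d) + bitlen (treg d) + 1 + bitlen (vreg i) + 2 * B))); last by nia.
    apply: (@goes_trans _ _ _ s1).
      by apply: (goes_step c0).
    apply: (@goes_step _ s1 _ _ _ c1) => //=.
    rewrite /upd eqxx vreg_treg (proj1 sm).
    have := bitlen_ev (e := EV i) (a := a) B0 WB sf => /=.
    rewrite -[bitlen `|0%R|]/1; lia.
  + by rewrite addn2.
  + by rewrite /upd !eqxx vreg_treg add0r (proj1 sm).
  + split=> //= r /(_ d (leqnn _)) /negPf rd; by rewrite /upd !rd.
- have [K1 H1] := IH1 d; have [K2 H2] := IH2 d.+1.
  exists (K1 + K2 + (bitlen (treg d) + bitlen (treg d) + (esize e1).+1 +
     bitlen (treg d.+1) + (esize e2).+1)).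
  move=> B W Q s a B0 WB /code_at_cat[c1 /code_at_cat[c2 /code_at_cons[c3 _]]] sm
    [sf1 sf2].
  have [s1 [g1 p1 v1 u1]] := H1 _ _ _ _ _ B0 WB c1 sm sf1.
  rewrite -p1 in c2 c3.
  have [s2 [g2 p2 v2 u2]] := H2 _ _ _ _ _ B0 WB c2 (untouched_sim u1 sm) sf2.
  rewrite -p2 in c3.
  have v1' : reg s2 (treg d) = ev e1 a by rewrite (untouched_treg u2).
  exists (step (iop o (treg d) (treg d) (treg d.+1)) s2); split=> //.
  + apply: (@goes_le _ _ (K1 * B + (K2 * B + (bitlen (treg d) + bitlen (treg d) +
    (esize e1).+1 +
     bitlen (treg d.+1) + (esize e2).+1) * B))); last by rewrite addnA -!mulnDl.
    apply: goes_trans g1 _; apply: goes_trans g2 _; apply: (goes_step c3) => //.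
    rewrite cost_op v1' v2.
    have := bitlen_ev B0 WB sf1; have := bitlen_ev B0 WB sf2; nia.
  + by rewrite step_op /= p2 p1 !size_cat /= addn1 !addnS !addnA.
  + by rewrite step_op /= /upd eqxx v1' v2.
  + apply: (@untouched_trans d d d _ s2) => //; last by rewrite step_op.
    exact: untouched_trans u1 u2.
- have [K1 H1] := IH1 d.
  exists (K1 + (bitlen (treg d) + bitlen (treg d) + (esize e1).+1 + 2)).
  move=> B W Q s a B0 WB /code_at_cat[c1 /code_at_cons[c2 _]] sm [sf1 sf2].
  have [s1 [g1 p1 v1 u1]] := H1 _ _ _ _ _ B0 WB c1 sm sf1.
  rewrite -p1 in c2.
  have sm1 := untouched_sim u1 sm.
  exists (step (ILoad (treg d) (treg d)) s1); split=> //=.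
  + apply: (@goes_le _ _ (K1 * B + (bitlen (treg d) + bitlen (treg d) + (esize e1).+1
    + 2) * B)); last by rewrite -!mulnDl.
    apply: goes_trans g1 _; apply: (goes_step c2) => //=.
    rewrite v1 (proj2 sm1).
    have b1 := bitlen_ev B0 WB sf1.
    have b2 := bitlen_le (leq_trans sf2 WB); nia.
  + by rewrite p1 size_cat addnA addn1.
  + by rewrite /upd eqxx v1 (proj2 sm1).
  + exact: untouched_trans u1 (untd _ _ _ _).
Qed.

Definition keeps_low (s s' : state) : Prop :=
  forall r, r < T0 -> reg s' r = reg s r.

Lemma ctest_correct e : exists K, forall B W Q s a l,
  0 < B -> 0 < W <= 2 ^ B -> sim a s -> esafe W e a ->
  code_at Q (pc s) (ctest e l) ->
  exists s', [/\ goes Q s (K * B) s',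
    pc s' = (if (0 < ev e a)%R then pc s + tsize e else l),
    sim a s' & keeps_low s s'].
Proof.
have [K H] := cexp_correct (EO Bsub (EC 1) e) 0.
exists (K + (bitlen (treg 0) + (esize e).+2)).
move=> B W Q s a l B0 /andP[W0 WB] sm sf /code_at_cat[c1 /code_at_cons[c2 _]].
have sf' : esafe W (EO Bsub (EC 1) e) a by [].
have [s1 [g1 p1 v1 u1]] := H _ _ _ _ _ B0 WB c1 sm sf'.
rewrite -p1 in c2.
exists (step (IJpos (treg 0) l) s1); split.
- rewrite mulnDl; apply: goes_trans g1 _; apply: (goes_step c2) => //.
  have := bitlen_ev B0 WB sf' => /=; rewrite v1 /=; nia.
- rewrite [LHS]/= v1 p1 -addnS -/(tsize e) /= subr_gt0.
  by case: ltgtP => // h; case: ltrP => //; lia.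
- have [hr hh] := untouched_sim u1 sm; split=> i /=; [exact: hr|exact: hh].
- by move=> r lr /=; apply: untouched_low u1 lr.
Qed.

(** [K] is fixed by the program before [W] and the state, so [u] structured units become machine
    time [O(B * u)]. Registers below [T0] survive, as the embedded multiplication program
    requires. *)
Theorem ccom_correct c : exists K, forall B W Q s a u a',
  0 < B -> 0 < W <= 2 ^ B -> code_at Q (pc s) (ccom c (pc s)) -> sim a s ->
  run W c a u a' ->
  exists s', [/\ goes Q s (K * B * u) s', pc s' = pc s + size (ccom c (pc s)),
    sim a' s' & keeps_low s s'].
Proof.
elim: c => [|i e|e1 e2|c1 IH1 c2 IH2|e c1 IH1|e c1 IH1].
- exists 0 => B W Q s a u a' _ _ _ sm [-> ->].
  by exists s; split=> //; [exact: goes_refl | rewrite addn0].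
- have [K H] := cexp_correct e 0.
  exists (K + (bitlen (vreg i) + 1 + bitlen (vreg i) + bitlen (vreg i) + 1 + bitlen
    (treg 0) + (esize e).+1)).
  move=> B W Q s a u a' B0 /andP[_ WB] /code_at_cat[c1 /code_at_cons[c2
    /code_at_cons[c3 _]]] sm [sf -> ->].
  have [s1 [g1 p1 v1 u1]] := H _ _ _ _ _ B0 WB c1 sm sf.
  rewrite -p1 in c2 c3.
  pose s2 := step (IConst (vreg i) 0) s1.
  have [sr sh] := untouched_sim u1 sm.
  exists (step (IAdd (vreg i) (vreg i) (treg 0)) s2); split=> //=.
  + rewrite muln1 mulnDl; apply: goes_trans g1 _.
    apply: (@goes_le _ _ ((bitlen (vreg i) + 1) +
      (bitlen (vreg i) + bitlen (vreg i) + 1 + bitlen (treg 0) + (esize e).+1 * B)));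
        last by nia.
    apply: (@goes_trans _ _ _ s2).
      by apply: (goes_step c2).
    apply: (@goes_step _ s2 _ _ _ c3) => //=.
    rewrite /upd eqxx [treg 0 == _]eq_sym vreg_treg v1.
    have := bitlen_ev B0 WB sf.
    rewrite -[bitlen `|0%R|]/1; lia.
  + by rewrite p1 size_cat /= addn2 !addnS.
  + split=> j /=; last exact: sh.
    rewrite /upd eqxx vreg_inj [treg 0 == _]eq_sym vreg_treg add0r v1.
    by case: eqP => // _.
  + move=> r lr /=; rewrite /upd.
    have -> : (r == vreg i) = false by rewrite /vreg; apply/eqP; lia.
    exact: untouched_low u1 lr.
- have [K1 H1] := cexp_correct e1 0; have [K2 H2] := cexp_correct e2 1.
  exists (K1 + K2 + (bitlen (treg 0) + (esize e1).+1 + bitlen (treg 1) + (esize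
    e2).+1)).
  move=> B W Q s a u a' B0 /andP[_ WB] /code_at_cat[c1 /code_at_cat[c2
    /code_at_cons[c3 _]]] sm [sf1 sf2 -> ->].
  have [s1 [g1 p1 v1 u1]] := H1 _ _ _ _ _ B0 WB c1 sm sf1.
  rewrite -p1 in c2 c3.
  have [s2 [g2 p2 v2 u2]] := H2 _ _ _ _ _ B0 WB c2 (untouched_sim u1 sm) sf2.
  rewrite -p2 in c3.
  have v1' : reg s2 (treg 0) = ev e1 a by rewrite (untouched_treg u2).
  have [sr sh] := untouched_sim u2 (untouched_sim u1 sm).
  exists (step (IStore (treg 0) (treg 1)) s2); split=> //=.
  + rewrite muln1 !mulnDl -addnA; apply: goes_trans g1 _; apply: goes_trans g2 _.
    apply: (goes_step c3) => //=; rewrite v1' v2.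
    have := bitlen_ev B0 WB sf1; have := bitlen_ev B0 WB sf2; nia.
  + by rewrite p2 p1 !size_cat /= !addnA addn1.
  + by split=> //= j; rewrite /upd v1' v2 sh.
  + move=> r lr /=; rewrite (untouched_low u2 lr); exact: untouched_low u1 lr.
- have [K1 H1] := IH1; have [K2 H2] := IH2.
  exists (K1 + K2) => B W Q s a u a' B0 WB /code_at_cat[c1' c2'] sm [u1 [a1 [u2 [r1
    r2 ->]]]].
  have [s1 [g1 p1 sm1 l1]] := H1 _ _ _ _ _ _ _ B0 WB c1' sm r1.
  rewrite -p1 in c2'.
  have [s2 [g2 p2 sm2 l2]] := H2 _ _ _ _ _ _ _ B0 WB c2' sm1 r2.
  exists s2; split=> //.
  + apply: goes_le (goes_trans g1 g2) _; nia.
  + by rewrite p2 p1 /= size_cat addnA -p1.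
  + by move=> r lr; rewrite l2 // l1.
- have [K1 H1] := IH1; have [K2 H2] := ctest_correct e.
  exists (K1 + K2) => B W Q s a u a' B0 WB cd sm [sf rr].
  rewrite ccom_if in cd *; case/code_at_cat: cd => cd1 cd2.
  have [s1 [g1 p1 sm1 l1]] := H2 _ _ _ _ _ _ B0 WB sm sf cd1.
  move: rr p1; case: ifP => [pe [u1 r1 ->] p1|pe [-> ->] p1]; last first.
    exists s1; split=> //; first by apply: goes_le g1 _; nia.
    by rewrite p1 size_cat size_ctest addnA.
  rewrite size_ctest -p1 in cd2.
  have [s2 [g2 p2 sm2 l2]] := H1 _ _ _ _ _ _ _ B0 WB cd2 sm1 r1.
  exists s2; split=> //.
  + apply: goes_le (goes_trans g1 g2) _; nia.
  + by rewrite p2 size_cat size_ctest p1 addnA.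
  + by move=> r lr; rewrite l2 // l1.
- have [K1 H1] := IH1; have [K2 H2] := ctest_correct e.
  exists (K1 + K2 + (bitlen (treg 0) + bitlen 1 + bitlen (treg 0) + bitlen 1)).
  move=> B W Q s a u a' B0 WB cd sm rr.
  (* Inner induction on the derivation of the loop: its code stays in place, so the hypothesis
     applies again once the backward jump has restored [pc s]. *)
  elim: rr s cd sm => {a u a'} [a sf ne|a u1 a1 u2 a2 sf pe r1 _ IH] s cd sm.
    rewrite ccom_while in cd *; case/code_at_cat: (cd) => cd1 _.
    have [s1 [g1 p1 sm1 l1]] := H2 _ _ _ _ _ _ B0 WB sm sf cd1.
    have {}ne : (0 < ev e a)%R = false by rewrite ltNge ne.
    rewrite ne in p1.
    exists s1; split=> //; first by apply: goes_le g1 _; nia.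
    by rewrite p1 size_cat size_ctest size_cat !addnA.
  move: (cd); rewrite ccom_while => /code_at_cat[cd1 /code_at_cat[cd2
    /code_at_cons[cd3 /code_at_cons[cd4 _]]]].
  have [s1 [g1 p1 sm1 l1]] := H2 _ _ _ _ _ _ B0 WB sm sf cd1.
  rewrite pe in p1.
  rewrite size_ctest -p1 in cd2 cd3 cd4.
  have [s2 [g2 p2 sm2 l2]] := H1 _ _ _ _ _ _ _ B0 WB cd2 sm1 r1.
  rewrite -p2 in cd3 cd4.
  pose s3 := step (IConst (treg 0) 1) s2.
  pose s4 := step (IJpos (treg 0) (pc s)) s3.
  have p4 : pc s4 = pc s by rewrite /= /upd eqxx.
  have sm4 : sim a1 s4.
    by case: sm2 => h1 h2; split=> //= j; rewrite /upd vreg_treg.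
  have cd' : code_at Q (pc s4) (ccom (CWhile e c1) (pc s4)) by rewrite p4.
  have [s5 [g5 p5 sm5 l5]] := IH _ cd' sm4.
  exists s5; split=> //.
  + have g3 : goes Q s2 (bitlen (treg 0) + bitlen 1) s3 by apply: goes_step cd3 _ _.
    have g4 : goes Q s3 (bitlen (treg 0) + bitlen 1) s4.
      by apply: (@goes_step _ s3 _ _ _ cd4) => //=; rewrite /upd eqxx.
    apply: goes_le (goes_trans g1 (goes_trans g2 (goes_trans g3 (goes_trans g4 g5)))) _.
    by nia.
  + by rewrite p5 p4.
  + move=> r lr; rewrite l5 //= /upd.
    have -> : (r == treg 0) = false by rewrite /treg; apply/eqP; lia.
    by rewrite l2 // l1.
Qed.

End Compile.

(** * Relocation of a program *)

(* Jumps out of the program text are redirected to its end. *)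
Definition shift_jump (p m : nat) (I : instr) : instr :=
  match I with
  | IJpos i l => IJpos i (p + minn l m)
  | _ => I
  end.

Definition relocate (P : program) (p : nat) : program :=
  map (shift_jump p (size P)) P.

Definition regs_of (I : instr) : seq nat :=
  match I with
  | IConst i _ | IJpos i _ => [:: i]
  | IAdd i j k | ISub i j k | IMul i j k | IDiv i j k => [:: i; j; k]
  | ILoad i j | IStore i j => [:: i; j]
  end.

Definition uses_below (T : nat) (P : program) : Prop :=
  forall j I, onth P j = Some I -> all (fun i => i < T) (regs_of I).

(** [2 <= T] keeps the two input registers below those of the compiled code. *)
Lemma uses_below_ex (P : program) : exists2 T, 2 <= T & uses_below T P.
Proof.
elim: P => [|I P [T T2 IH]]; first by exists 2 => // -[].
exists (maxn T (\max_(i <- regs_of I) i).+1); first by rewrite leq_max T2.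
case=> [|j] J /=; last first.
  by move/IH/allP => h; apply/allP => i /h li; rewrite leq_max li.
case=> <-; apply/allP => i iI; rewrite leq_max ltnS orbC.
by rewrite (@leq_bigmax_seq _ _ xpredT id i).
Qed.

Lemma step_shift T p m I s s2 :
  all (fun i => i < T) (regs_of I) -> pc s < m ->
  pc s2 = p + pc s -> (forall r, r < T -> reg s2 r = reg s r) ->
  heap s2 =1 heap s ->
  let J := shift_jump p m I in
  [/\ cost J s2 = cost I s, pc (step J s2) = p + minn (pc (step I s)) m,
      forall r, r < T -> reg (step J s2) r = reg (step I s) r,
      forall r, T <= r -> reg (step J s2) r = reg s2 r &
      heap (step J s2) =1 heap (step I s)].
Proof.
move=> us lm p2 r2 h2.
have nx : (pc s2).+1 = p + minn (pc s).+1 m by rewrite p2 (minn_idPl lm) addnS.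
have low i v w : i < T -> v = w ->
    (forall r, r < T -> upd (reg s2) i v r = upd (reg s) i w r) /\
    (forall r, T <= r -> upd (reg s2) i v r = reg s2 r).
  move=> li ->; split=> r lr; rewrite /upd; first by rewrite r2.
  by case: eqP => // ri; move: lr; rewrite ri leqNgt li.
case: I us => /= [i z|i j k|i j k|i j k|i j k|i j|i j|i l].
- by case/andP=> li _; case: (low i z z li erefl) => h3 h4.
- case/and4P=> li lj lk _; rewrite !r2 //.
  by case: (low i (reg s j + reg s k)%R _ li erefl).
- case/and4P=> li lj lk _; rewrite !r2 //.
  by case: (low i (reg s j - reg s k)%R _ li erefl).
- case/and4P=> li lj lk _; rewrite !r2 //.
  by case: (low i (reg s j * reg s k)%R _ li erefl).
- case/and4P=> li lj lk _; rewrite !r2 //.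
  by case: (low i (reg s j %/ reg s k)%Z _ li erefl).
- case/and3P=> li lj _; rewrite !r2 // h2.
  by case: (low i (heap s `|reg s j|) _ li erefl).
- case/and3P=> li lj _; rewrite !r2 //; split=> // a.
  by rewrite /upd h2.
- case/andP=> li _; rewrite !r2 //; split=> //.
  by case: ifP.
Qed.

(** Along the run the two counters are related by [minn], which sends every halting position of [P]
    to the end of the relocated copy, where the following code takes over. Registers from [T] on are
    never named by [P], so the variables of the surrounding program survive. *)
Lemma exec_relocate T P s t s' : exec P s t s' -> uses_below T P ->
  forall Q p s2, code_at Q p (relocate P p) ->
  pc s2 = p + minn (pc s) (size P) ->
  (forall r, r < T -> reg s2 r = reg s r) -> heap s2 =1 heap s ->
  exists s2', [/\ goes Q s2 t s2', pc s2' = p + size P,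
    heap s2' =1 heap s' & forall r, T <= r -> reg s2' r = reg s2 r].
Proof.
move=> ex us Q p s2 cd; elim: ex s2 => {s t s'} [s hl|s I t s' hI _ IH] s2 p2 r2 h2.
  exists s2; split=> //; first exact: goes_refl.
  rewrite p2; congr (_ + _); apply/minn_idPr.
  by rewrite -onthNE hl.
have lm : pc s < size P by rewrite -onthTE hI.
rewrite (minn_idPl (ltnW lm)) in p2.
have uI : all (fun i => i < T) (regs_of I).
  exact: us hI.
have cdI : onth Q (pc s2) = Some (shift_jump p (size P) I).
  case: cd => [Q1 [Q2 [-> s1]]]; rewrite p2 onth_cat s1 ltnNge leq_addr /=.
  by rewrite addKn onth_cat size_map lm /relocate onth_map hI.
have [c3 p3 r3 r3' h3] := step_shift uI lm p2 r2 h2.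
have [s4 [g4 p4 h4 r4]] := IH _ p3 r3 h3.
exists s4; split=> //; last by move=> r lr; rewrite r4 // r3'.
apply: (goes_trans _ g4); apply: (goes_step cdI) => //.
by rewrite c3.
Qed.

Lemma size_relocate P p : size (relocate P p) = size P.
Proof. exact: size_map. Qed.

Lemma cost_gt0 I s : 0 < cost I s.
Proof. by case: I. Qed.

(** A step alters at most one heap cell and costs at least 1. This is the source of the quadratic
    lower bound for matrix multiplication. *)
Lemma exec_writes P s t s' N : exec P s t s' ->
  \sum_(i < N) (heap s i != heap s' i) <= t.
Proof.
elim=> {s t s'} [s _|s I t s' _ _ IH].
  by rewrite big1 // => i _; rewrite eqxx.
apply: leq_trans (leq_add (cost_gt0 I s) IH).
have [a ha] : exists a, forall i, i != a -> heap (step I s) i = heap s i.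
  case: {IH} I => [i z|i j k|i j k|i j k|i j k|i j|i j|i l] /=; try by exists 0.
  by exists `|reg s i| => b /negPf ba; rewrite /upd ba.
case: (ltnP a N) => [aN|Na].
  rewrite (bigD1 (Ordinal aN)) //= [X in _ <= _ + X](bigD1 (Ordinal aN)) //=.
  rewrite addnA leq_add //; first by rewrite (leq_trans (leq_b1 _)) ?leq_addr.
  by apply: leq_sum => i ia; rewrite ha.
rewrite (leq_trans _ (leq_addl _ _)) //; apply: leq_sum => i _.
by rewrite ha //; apply/eqP=> E; move: (ltn_ord i); rewrite E ltnNge Na.
Qed.

(** * Hoare-style rules with a bound on the number of units *)

Definition tri (W : nat) (c : com) (a : ast) (U : nat) (Q : ast -> Prop) : Prop :=
  exists u a', [/\ run W c a u a', u <= U & Q a'].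

Lemma tri_asn W i e a (Q : ast -> Prop) :
  esafe W e a -> Q (setv a i (ev e a)) -> tri W (CAsn i e) a 1 Q.
Proof. by move=> sf q; exists 1, (setv a i (ev e a)). Qed.

Lemma tri_st W e1 e2 a (Q : ast -> Prop) :
  esafe W e1 a -> esafe W e2 a -> Q (seth a `|ev e1 a| (ev e2 a)) ->
  tri W (CSt e1 e2) a 1 Q.
Proof. by move=> s1 s2 q; exists 1, (seth a `|ev e1 a| (ev e2 a)). Qed.

Lemma tri_skip W a (Q : ast -> Prop) : Q a -> tri W CSkip a 0 Q.
Proof. by move=> q; exists 0, a. Qed.

Lemma tri_seq W c1 c2 a U1 U2 (Q : ast -> Prop) :
  tri W c1 a U1 (fun a1 => tri W c2 a1 U2 Q) ->
  tri W (CSeq c1 c2) a (U1 + U2) Q.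
Proof.
move=> [u1 [a1 [r1 l1 [u2 [a2 [r2 l2 q]]]]]].
by exists (u1 + u2), a2; split=> //; [exists u1, a1, u2 | apply: leq_add].
Qed.

Lemma tri_if W e c a U (Q : ast -> Prop) :
  esafe W e a ->
  ((0 < ev e a)%R -> tri W c a U Q) -> ((ev e a <= 0)%R -> Q a) ->
  tri W (CIf e c) a U.+1 Q.
Proof.
move=> sf h1 h2; case: (ltrP 0%R (ev e a)) => [pe|ne]; last first.
  exists 1, a; split=> //; last exact: h2.
  by rewrite /= ltNge ne.
have [u [a' [r l q]]] := h1 pe.
by exists u.+1, a'; split=> //=; rewrite pe; split=> //; exists u.
Qed.

Lemma tri_weaken W c a U1 U2 (Q1 Q2 : ast -> Prop) :
  tri W c a U1 Q1 -> U1 <= U2 -> (forall a', Q1 a' -> Q2 a') -> tri W c a U2 Q2.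
Proof.
move=> [u [a' [r l q]]] l2 qq; exists u, a'; split=> //; last exact: qq.
exact: leq_trans l l2.
Qed.

Definition CFor (i m : nat) (c : com) : com :=
  CSeq (CAsn i (EC 0))
    (CWhile (EO Bsub (EV m) (EV i)) (CSeq c (CAsn i (EO Badd (EV i) (EC 1))))).

(** Besides the body, each round pays for the test and the increment; the two remaining units are
    the initialization and the failing test. The body must leave the counter alone, and the
    invariant fixes the bound. *)
Lemma tri_for W i m c a U N (Inv : nat -> ast -> Prop) :
  0 < W -> N <= W ->
  (forall t a, Inv t a -> vr a i = t /\ vr a m = N) ->
  Inv 0 (setv a i 0) ->
  (forall t a, t < N -> Inv t a ->
     tri W c a U (fun a' => vr a' i = t /\ Inv t.+1 (setv a' i t.+1))) ->
  tri W (CFor i m c) a (N * U.+2).+2 (Inv N).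
Proof.
move=> W0 NW Iv I0 body; rewrite -addn1 addnC -[_.+1]add1n; apply: tri_seq.
rewrite add1n; apply: tri_asn => //=.
suff H : forall d t a1, t + d = N -> Inv t a1 ->
    tri W (CWhile (EO Bsub (EV m) (EV i)) (CSeq c (CAsn i (EO Badd (EV i) (EC 1)))))
      a1 (d * U.+2).+1 (Inv N) by apply: (H N 0) => //; rewrite add0n.
elim=> [|d IH] t a1 td It; have [vi vm] := Iv _ _ It.
  rewrite addn0 in td; subst t.
  exists 1, a1; split=> //; apply: runw_stop => /=; last by rewrite vi vm subrr.
  by rewrite vi vm /=; split.
have lt : t < N by rewrite -td addnS ltnS leq_addr.
have [u [a2 [r2 l2 [vi2 I2]]]] := body _ _ lt It.
have := IH t.+1 _ _ I2; rewrite addSnnS td => /(_ erefl)[u3 [a3 [r3 l3 q3]]].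
exists (u + 1 + u3).+1, a3; split=> //; last by move: l2 l3; lia.
apply: runw_loop r3 => /=.
- by rewrite vi vm; split=> //=; apply: leq_trans (ltnW lt) NW.
- by rewrite vi vm; lia.
- exists u, a2, 1; split=> //; split=> //=.
    by rewrite vi2; split=> //=; apply: leq_trans (ltnW lt) NW.
  by rewrite vi2; congr (setv _ _ _); lia.
Qed.

Lemma tri_post W c a U (Q1 Q2 : ast -> Prop) :
  tri W c a U Q1 -> (forall a', Q1 a' -> Q2 a') -> tri W c a U Q2.
Proof. by move=> t; apply: tri_weaken t _. Qed.

Local Open Scope ring_scope.

(** * Sums over cartesian products *)

Fixpoint cart (ss : seq (seq nat)) : seq (seq nat) :=
  if ss is s :: ss' then [seq x :: l | x <- s, l <- cart ss'] else [:: [::]].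

Lemma big_cart_cons (R : nmodType) s ss (f : seq nat -> R) :
  \sum_(l <- cart (s :: ss)) f l =
  \sum_(x <- s) \sum_(l <- cart ss) f (x :: l).
Proof. by rewrite /= big_allpairs_dep. Qed.

Lemma big_cart_nil (R : nmodType) (f : seq nat -> R) :
  \sum_(l <- cart [::]) f l = f [::].
Proof. by rewrite big_seq1. Qed.

Lemma sum_iota (R : nmodType) n (f : nat -> R) :
  \sum_(x <- iota 0 n) f x = \sum_(i < n) f i.
Proof. by rewrite -(big_mkord xpredT f) /index_iota subn0. Qed.

Lemma sum_mkseq (R : nmodType) n (g : nat -> nat) (f : nat -> R) :
  \sum_(x <- mkseq g n) f x = \sum_(i < n) f (g i).
Proof. by rewrite big_map sum_iota. Qed.

Arguments cart : simpl never.

(** Distributivity: it turns a kernel defined over all tuples into a product of sums over single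
    coordinates, which is cheap to compute. *)
Lemma sum_cart_prod (R : comNzRingType) ss (g : nat -> nat -> R) :
  \sum_(l <- cart ss) \prod_(b < size ss) g b (nth 0%N l b) =
  \prod_(b < size ss) \sum_(x <- nth [::] ss b) g b x.
Proof.
elim: ss g => [|s ss IH] g; first by rewrite big_cart_nil !big_ord0.
rewrite big_cart_cons big_ord_recl /= mulr_suml; apply: eq_bigr => x _.
rewrite -(IH (fun b => g b.+1)) mulr_sumr; apply: eq_bigr => l _.
by rewrite big_ord_recl.
Qed.

(** Slot [a] receives a one-element placeholder list, later overwritten by [x], so that tuples of
    the other coordinates keep the length and indexing of full ones. *)
Lemma sum_cart_slot (R : nmodType) ss a (f : seq nat -> R) :
  (a < size ss)%N ->
  \sum_(l <- cart ss) f l =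
  \sum_(x <- nth [::] ss a)
    \sum_(l <- cart (set_nth [::] ss a [:: 0%N])) f (set_nth 0%N l a x).
Proof.
elim: ss a f => [|s ss IH] [|a] f //= la.
  by rewrite big_cart_cons; apply: eq_bigr => x _; rewrite big_cart_cons big_seq1.
rewrite big_cart_cons.
rewrite (eq_bigr _ (fun y _ => IH a (fun l => f (y :: l)) la)).
rewrite exchange_big /=; apply: eq_bigr => x _.
by rewrite big_cart_cons.
Qed.

Lemma set_nth_mkseq (T : eqType) (x0 : T) (g : nat -> T) v a y : (a < v)%N ->
  set_nth x0 (mkseq g v) a y = mkseq (fun b => if b == a then y else g b) v.
Proof.
move=> av; apply: (@eq_from_nth _ x0).
  by rewrite size_set_nth !size_mkseq; apply/maxn_idPr.
move=> i; rewrite size_set_nth size_mkseq (maxn_idPr av) => iv.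
by rewrite nth_set_nth /= !nth_mkseq //; case: eqP.
Qed.

(** Cauchy-Schwarz against the constant 1, obtained from the nonnegativity of a variance cleared of
    denominators. *)
Lemma sum_sq_le (I : Type) (r : seq I) (c : I -> int) :
  (\sum_(i <- r) c i) ^+ 2 <= (size r)%:Z * \sum_(i <- r) c i ^+ 2.
Proof.
set N := (size r)%:Z; set T := \sum_(i <- r) c i.
case: (posnP (size r)) => [r0|r0].
  by rewrite /N /T; case: r r0 {N T} => // _; rewrite !big_nil expr0n mulr0.
have N0 : 0 < N by rewrite ltz_nat.
have : 0 <= \sum_(i <- r) (N * c i - T) ^+ 2 by apply: sumr_ge0 => i _; apply: sqr_ge0.
have -> : \sum_(i <- r) (N * c i - T) ^+ 2 =
    N * (N * (\sum_(i <- r) c i ^+ 2) - T ^+ 2).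
  transitivity (\sum_(i <- r) (N ^+ 2 * c i ^+ 2 - (2 * N * T) * c i + T ^+ 2)).
    by apply: eq_bigr => i _; ring.
  rewrite big_split big_split /= sumrN -!mulr_sumr -/T.
  rewrite big_const_seq count_predT iter_addr_0 -mulr_natr natz -/N; ring.
by rewrite pmulr_rge0 // subr_ge0.
Qed.

(** * Kernel herding *)

(** [h j x] is the inner product of the feature vector of [x] with the discrepancy [rr j] after [j]
    choices; it is computable from [kap] without forming any feature. With a nonpositive cross term,
    the squared norm grows by at most [n ^ 2 * size r] per choice, hence linearly and not
    quadratically in [k]. *)
Lemma herding (L : Type) (r : seq L) (phi : nat -> L -> bool) n k (S : nat -> nat)
    (kap : nat -> nat -> int) :
  (forall x y, kap x y = \sum_(l <- r) (phi x l)%:R * (phi y l)%:R) ->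
  let h j x := n%:Z * \sum_(i < j) kap x (S i) - j%:Z * \sum_(y < n) kap x y in
  (forall j, (j < k)%N -> forall x, (x < n)%N -> h j (S j) <= h j x) ->
  \sum_(l <- r)
    (\sum_(i < k) (n%:Z * (phi (S i) l)%:R - \sum_(x < n) (phi x l)%:R)) ^+ 2
  <= k%:Z * n%:Z ^+ 2 * (size r)%:Z.
Proof.
move=> kapE h greedy.
pose rr j l : int := \sum_(i < j) (n%:Z * (phi (S i) l)%:R - \sum_(x < n) (phi x l)%:R).
have hE j x : h j x = \sum_(l <- r) rr j l * (phi x l)%:R.
  rewrite /h; under eq_bigr => i _ do rewrite kapE.
  under [X in _ - _ * X]eq_bigr => i _ do rewrite kapE.
  rewrite exchange_big [X in _ - _ * X]exchange_big /= !mulr_sumr -sumrB.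
  apply: eq_bigr => l _; rewrite -!mulr_sumr /rr sumrB sumr_const card_ord.
  rewrite -!mulr_sumr -mulr_natr natz; ring.
suff H j : (j <= k)%N ->
    \sum_(l <- r) rr j l ^+ 2 <= j%:Z * n%:Z ^+ 2 * (size r)%:Z by apply: H.
elim: j => [_|j IH jk].
  by rewrite !mul0r big1 // => l _; rewrite /rr big_ord0 expr0n.
pose d l : int := n%:Z * (phi (S j) l)%:R - \sum_(x < n) (phi x l)%:R.
have -> : \sum_(l <- r) rr j.+1 l ^+ 2 =
    \sum_(l <- r) rr j l ^+ 2 + 2 * (\sum_(l <- r) rr j l * d l) +
    \sum_(l <- r) d l ^+ 2.
  rewrite mulr_sumr -!big_split /=; apply: eq_bigr => l _.
  by rewrite /rr big_ord_recr /= -/(rr j l) -/(d l); ring.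
(* Summing over all [x] turns the mean inside [d] into a comparison of the score of [S j] with every
   other score. *)
have cross : \sum_(l <- r) rr j l * d l <= 0.
  have -> : \sum_(l <- r) rr j l * d l = \sum_(x < n) (h j (S j) - h j x).
    rewrite sumrB sumr_const card_ord -mulr_natl natz hE.
    under [X in _ = _ - X]eq_bigr => x _ do rewrite hE.
    rewrite exchange_big mulr_sumr /= -sumrB; apply: eq_bigr => l _.
    by rewrite /d mulrBr -mulr_sumr; ring.
  by apply: sumr_le0 => x _; rewrite subr_le0 greedy.
have last : \sum_(l <- r) d l ^+ 2 <= n%:Z ^+ 2 * (size r)%:Z.
  have -> : n%:Z ^+ 2 * (size r)%:Z = \sum_(l <- r) n%:Z ^+ 2.
    by rewrite big_const_seq count_predT iter_addr_0 -mulr_natr natz.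
  (* Both terms of [d l] lie between 0 and [n]. *)
  apply: ler_sum => l _; rewrite /d.
  have s0 : 0 <= \sum_(x < n) (phi x l)%:R :> int by apply: sumr_ge0 => i _;
    apply: ler0n.
  have s1 : \sum_(x < n) (phi x l)%:R <= n%:Z :> int.
    apply: (@le_trans _ _ (\sum_(x < n) 1)); first by apply: ler_sum => i _;
      case: (phi i l).
    by rewrite sumr_const card_ord natz.
  move: (\sum_(x < n) _) s0 s1 => s s0 s1.
  by rewrite !expr2; case: (phi (S j) l); rewrite ?mulr1 ?mulr0 ?sub0r; nia.
move: (IH (ltnW jk)) cross last; rewrite -[j.+1]addn1 PoszD !mulrDl mul1r; lia.
Qed.

(** * Replacing the vertices by samples, one coordinate at a time *)

Section Sampling.

Variables (n k v : nat) (F : nat -> nat -> nat -> nat -> bool).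
Hypothesis Fid : forall a x y, F a a x y.
Hypothesis Fsym : forall a b x y, F a b x y = F b a y x.

Definition pairs_ok (l : seq nat) : bool :=
  all (fun b => all (fun c => F b c (nth 0%N l b) (nth 0%N l c)) (iota 0 v)) (iota 0 v).

Definition link (a x : nat) (l : seq nat) : bool :=
  all (fun b => F a b x (nth 0%N l b)) (iota 0 v).

Definition pairs_off (a : nat) (l : seq nat) : bool :=
  all (fun b => all (fun c => [|| b == a, c == a | F b c (nth 0%N l b) (nth 0%N l c)])
    (iota 0 v)) (iota 0 v).

(** Separates the conditions involving coordinate [a] from the rest, which ignores slot [a]. The
    condition of [a] with itself is free by [Fid], and by [Fsym] one direction per pair is
    enough. *)
Lemma pairs_ok_slot a x l : (a < v)%N ->
  pairs_ok (set_nth 0%N l a x) = link a x l && pairs_off a l.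
Proof.
move=> av; apply/idP/andP => [/allP ok|[/allP lk /allP off]].
  split; apply/allP => b bv.
    have [->|ba] := eqVneq b a; first exact: Fid.
    have av' : a \in iota 0 v by rewrite mem_iota.
    by move/allP: (ok a av') => /(_ b bv); rewrite !nth_set_nth /= eqxx (negPf ba).
  apply/allP => c cv; move/allP: (ok b bv) => /(_ c cv); rewrite !nth_set_nth /=.
  by case: eqP => //= _; case: eqP.
apply/allP => b bv; apply/allP => c cv; rewrite !nth_set_nth /=.
move/allP: (off b bv) => /(_ c cv).
have [->|ba] := eqVneq b a; have [->|ca] := eqVneq c a => //= _.
  by have := lk c cv.
by rewrite Fsym; have := lk b bv.
Qed.

Lemma all_natr (P : pred nat) m :
  (all P (iota 0 m))%:R = \prod_(b < m) (P b)%:R :> int.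
Proof.
rewrite -(big_mkord xpredT (fun b => (P b)%:R : int)) /index_iota subn0.
by elim: (iota 0 m) => [|b s IH] /=; rewrite ?big_nil ?big_cons // -IH; case: (P b);
  rewrite ?mul1r ?mul0r.
Qed.

(** The inner product of [link a x] and [link a y] over all tuples with slot [a] collapsed to one
    element, factorized by coordinates; the collapsed slot contributes the 1. *)
Definition kapv (S : nat -> nat -> nat) (a x y : nat) : int :=
  \prod_(b < v) (if b == a :> nat then 1 else
    if (b < a)%N then \sum_(i < k) (F a b x (S b i))%:R * (F a b y (S b i))%:R
    else \sum_(z < n) (F a b x z)%:R * (F a b y z)%:R).

Definition hval (S : nat -> nat -> nat) (a j x : nat) : int :=
  n%:Z * \sum_(i < j) kapv S a x (S a i) - j%:Z * \sum_(y < n) kapv S a x y.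

Definition mixed (S : nat -> nat -> nat) (a b : nat) : seq nat :=
  if (b < a)%N then mkseq (S b) k else iota 0 n.

Definition mixed_sum (S : nat -> nat -> nat) (a : nat) : int :=
  \sum_(l <- cart (mkseq (mixed S a) v)) (pairs_ok l)%:R.

Definition mixed_size (S : nat -> nat -> nat) (a : nat) : nat :=
  size (cart (mkseq (mixed S a) v)).

(** [N] counts the tuples of the other coordinates, common to both stages. Multiplying the sums
    crosswise by [k] and [n], and squaring, keeps the estimate over the integers. *)
Lemma mixed_step S a : (a < v)%N ->
  (forall j, (j < k)%N -> forall x, (x < n)%N -> hval S a j (S a j) <= hval S a j x) ->
  exists2 N : nat, mixed_size S a = (n * N)%N /\ mixed_size S a.+1 = (k * N)%N &
  (k%:Z * mixed_sum S a - n%:Z * mixed_sum S a.+1) ^+ 2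
    <= k%:Z * n%:Z ^+ 2 * N%:Z ^+ 2.
Proof.
move=> av greedy.
pose sig b := if b == a then [:: 0%N] else mixed S a b.
pose Lam := cart (mkseq sig v).
have slot (R : nmodType) (f : seq nat -> R) :
    \sum_(l <- cart (mkseq (mixed S a) v)) f l =
    \sum_(x < n) \sum_(l <- Lam) f (set_nth 0%N l a x).
  rewrite (@sum_cart_slot _ _ a) ?size_mkseq // nth_mkseq // {1}/mixed ltnn.
  by rewrite sum_iota set_nth_mkseq.
have slot' (R : nmodType) (f : seq nat -> R) :
    \sum_(l <- cart (mkseq (mixed S a.+1) v)) f l =
    \sum_(i < k) \sum_(l <- Lam) f (set_nth 0%N l a (S a i)).
  rewrite (@sum_cart_slot _ _ a) ?size_mkseq // nth_mkseq // {1}/mixed ltnSn.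
  rewrite sum_mkseq set_nth_mkseq // /Lam.
  (* The two stages differ at slot [a] only, where the placeholder hides the difference. *)
  suff -> : mkseq (fun b => if b == a then [:: 0%N] else mixed S a.+1 b) v = mkseq
    sig v by [].
  apply/eq_map => b; rewrite /sig; case: eqVneq => // ba.
  by rewrite /mixed ltnS [in LHS]leq_eqVlt (negPf ba).
have cnt (s : seq (seq nat)) : size s = (\sum_(l <- s) 1)%N by rewrite sum1_size.
exists (size Lam).
  split.
    rewrite /mixed_size cnt (slot nat (fun=> 1%N)) /=.
    under eq_bigr => x _ do rewrite sum1_size.
    by rewrite sum_nat_const card_ord.
  rewrite /mixed_size cnt (slot' nat (fun=> 1%N)) /=.
  under eq_bigr => x _ do rewrite sum1_size.
  by rewrite sum_nat_const card_ord.
have kapE x y : kapv S a x y = \sum_(l <- Lam) (link a x l)%:R * (link a y l)%:R.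
  rewrite /Lam.
  under eq_bigr => l _ do rewrite /link !all_natr -big_split /=.
  have := sum_cart_prod (mkseq sig v) (fun b z => (F a b x z)%:R * (F a b y z)%:R :
    int).
  rewrite size_mkseq => ->; apply: eq_bigr => b _.
  rewrite nth_mkseq // /sig /mixed; case: eqP => [->|_].
    by rewrite big_seq1 !Fid.
  by case: ifP => _; rewrite ?sum_mkseq ?sum_iota.
have := herding (r := Lam) (phi := link a) (kap := kapv S a) kapE greedy.
set Q := \sum_(l <- Lam) _ => hQ.
rewrite /mixed_sum slot slot'.
have -> : k%:Z * (\sum_(x < n) \sum_(l <- Lam) (pairs_ok (set_nth 0%N l a x))%:R) -
    n%:Z * (\sum_(i < k) \sum_(l <- Lam) (pairs_ok (set_nth 0%N l a (S a i)))%:R) =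
    - \sum_(l <- Lam) (pairs_off a l)%:R *
      \sum_(i < k) (n%:Z * (link a (S a i) l)%:R - \sum_(x < n) (link a x l)%:R).
  rewrite exchange_big [X in _ - _ * X]exchange_big /= !mulr_sumr -sumrB -sumrN.
  apply: eq_bigr => l _.
  under eq_bigr => x _ do rewrite pairs_ok_slot // -mulnb natrM.
  under [X in _ - _ * X]eq_bigr => x _ do rewrite pairs_ok_slot // -mulnb natrM.
  rewrite -!mulr_suml sumrB -mulr_sumr sumr_const card_ord -mulr_natl natz; ring.
rewrite sqrrN; apply: le_trans (sum_sq_le _ _) _.
have -> : k%:Z * n%:Z ^+ 2 * (size Lam)%:Z ^+ 2 =
  (size Lam)%:Z * (k%:Z * n%:Z ^+ 2 * (size Lam)%:Z) by ring.
(* The weight [pairs_off a l] is 0 or 1, so dropping it can only increase the sum of squares. *)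
apply: ler_wpM2l => //; apply: le_trans hQ; apply: ler_sum => l _.
rewrite exprMn; case: (pairs_off a l); rewrite ?expr1n ?mul1r //.
by rewrite expr0n mul0r sqr_ge0.
Qed.

Lemma mixed_size0 S : mixed_size S 0 = (n ^ v)%N.
Proof.
rewrite /mixed_size -sum1_size.
have -> : mkseq (mixed S 0) v = nseq v (iota 0 n).
  by apply: (@eq_from_nth _ [::]) => [|i]; rewrite size_mkseq ?size_nseq // => iv;
    rewrite nth_mkseq // nth_nseq iv.
elim: v => [|w IH]; first by rewrite big_seq1.
by rewrite (@big_cart_cons nat) /= IH sum_iota sum_nat_const card_ord expnS.
Qed.

(** The normalized averages telescope over the coordinates, each step contributing [k^(-1/2)]; a
    square [k] makes this the rational number [1 / m]. *)
Lemma sampling_error (R : realFieldType) m S : (0 < n)%N -> (0 < m)%N -> k = (m *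
  m)%N ->
  (forall a, (a < v)%N -> forall j, (j < k)%N -> forall x, (x < n)%N ->
     hval S a j (S a j) <= hval S a j x) ->
  `| (mixed_sum S 0)%:~R / (n ^ v)%:R - (mixed_sum S v)%:~R / (mixed_size S v)%:R |
    <= v%:R / m%:R :> R.
Proof.
move=> n0 m0 km greedy.
pose t a : R := (mixed_sum S a)%:~R / (mixed_size S a)%:R.
suff H a : (a <= v)%N -> (0 < mixed_size S a)%N /\ `|t 0%N - t a| <= a%:R / m%:R.
  by have [_] := H v (leqnn v); rewrite /t mixed_size0.
have k0 : (0 < k)%N by rewrite km muln_gt0 m0.
elim: a => [_|a IH av].
  by rewrite mixed_size0 expn_gt0 n0 subrr normr0 mul0r.
have [s0 h] := IH (ltnW av).
have [N [sa sa1] hN] := mixed_step av (greedy a av).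
have N0 : (0 < N)%N by move: s0; rewrite sa muln_gt0 n0.
split; first by rewrite sa1 muln_gt0 k0.
have st : `|t a - t a.+1| <= m%:R^-1.
  rewrite -(@ler_pXn2r _ 2) ?nnegrE ?invr_ge0 ?ler0n // real_normK ?num_real //.
  rewrite /t sa sa1 !natrM.
  set X := (mixed_sum S a)%:~R; set Y := (mixed_sum S a.+1)%:~R.
  have nR : n%:R != 0 :> R by rewrite pnatr_eq0 -lt0n.
  have kR : k%:R != 0 :> R by rewrite pnatr_eq0 -lt0n.
  have NR : N%:R != 0 :> R by rewrite pnatr_eq0 -lt0n.
  have mR : m%:R != 0 :> R by rewrite pnatr_eq0 -lt0n.
  have -> : (X / (n%:R * N%:R) - Y / (k%:R * N%:R)) ^+ 2 =
      (k%:R * X - n%:R * Y) ^+ 2 / (k%:R * n%:R * N%:R) ^+ 2.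
    by field; rewrite nR kR NR.
  have -> : m%:R^-1 ^+ 2 = (k%:R * n%:R ^+ 2 * N%:R ^+ 2) / (k%:R * n%:R * N%:R) ^+ 2
    :> R.
    by rewrite km natrM; field; rewrite nR NR mR.
  apply: ler_wpM2r; first by rewrite invr_ge0 sqr_ge0.
  move: hN; rewrite -(ler_int R) !(rmorphXn, rmorphM, rmorphB) /=.
  by rewrite -!pmulrn.
rewrite -natr1 mulrDl mul1r.
apply: le_trans (lerD h st).
have -> : t 0%N - t a.+1 = (t 0%N - t a) + (t a - t a.+1) by ring.
exact: ler_normD.
Qed.

End Sampling.

(** * Copies and injective homomorphisms *)

Section Copies.

Variables (S T : finType) (H : graph S) (G : graph T).

(** Irreflexivity excludes degenerate pairs, so an edge determines its endpoints up to order. *)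
Lemma in_edges (U : finType) (K : graph U) x y : ([set x; y] \in edges K) = adj K x y.
Proof.
apply/imsetP/idP => [[[a b]]|xy]; last by exists (x, y) => //; rewrite inE.
rewrite inE /= => ab E.
have xin : x \in [set a; b] by rewrite -E set21.
have yin : y \in [set a; b] by rewrite -E set22.
have ain : a \in [set x; y] by rewrite E set21.
have bin : b \in [set x; y] by rewrite E set22.
move: xin yin; rewrite !inE => /orP[/eqP xa|/eqP xb] /orP[/eqP ya|/eqP yb]; subst.
- move: bin; rewrite !inE orbb => /eqP ba; by rewrite ba adj_irr in ab.
- exact: ab.
- by rewrite adj_sym.
- move: ain; rewrite !inE orbb => /eqP ba; by rewrite ba adj_irr in ab.
Qed.

Lemma edgesP (U : finType) (K : graph U) (e : {set U}) :
  reflect (exists x y, adj K x y /\ e = [set x; y]) (e \in edges K).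
Proof.
apply: (iffP imsetP) => [[[a b]]|[x [y [xy ->]]]].
  by rewrite inE /= => ab ->; exists a, b.
by exists (x, y) => //; rewrite inE.
Qed.

Definition injhom (f : {ffun S -> T}) : bool :=
  injectiveb f && [forall x, forall y, adj H x y ==> adj G (f x) (f y)].

Definition img (f : {ffun S -> T}) : {set T} * {set {set T}} :=
  ([set f x | x : S], [set [set f x | x in e] | e : {set S} in edges H]).

Lemma injhomP (f : {ffun S -> T}) :
  reflect (injective f /\ forall x y, adj H x y -> adj G (f x) (f y)) (injhom f).
Proof.
apply: (iffP andP) => [[/injectiveP fi /forallP h]|[fi h]]; split=> //.
- by move=> x y; move/forallP: (h x) => /(_ y)/implyP.
- exact/injectiveP.
- by apply/forallP => x; apply/forallP => y; apply/implyP; apply: h.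
Qed.

Lemma imset_pair (f : {ffun S -> T}) x y : [set f z | z in [set x; y]] = [set f x; f y].
Proof. by rewrite imsetU1 imset_set1. Qed.

Lemma img_edges (f : {ffun S -> T}) :
  ((img f).2 \subset edges G) = [forall x, forall y, adj H x y ==> adj G (f x) (f y)].
Proof.
apply/subsetP/forallP => [sub x|h e].
  apply/forallP => y; apply/implyP => xy; rewrite -in_edges -imset_pair; apply: sub.
  by apply: imset_f; rewrite in_edges.
case/imsetP=> d /edgesP[x [y [xy ->]]] ->.
by rewrite imset_pair in_edges; move/forallP: (h x) => /(_ y)/implyP; apply.
Qed.

Lemma is_copyE K : is_copy H G K = [exists f, injhom f && (img f == K)].
Proof.
apply/andP/existsP => [[sub /existsP[f /and3P[fi /eqP k1 /eqP k2]]]|[f]].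
  exists f; rewrite /injhom fi -img_edges /img /= -k2 sub /=.
  by rewrite -k1; case: K {sub k1 k2}.
case/andP=> /andP[fi hm] /eqP <-; rewrite img_edges; split=> //.
by apply/existsP; exists f; rewrite fi !eqxx.
Qed.

End Copies.

(** An injection of the finite edge set into itself is onto, so injective endomorphisms are
    automorphisms. *)
Lemma injhom_edges (S : finType) (H : graph S) (g : {ffun S -> S}) :
  injhom H H g -> (img H g).2 = edges H.
Proof.
move=> hg; apply/eqP; rewrite eqEcard img_edges; case/andP: (hg) => /injectiveP gi ->.
by rewrite /= (card_imset _ (imset_inj gi)).
Qed.

Definition aut (S : finType) (H : graph S) : nat := #|[set g | injhom H H g]|.

Lemma aut_gt0 (S : finType) (H : graph S) : (0 < aut H)%N.
Proof.
apply/card_gt0P; exists [ffun x => x]; rewrite inE; apply/injhomP.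
by split=> x y; rewrite !ffunE.
Qed.

(* A homomorphism with the same image as [f] is [f] precomposed with an
   automorphism. *)
Lemma card_fiber (S T : finType) (H : graph S) (G : graph T) (f : {ffun S -> T}) :
  injhom H G f -> #|[set g | injhom H G g && (img H g == img H f)]| = aut H.
Proof.
move=> hf; have [fi fh] := injhomP _ _ _ hf.
pose comp (g : {ffun S -> S}) : {ffun S -> T} := [ffun x => f (g x)].
have ci : injective comp.
  move=> g1 g2 /ffunP E; apply/ffunP => x; apply: fi.
  by have := E x; rewrite !ffunE.
rewrite /aut -(card_imset _ ci); apply: eq_card => h; rewrite inE; apply/idP/imsetP.
  (* Equal vertex images define [g] as [h] followed by the inverse of [f]; equal edge images make
     [g] a homomorphism. *)
  case/andP=> hh /eqP[E1 E2]; have [hi hm] := injhomP _ _ _ hh.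
  have hx x : {y | f y == h x}.
    apply: sigW; have : h x \in [set f y | y : S] by rewrite -E1 imset_f.
    by case/imsetP => y _ ->; exists y; rewrite eqxx.
  pose g := [ffun x => sval (hx x)].
  have gE x : f (g x) = h x by rewrite ffunE; case: (hx x) => y /= /eqP.
  exists g; last by apply/ffunP => x; rewrite ffunE gE.
  rewrite inE; apply/injhomP; split=> [x y E|x y xy].
    by apply: hi; rewrite -!gE E.
  rewrite -in_edges.
  have : [set h z | z in [set x;
    y]] \in [set [set f z | z in e] | e : {set S} in edges H].
    by rewrite -E2; apply: imset_f; rewrite in_edges.
  case/imsetP => e eH; rewrite imset_pair -!gE -imset_pair => E.
  by rewrite (imset_inj fi E).
case=> g; rewrite inE => hg ->; have [gi gm] := injhomP _ _ _ hg.
apply/andP; split.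
  apply/injhomP; split=> [x y|x y xy]; rewrite !ffunE; last by apply/fh/gm.
  by move/fi/gi.
apply/eqP; congr pair.
  apply/setP => z; apply/imsetP/imsetP => -[x _ ->].
    by exists (g x) => //; rewrite ffunE.
  have [g' gK Kg] := injF_bij gi.
  by exists (g' x) => //; rewrite ffunE Kg.
rewrite -[in RHS](injhom_edges hg) /img /= -[in RHS]imset_comp.
apply: eq_imset => e /=; rewrite -imset_comp; apply: eq_imset => x /=.
by rewrite ffunE.
Qed.

(** The injective homomorphisms are partitioned by their image, and all fibers have the same
    size. *)
Lemma copies_aut (S T : finType) (H : graph S) (G : graph T) :
  #|[set f | injhom H G f]| = (copies H G * aut H)%N.
Proof.
rewrite -sum1_card (partition_big (img H) (is_copy H G)) /=; last first.
  move=> f; rewrite inE => hf; rewrite is_copyE; apply/existsP.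
  by exists f; rewrite hf eqxx.
rewrite /copies -sum_nat_const; apply: eq_big => [K|K]; first by rewrite inE.
rewrite is_copyE => /existsP[f /andP[hf /eqP <-]].
rewrite -(card_fiber hf) -sum1_card; apply: eq_bigl => g.
by rewrite !inE.
Qed.

(** * Counting by lists of vertices *)

(** Extended by [false] outside the range, so that lists and heap contents can be plain natural
    numbers. *)
Definition adjn (n : nat) (G : graph 'I_n) (x y : nat) : bool :=
  if insub x is Some i then if insub y is Some j then adj G i j else false
  else false.

Lemma adjn_ord n (G : graph 'I_n) (i j : 'I_n) : adjn G i j = adj G i j.
Proof. by rewrite /adjn !valK. Qed.

Lemma adjnC n (G : graph 'I_n) x y : adjn G x y = adjn G y x.
Proof. by rewrite /adjn; case: insubP => [i|] _ *; case: insubP => // j *;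
  apply: adj_sym. Qed.

Lemma adjnn n (G : graph 'I_n) x : adjn G x x = false.
Proof. by rewrite /adjn; case: insubP => // i *; apply: adj_irr. Qed.

Definition adjo (V : finType) (H : graph V) (us : seq V) (b c : nat) : bool :=
  if onth us b is Some u then if onth us c is Some w then adj H u w else false
  else false.

(* Non-adjacent vertices of [H] must still be mapped to distinct vertices. *)
Definition Fh (V : finType) (H : graph V) (us : seq V) n (G : graph 'I_n)
    (b c x y : nat) : bool :=
  (b == c) || (if adjo H us b c then adjn G x y else x != y).

Arguments Fh : simpl never.

Section Lists.

Variables (V : finType) (H : graph V) (n : nat) (G : graph 'I_n).

Lemma adjoC us b c : adjo H us b c = adjo H us c b.
Proof. by rewrite /adjo; case: onth => [u|]; case: onth => // w; apply: adj_sym. Qed.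

Lemma Fh_id us a x y : Fh H us G a a x y.
Proof. by rewrite /Fh eqxx. Qed.

Lemma Fh_sym us a b x y : Fh H us G a b x y = Fh H us G b a y x.
Proof. by rewrite /Fh eq_sym adjoC adjnC [x == y]eq_sym. Qed.

Lemma mem_cart_nseq m (s l : seq nat) :
  (l \in cart (nseq m s)) = (size l == m) && all (mem s) l.
Proof.
elim: m l => [|m IH] l; first by rewrite inE; case: l.
rewrite -[cart _]/[seq x :: l | x <- s, l <- cart (nseq m s)].
apply/allpairsP/andP => [[[x l'] /= [xs ml ->]]|].
  by move: ml; rewrite IH => /andP[/eqP sl al]; rewrite /= sl xs.
case: l => [|x l] /= [] // /eqP[sl] /andP[xs al].
by exists (x, l); split=> //; rewrite IH sl eqxx.
Qed.

Lemma uniq_cart_nseq m (s : seq nat) : uniq s -> uniq (cart (nseq m s)).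
Proof.
move=> us; elim: m => [//|m IH].
rewrite -[cart _]/[seq x :: l | x <- s, l <- cart (nseq m s)].
apply: allpairs_uniq => //.
by move=> [x l] [y k] _ _ /= [-> ->].
Qed.

Definition list_count (us : seq V) : int :=
  \sum_(l <- cart (nseq (size us) (iota 0 n))) (pairs_ok (size us) (Fh H us G) l)%:R.

Lemma pairs_ok_uniq us l : size l = size us ->
  pairs_ok (size us) (Fh H us G) l -> uniq l.
Proof.
move=> sl /allP ok; apply/(uniqP 0%N) => i j; rewrite !inE sl => li lj E.
have ii : i \in iota 0 (size us) by rewrite mem_iota.
have jj : j \in iota 0 (size us) by rewrite mem_iota.
move/allP: (ok i ii) => /(_ j jj); rewrite /Fh E adjnn eqxx /=.
by case: eqVneq => //= _; case: ifP.
Qed.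

Lemma pairs_ok_cons u us x l : (forall w, adj H u w = false) -> size l = size us ->
  pairs_ok (size us).+1 (Fh H (u :: us) G) (x :: l) =
  (x \notin l) && pairs_ok (size us) (Fh H us G) l.
Proof.
move=> iso sl; set m := size us in sl *.
have s1 : iota 1 m = map S (iota 0 m) by rewrite -[1%N]/(1 + 0)%N iotaDl.
have isoo b : adjo H (u :: us) 0 b = false.
  by rewrite /adjo /=; case: onth.
have xl : all (fun c => x != nth 0%N l c) (iota 0 m) = (x \notin l).
  rewrite -(@all_map _ _ (nth 0%N l) (fun y => x != y)) -sl -/(mkseq _ _) mkseq_nth.
  by rewrite all_predC; congr (~~ _); elim: l {sl} => //= y l ->; rewrite inE.
rewrite /pairs_ok /= s1 all_map -xl.
have -> : all (preim S (fun c => Fh H (u :: us) G 0 c x (nth 0%N (x :: l) c))) (iota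
  0 m) =
    all (fun c => x != nth 0%N l c) (iota 0 m).
  by apply: eq_all => c /=; rewrite /Fh isoo.
rewrite all_map.
set P1 := all _ (iota 0 m); set P2 := all _ (iota 0 m).
suff -> : P2 = P1 && pairs_ok m (Fh H us G) l by rewrite andbA andbb.
rewrite /P1 /P2 /pairs_ok -all_predI; apply: eq_all => b /=.
by rewrite Fh_sym {1}/Fh isoo /= all_map.
Qed.

Lemma sum_notin l : uniq l -> all (mem (iota 0 n)) l ->
  \sum_(x <- iota 0 n) (x \notin l)%:R = n%:Z - (size l)%:Z.
Proof.
move=> ul al.
have -> : size l = count (mem l) (iota 0 n).
  rewrite -size_filter; apply: perm_size; apply: uniq_perm => //.
    by rewrite filter_uniq ?iota_uniq.
  move=> x; rewrite mem_filter /= andbC; case xl: (x \in l); rewrite ?andbF ?andbT //.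
  by move/allP: al => /(_ x xl) /= ->.
have -> : n%:Z = (count (mem l) (iota 0 n) + count (predC (mem l)) (iota 0 n))%N.
  by rewrite count_predC size_iota.
rewrite PoszD addrAC subrr add0r -sum1_count -natz natr_sum [in RHS]big_mkcond /=.
by apply: eq_bigr => x _; case: (x \in l).
Qed.

(** An isolated vertex only has to avoid the images of the others, which are distinct by
    [pairs_ok_uniq]. The integer difference is correct even for [n < size us], as no list is then
    admissible. *)
Lemma list_count_cons u us : (forall w, adj H u w = false) ->
  list_count (u :: us) = (n%:Z - (size us)%:Z) * list_count us.
Proof.
move=> iso; rewrite /list_count /= big_cart_cons exchange_big /= mulr_sumr.
rewrite big_seq [RHS]big_seq; apply: eq_bigr => l; rewrite mem_cart_nseq.
case/andP=> /eqP sl al.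
under eq_bigr => x _ do rewrite pairs_ok_cons // -mulnb natrM.
rewrite -mulr_suml.
case ok: (pairs_ok _ _ _); last by rewrite !mulr0.
by rewrite sum_notin ?sl // (pairs_ok_uniq sl ok).
Qed.

Lemma list_count_cat us1 us : (forall u w, u \in us1 -> adj H u w = false) ->
  list_count (us1 ++ us) =
  (\prod_(j < size us1) (n%:Z - (size us + j)%:Z)) * list_count us.
Proof.
elim: us1 => [|u us1 IH] iso; first by rewrite big_ord0 mul1r.
rewrite cat_cons list_count_cons; last by move=> w; apply: iso; rewrite inE eqxx.
rewrite IH; last by move=> u' w uu; apply: iso; rewrite inE uu orbT.
by rewrite /= big_ord_recr /= size_cat [X in (n%:Z - X%:Z)]addnC; ring.
Qed.

(** [vals] matches maps with lists. Injectivity comes from distinctness for non-adjacent pairs, and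
    from the absence of loops in [G] for adjacent ones. *)
Lemma list_count_full us : (0 < n)%N -> uniq us -> (forall u, u \in us) ->
  list_count us = (#|[set f | injhom H G f]|)%:Z.
Proof.
move=> n0 uus mus.
pose vals (f : {ffun V -> 'I_n}) := [seq val (f u) | u <- us].
have vi : injective vals.
  move=> f g /eq_in_map E; apply/ffunP => u; apply: val_inj; exact: E.
have pm : perm_eq (map vals (enum {: {ffun V -> 'I_n}})) (cart (nseq (size us) (iota
  0 n))).
  apply: uniq_perm; first by rewrite map_inj_uniq // enum_uniq.
    by rewrite uniq_cart_nseq // iota_uniq.
  move=> l; rewrite mem_cart_nseq; apply/mapP/andP => [[f _ ->]|[/eqP sl /allP al]].
    rewrite size_map; split=> //; apply/allP => x /mapP[u _ ->].
    by rewrite /= mem_iota /=.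
  exists [ffun u => insubd (Ordinal n0) (nth 0%N l (index u us))].
    by rewrite mem_enum.
  apply: (@eq_from_nth _ 0%N); first by rewrite size_map.
  move=> i; rewrite sl => li.
  have [u0 _] : exists u : V, True.
    by case: us li {uus mus sl al vals vi} => [|u us]//; exists u.
  rewrite (nth_map u0) // ffunE val_insubd index_uniq //.
  have : nth 0%N l i \in l by rewrite mem_nth ?sl.
  by move/al; rewrite /= mem_iota /= add0n => ->.
rewrite /list_count -(perm_big _ pm) /= big_map big_enum /=.
rewrite cardsE -sum1_card -natz natr_sum [in RHS]big_mkcond /=; apply: eq_bigr => f _.
rewrite -[f \in _]/(injhom H G f).
suff -> : pairs_ok (size us) (Fh H us G) (vals f) = injhom H G f by case: injhom.
have on u : onth us (index u us) = Some u.
  by rewrite onthE (nth_map u) ?index_mem // nth_index.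
have nv u : nth 0%N (vals f) (index u us) = f u.
  by rewrite (nth_map u) ?index_mem // nth_index.
have ix u : index u us \in iota 0 (size us) by rewrite mem_iota /= index_mem.
apply/idP/injhomP => [/allP ok|[fi fh]].
  split=> [x y E|x y xy].
    apply/eqP; apply: contraT => nxy.
    move/allP: (ok _ (ix x)) => /(_ _ (ix y)); rewrite !nv /Fh E adjnn eqxx /=.
    have -> : (index x us == index y us) = false.
      by apply/eqP => E2; move: nxy; rewrite -(nth_index x (mus x)) E2 nth_index ?eqxx.
    by case: ifP.
  move/allP: (ok _ (ix x)) => /(_ _ (ix y)); rewrite !nv /Fh /adjo !on xy adjn_ord.
  case/orP => // /eqP E2.
  have E3 : x = y by rewrite -(nth_index x (mus x)) E2 nth_index.
  by rewrite E3 adj_irr in xy.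
apply/allP => b; rewrite mem_iota /= add0n => bv; apply/allP => c.
rewrite mem_iota /= add0n => cv.
have [u0 _] : exists u : V, True.
  by case: us bv {uus mus vals vi pm on nv ix cv} => [|u us]//; exists u.
have bE : b = index (nth u0 us b) us by rewrite index_uniq.
have cE : c = index (nth u0 us c) us by rewrite index_uniq.
rewrite bE cE !nv /Fh /adjo !on adjn_ord; case: eqVneq => //= bc.
case: ifP => [/fh //|_]; apply/eqP => /val_inj /fi E.
by move: bc; rewrite -bE -cE => /eqP; apply; rewrite bE E -cE.
Qed.

Definition isolated (u : V) : bool := [forall w, ~~ adj H u w].

Definition core : seq V := [seq u <- enum V | ~~ isolated u].

Definition n_iso : nat := count isolated (enum V).

Lemma core_iso_card : (size core + n_iso = #|V|)%N.
Proof. by rewrite size_filter addnC count_predC cardE. Qed.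

Lemma list_count_core : (0 < n)%N ->
  (copies H G * aut H)%:Z =
  (\prod_(j < n_iso) (n%:Z - (size core + j)%:Z)) * list_count core.
Proof.
move=> n0; rewrite -copies_aut.
(* With the isolated vertices in front, they can be peeled off one by one. *)
rewrite -(@list_count_full ([seq u <- enum V | isolated u] ++ core)) //.
- rewrite list_count_cat ?size_filter // => u w;
  rewrite mem_filter => /andP[/forallP h _].
  exact/negbTE.
- rewrite cat_uniq; apply/and3P; split; try by rewrite filter_uniq ?enum_uniq.
  by apply/hasPn => u; rewrite /= !mem_filter => /andP[/negPf ->].
- by move=> u; rewrite mem_cat mem_filter mem_enum /core mem_filter mem_enum !inE
  !andbT orbN.
Qed.

(** The edges cover the non-isolated vertices, at most two each. This ties the [k ^ v] tuples of the
    final sum to an exponent [O(e(H))]. *)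
Lemma size_core : (size core <= 2 * #|edges H|)%N.
Proof.
have -> : size core = #|[set u | ~~ isolated u]|.
  rewrite cardE -(size_map id) map_id; apply: perm_size; apply: uniq_perm.
  - by rewrite filter_uniq ?enum_uniq.
  - exact: enum_uniq.
  by move=> u; rewrite mem_filter !mem_enum !inE andbT.
apply: (@leq_trans #|cover (edges H)|).
  apply/subset_leq_card/subsetP => u; rewrite inE negb_forall => /existsP[w].
  rewrite negbK => uw; apply/bigcupP; exists [set u; w]; first by rewrite in_edges.
  exact: set21.
apply: leq_trans (leq_card_cover _) _; rewrite mulnC -sum_nat_const.
apply: leq_sum => e /edgesP[x [y [_ ->]]]; rewrite cards2; by case: eqP.
Qed.

Lemma mixed_sum_core k S :
  mixed_sum n k (size core) (Fh H core G) S 0 = list_count core.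
Proof.
rewrite /mixed_sum /list_count; congr (\sum_(l <- cart _) _).
apply: (@eq_from_nth _ [::]) => [|i]; rewrite size_mkseq ?size_nseq // => iv.
by rewrite nth_mkseq // nth_nseq iv.
Qed.

End Lists.

Local Open Scope nat_scope.

(** * Evaluation of expressions *)

Definition evals W (e : expr) (a : ast) (z : int) : Prop := esafe W e a /\ ev e a = z.

Lemma evals_C W a z : `|z| <= W -> evals W (EC z) a z.
Proof. by []. Qed.

Lemma evals_V W a i z : vr a i = z -> `|z| <= W -> evals W (EV i) a z.
Proof. by move=> <-. Qed.

Lemma evals_O W o e1 e2 a z1 z2 z : evals W e1 a z1 -> evals W e2 a z2 ->
  bop o z1 z2 = z -> evals W (EO o e1 e2) a z.
Proof. by move=> [s1 <-] [s2 <-] <-. Qed.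

Lemma evals_L W e a m z : evals W e a (Posz m) -> hp a m = z -> `|z| <= W ->
  evals W (EL e) a z.
Proof. by move=> [s1 E] h zW; split=> //=; rewrite E /= h. Qed.

Fixpoint eprod (f : nat -> expr) (t : nat) : expr :=
  if t is t'.+1 then EO Bmul (eprod f t') (f t') else EC 1.

Lemma evals_prod W f t a (g : nat -> int) : 0 < W ->
  (forall b, b < t -> evals W (f b) a (g b)) ->
  evals W (eprod f t) a (\prod_(b < t) g b)%R.
Proof.
move=> W0; elim: t => [|t IH] h /=; first by rewrite big_ord0; apply: evals_C.
rewrite big_ord_recr; apply: evals_O (h t _) _ => //.
by apply: IH => b bt; apply: h; apply: leqW.
Qed.

Definition epow (e : expr) (t : nat) : expr := eprod (fun=> e) t.

Lemma evals_pow W e t a m : 0 < W -> evals W e a (Posz m) ->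
  evals W (epow e t) a (Posz (m ^ t)).
Proof.
move=> W0 h; have := @evals_prod W (fun=> e) t a (fun=> Posz m) W0 (fun _ _ => h).
by rewrite prodr_const card_ord -[X in evals _ _ _ X -> _]/(Posz m ^+ t)%R -rmorphXn
  /= -natrXE.
Qed.

(** A branch-free equality test: the Euclidean quotient of 1 by [1 + (e1 - e2)^2] is 1 if the values
    agree and 0 otherwise. *)
Definition eeq (e1 e2 : expr) : expr :=
  EO Bdiv (EC 1) (EO Badd (EC 1) (EO Bmul (EO Bsub e1 e2) (EO Bsub e1 e2))).

Lemma evals_eq W e1 e2 a (x y : nat) : 0 < W ->
  evals W e1 a x -> evals W e2 a y -> evals W (eeq e1 e2) a (x == y)%:R.
Proof.
move=> W0 [s1 E1] [s2 E2]; split=> //=; rewrite E1 E2.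
have [->|xy] := eqVneq x y; first by rewrite subrr mulr0 addr0.
by apply: divz_small; apply/andP; split=> //; move/eqP: xy => xy; nia.
Qed.

Definition same (X : seq nat) (a a' : ast) : Prop :=
  (forall r, r \notin X -> vr a' r = vr a r) /\ hp a' = hp a.

Lemma same_trans X Y Z a b c : all (mem Z) X -> all (mem Z) Y ->
  same X a b -> same Y b c -> same Z a c.
Proof.
move=> /allP XZ /allP YZ [r1 h1] [r2 h2]; split; last by rewrite h2.
move=> r rZ; rewrite r2 ?r1 //; apply: contra rZ; [exact: XZ | exact: YZ].
Qed.

Lemma same_setv X Z a b i z : all (mem Z) (i :: X) ->
  same X a b -> same Z a (setv b i z).
Proof.
move=> /= /andP[iZ XZ] s; apply: (@same_trans X [:: i] Z _ b) => //=.
  by rewrite iZ.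
by split=> // r; rewrite inE /= /upd => /negPf ->.
Qed.

Lemma same_set1 Z a i z : i \in Z -> same Z a (setv a i z).
Proof. by move=> iZ; apply: (@same_setv [::]) => //=; rewrite iZ. Qed.

Lemma sameE X a b r : same X a b -> r \notin X -> vr b r = vr a r.
Proof. by case=> h _; apply: h. Qed.

(** * The program *)

Section Program.

Variables (v : nat) (ef : nat -> nat -> bool).

(* Variables: 0 [n]; 1 [ceil(1/eps)]; 2 [n + 1]; 3 [n * n]; 4 [k]; 5, 6 the
   arguments [x], [y] of the kernel; 7, 8 its partial product and current
   factor; 9, 14, 16 loop counters; 10 the score of [x]; 11 the number of
   elements chosen so far; 12, 13 the best candidate and its score; 15 the sum
   over the tuples of samples; 17 [k ^ v]; 18 the result.
   Heap: entry [(x, y)] of [A^2 + (n+1) A] at [x * n + y], and the element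
   [S_b[i]] at [n * n + (b * k + i)]. *)
Definition eM (e1 e2 : expr) : expr := EL (EO Badd (EO Bmul e1 (EV 0)) e2).
(** Codegrees are at most [n], so division by [n + 1] isolates the adjacency bit and leaves the
    codegree as remainder. *)
Definition eA (e1 e2 : expr) : expr := EO Bdiv (eM e1 e2) (EV 2).
Definition ecod (e1 e2 : expr) : expr := EO Bsub (eM e1 e2) (EO Bmul (EV 2) (eA e1 e2)).
Definition eF (fl : bool) (e1 e2 : expr) : expr :=
  if fl then eA e1 e2 else EO Bsub (EC 1) (eeq e1 e2).
Definition eS (b : nat) (e : expr) : expr :=
  EL (EO Badd (EV 3) (EO Badd (EO Bmul (EC b) (EV 4)) e)).

(** For [b > a] the sum over [V(G)] is never formed: it is a codegree, or [n - 2 + [x == y]] for the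
    distinctness kernel. *)
Definition facC (a b : nat) : com :=
  if b < a then
    CSeq (CAsn 8 (EC 0))
      (CFor 9 4 (CAsn 8 (EO Badd (EV 8)
         (EO Bmul (eF (ef a b) (EV 5) (eS b (EV 9)))
                  (eF (ef a b) (EV 6) (eS b (EV 9)))))))
  else CAsn 8 (if ef a b then ecod (EV 5) (EV 6)
               else EO Badd (EO Bsub (EV 0) (EC 2)) (eeq (EV 5) (EV 6))).

Fixpoint kapL (a t : nat) : com :=
  if t is b.+1 then
    CSeq (kapL a b)
      (if b == a then CSkip else CSeq (facC a b) (CAsn 7 (EO Bmul (EV 7) (EV 8))))
  else CAsn 7 (EC 1).

Definition kapC (a : nat) : com := kapL a v.

Definition hC (a : nat) : com :=
  CSeq (CAsn 10 (EC 0))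
  (CSeq (CFor 14 11 (CSeq (CAsn 6 (eS a (EV 14)))
          (CSeq (kapC a) (CAsn 10 (EO Badd (EV 10) (EO Bmul (EV 0) (EV 7)))))))
        (CFor 6 0 (CSeq (kapC a)
          (CAsn 10 (EO Bsub (EV 10) (EO Bmul (EV 11) (EV 7))))))).

Definition argC (a : nat) : com :=
  CSeq (CAsn 5 (EC 0)) (CSeq (hC a) (CSeq (CAsn 12 (EC 0)) (CSeq (CAsn 13 (EV 10))
    (CFor 5 0 (CSeq (hC a)
      (CIf (EO Bsub (EV 13) (EV 10)) (CSeq (CAsn 12 (EV 5)) (CAsn 13 (EV 10))))))))).

Definition herdC (a : nat) : com :=
  CFor 11 4 (CSeq (argC a)
    (CSt (EO Badd (EV 3) (EO Badd (EO Bmul (EC a) (EV 4)) (EV 11))) (EV 12))).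

Fixpoint herdL (t : nat) : com :=
  if t is a.+1 then CSeq (herdL a) (herdC a) else CSkip.

(** Digit [b] in base [k] of the counter in variable 16, with the remainder expressed through
    quotients. *)
Definition edig (b : nat) : expr :=
  let d := EO Bdiv (EV 16) (epow (EV 4) b) in
  EO Bsub d (EO Bmul (EV 4) (EO Bdiv d (EV 4))).

Definition epairs : expr :=
  eprod (fun b => eprod (fun c =>
    if b == c then EC 1 else eF (ef b c) (eS b (edig b)) (eS c (edig c))) v) v.

Definition countC : com :=
  CSeq (CAsn 17 (epow (EV 4) v))
  (CSeq (CAsn 15 (EC 0))
        (CFor 16 17 (CAsn 15 (EO Badd (EV 15) epairs)))).

Variables (n_iso aut_H c : nat).

(** The sampled average, times [n ^ v] and the placements of isolated vertices, over the number of
    automorphisms; adding half the denominator rounds to the nearest integer. *)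
Definition eout : expr :=
  let num := EO Bmul (EO Bmul (EV 15) (epow (EV 0) v))
    (eprod (fun j => EO Bsub (EV 0) (EC (v + j)%N)) n_iso) in
  let den := EO Bmul (EV 17) (EC aut_H) in
  EO Bdiv (EO Badd (EO Bmul (EC 2) num) den) (EO Bmul (EC 2) den).

Definition mainC : com :=
  CSeq (CAsn 4 (EO Bmul (EO Bmul (EC c) (EV 1)) (EO Bmul (EC c) (EV 1))))
  (CSeq (herdL v) (CSeq countC (CAsn 18 eout))).

(** Writes [A + (n+1) I] right behind [A], the input layout of the multiplication program; cell [t]
    lies in row [t / n] and column [t mod n]. *)
Definition prepC : com :=
  CSeq (CAsn 2 (EO Badd (EV 0) (EC 1)))
  (CSeq (CAsn 3 (EO Bmul (EV 0) (EV 0)))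
  (CFor 16 3 (CSt (EO Badd (EV 3) (EV 16))
    (EO Badd (EL (EV 16)) (EO Bmul (EV 2)
       (eeq (EO Bdiv (EV 16) (EV 0))
            (EO Bsub (EV 16) (EO Bmul (EV 0) (EO Bdiv (EV 16) (EV 0)))))))))).

Section Verification.

Variables (n k W : nat) (A : nat -> nat -> bool).
Hypotheses (n0 : 0 < n) (k0 : 0 < k).

(** An abstract [Fh], which it unfolds to when [ef] is [adjo H us] and [A] is [adjn G]. *)
Definition F (a b x y : nat) : bool :=
  (a == b) || (if ef a b then A x y else x != y).

(** [W] caps every value read: [W_n] serves the entries of the encoded matrix, [W_p] the scores and
    kernel products, [W_v] the constants of the code. *)
Hypothesis W_n : (n.+1) * (n.+1) <= W.
Hypothesis W_p : n * k * (n + k) ^ v <= W.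
Hypothesis W_v : v + 2 <= W.

Definition cod (x y : nat) : nat := \sum_(z < n) A x z * A y z.

(** Rows of the sample table below [al] are complete, and row [al] has its first [j] entries. [S] is
    total, its values elsewhere being arbitrary. *)
Record Mem (S : nat -> nat -> nat) (al j : nat) (a : ast) : Prop := {
  mem0 : vr a 0 = n;
  mem2 : vr a 2 = n.+1;
  mem3 : vr a 3 = n * n;
  mem4 : vr a 4 = k;
  memM : forall x y, x < n -> y < n -> hp a (x * n + y) = cod x y + n.+1 * A x y;
  memS : forall b i, b < al -> i < k -> hp a (n * n + (b * k + i)) = S b i;
  memT : forall i, i < j -> hp a (n * n + (al * k + i)) = S al i }.

Lemma Mem_same X S al j a a' : same X a a' -> all (fun r => r \notin X) [:: 0; 2; 3;
  4] ->
  Mem S al j a -> Mem S al j a'.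
Proof.
move=> [r h] /and5P[x0 x2 x3 x4 _] [m0 m2 m3 m4 mM mS mT].
by split; rewrite ?h ?r.
Qed.

Lemma pow_ge1 : 0 < (n + k) ^ v.
Proof. by rewrite expn_gt0 addn_gt0 n0. Qed.

Lemma W_gt0 : 0 < W.
Proof. by apply: leq_trans W_n. Qed.

Lemma W_k : k <= W.
Proof.
apply: leq_trans W_p; rewrite -mulnA mulnCA; apply: leq_pmulr.
by rewrite muln_gt0 n0 pow_ge1.
Qed.

Lemma W_S : n.+1 <= W.
Proof. by apply: leq_trans W_n; rewrite leq_pmulr. Qed.

Lemma W_nn : n * n <= W.
Proof. by apply: leq_trans W_n; rewrite leq_mul. Qed.

Lemma leq_cod x y : cod x y <= n.
Proof.
rewrite -[X in _ <= X]card_ord -sum1_card; apply: leq_sum => z _.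
by case: (A x z); case: (A y z).
Qed.

(** * Reading the encoded matrix and the sample table *)

Section Values.

Variables (S : nat -> nat -> nat) (al j : nat) (st : ast).
Hypothesis S_lt : forall b i, S b i < n.
Hypothesis memst : Mem S al j st.

Let v0 : evals W (EV 0) st n.
Proof. by apply: evals_V (mem0 memst) _; apply: leq_trans W_S. Qed.

Let v2 : evals W (EV 2) st n.+1.
Proof. by apply: evals_V (mem2 memst) _; apply: W_S. Qed.

Lemma evals_M e1 e2 x y : x < n -> y < n -> evals W e1 st x -> evals W e2 st y ->
  evals W (eM e1 e2) st (cod x y + n.+1 * A x y)%N.
Proof.
move=> xn yn h1 h2; apply: (@evals_L _ _ _ (x * n + y)).
- apply: evals_O h2 _; first by apply: evals_O h1 v0 _.
  by rewrite /= -PoszM -PoszD.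
- exact: (memM memst).
- rewrite /=; apply: leq_trans W_n; have := leq_cod x y.
  by case: (A x y) => /=; nia.
Qed.

Lemma evals_A e1 e2 x y : x < n -> y < n -> evals W e1 st x -> evals W e2 st y ->
  evals W (eA e1 e2) st (A x y)%:R.
Proof.
move=> xn yn h1 h2; apply: evals_O v2 _; first exact: evals_M h1 h2.
rewrite /= divz_nat mulnC divnDMl // divn_small ?add0n ?natz // ltnS.
exact: leq_cod.
Qed.

Lemma evals_cod e1 e2 x y : x < n -> y < n -> evals W e1 st x -> evals W e2 st y ->
  evals W (ecod e1 e2) st (cod x y).
Proof.
move=> xn yn h1 h2; apply: evals_O; first exact: evals_M h1 h2.
  by apply: evals_O v2 _ _; [exact: evals_A h1 h2|].
by rewrite /=; case: (A x y); lia.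
Qed.

Lemma evals_F a b e1 e2 x y : a != b -> x < n -> y < n ->
  evals W e1 st x -> evals W e2 st y -> evals W (eF (ef a b) e1 e2) st (F a b x y)%:R.
Proof.
move=> ab xn yn h1 h2; rewrite /eF /F (negPf ab) /=; case: ifP => _.
  exact: evals_A h1 h2.
apply: (@evals_O _ _ _ _ _ 1%R _ _ _ (evals_eq W_gt0 h1 h2)).
  by apply: evals_C; apply: W_gt0.
by case: (x == y).
Qed.

Lemma evals_S b e i : b < v -> i < k -> (b < al) || ((b == al) && (i < j)) ->
  evals W e st i -> evals W (eS b e) st (S b i).
Proof.
move=> bv ik ok h; apply: (@evals_L _ _ _ (n * n + (b * k + i))).
- apply: evals_O; [apply: evals_V (mem3 memst) _ | apply: evals_O h _ | ] => //.
  + exact: W_nn.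
  + apply: evals_O; [apply: (@evals_C _ _ b) | apply: evals_V (mem4 memst) _ | ] => //.
    * by apply: leq_trans W_v; rewrite (leq_trans (ltnW bv)) // leq_addr.
    * exact: W_k.
  + by rewrite /= -PoszM -!PoszD.
- case/orP: ok => [ba|/andP[/eqP -> ij]]; [exact: (memS memst) | exact: (memT memst)].
- by apply: leq_trans W_S; rewrite /= (leq_trans (ltnW (S_lt _ _))).
Qed.

End Values.

Lemma tri_asn_evals i e a z (Q : ast -> Prop) :
  evals W e a z -> Q (setv a i z) -> tri W (CAsn i e) a 1 Q.
Proof. by move=> [sf <-]; apply: tri_asn. Qed.

Lemma tri_st_evals e1 e2 a m z (Q : ast -> Prop) :
  evals W e1 a (Posz m) -> evals W e2 a z -> Q (seth a m z) -> tri W (CSt e1 e2) a 1 Q.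
Proof. by move=> [s1 E1] [s2 <-] q; apply: tri_st => //; rewrite E1. Qed.

(** * Evaluation of the codegree kernels *)

Definition fac (S : nat -> nat -> nat) (a x y b : nat) : int :=
  (if b == a then 1 else
    if (b < a)%N then \sum_(i < k) (F a b x (S b i))%:R * (F a b y (S b i))%:R
    else \sum_(z < n) (F a b x z)%:R * (F a b y z)%:R)%R.

Lemma kapvE S a x y : kapv n k v F S a x y = (\prod_(b < v) fac S a x y b)%R.
Proof. by []. Qed.

Lemma sum01 t (f g : nat -> bool) :
  (0 <= (\sum_(i < t) (f i)%:R * (g i)%:R : int) <= t%:Z)%R.
Proof.
elim: t => [|t IH]; first by rewrite big_ord0.
rewrite big_ord_recr /= -natrM natz; move: (\sum_(i < t) _)%R IH => X.
by case: (f t); case: (g t) => /=; lia.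
Qed.

Lemma sum_eq t x : x < t -> (\sum_(z < t) (x == z :> nat)%:R = 1 :> int)%R.
Proof.
move=> xt; rewrite (bigD1 (Ordinal xt)) //= eqxx big1 ?addr0 // => z zx.
by rewrite eq_sym; move: zx; rewrite -val_eqE /= => /negPf ->.
Qed.

(** For distinctness, the [z] different from both [x] and [y] are all but two, or all but one when
    [x = y]. *)
Lemma fac_gt S a x y b : a < b -> x < n -> y < n ->
  fac S a x y b = (if ef a b then (cod x y)%:Z else n%:Z - 2 + (x == y)%:R)%R.
Proof.
move=> ab xn yn; rewrite /fac gtn_eqF // ltnNge ltnW //=.
rewrite /F (ltn_eqF ab) /=; case: ifP => _.
  rewrite /cod -natz natr_sum; apply: eq_bigr => z _.
  by rewrite -natrM.
have -> : (\sum_(z < n) (x != z :> nat)%:R * (y != z :> nat)%:R =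
    \sum_(z < n) (1 - (x == z :> nat)%:R - (y == z :> nat)%:R +
      (x == y)%:R * (x == z :> nat)%:R) :> int)%R.
  apply: eq_bigr => z _; case: (eqVneq x z) => [->|xz].
    by case: (eqVneq y z).
  by case: (eqVneq y z); rewrite /= ?mulr0 ?mulr1.
rewrite big_split /= sumrB sumrB -mulr_sumr !sum_eq // sumr_const card_ord natz.
by case: (x == y) => /=; lia.
Qed.

Lemma fac_bounds S a x y b : (0 <= fac S a x y b <= (n + k)%:Z)%R.
Proof.
rewrite /fac; case: eqP => _; first by lia.
case: ifP => _.
  have := sum01 k (fun i => F a b x (S b i)) (fun i => F a b y (S b i)); lia.
have := sum01 n (fun i => F a b x i) (fun i => F a b y i); lia.
Qed.

Lemma facs_bounds S a x y t :
  (0 <= \prod_(b < t) fac S a x y b <= ((n + k) ^ t)%:Z)%R.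
Proof.
elim: t => [|t IH]; first by rewrite big_ord0.
rewrite big_ord_recr /= expnSr PoszM.
have /andP[h1 h2] := fac_bounds S a x y t; case/andP: IH => h3 h4.
by rewrite mulr_ge0 //= ler_pM.
Qed.

Lemma kapv_bounds S a x y : (0 <= kapv n k v F S a x y <= ((n + k) ^ v)%:Z)%R.
Proof. exact: facs_bounds. Qed.

Lemma leqW_k t : t <= k -> t <= W.
Proof. by move=> tk; apply: leq_trans W_k. Qed.

Lemma leqW_n t : t <= n -> t <= W.
Proof. by move=> tn; apply: leq_trans W_S; apply: leqW. Qed.

Lemma leqW_P (z : int) : (0 <= z <= ((n + k) ^ v)%:Z)%R -> `|z| <= W.
Proof.
move=> zP; have : `|z| <= (n + k) ^ v by lia.
move=> h; apply: leq_trans h _; apply: leq_trans W_p.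
by apply: leq_pmull; rewrite muln_gt0 n0.
Qed.

Lemma tri_fac S a b j st (x y : nat) : (forall b i, S b i < n) -> Mem S a j st ->
  b < v -> b != a -> vr st 5 = x -> vr st 6 = y -> x < n -> y < n ->
  tri W (facC a b) st (k * 3 + 3) (fun st' =>
    vr st' 8 = fac S a x y b /\ same [:: 8; 9] st st').
Proof.
move=> Slt ms bv ba vx vy xn yn; rewrite /facC.
have W0 := W_gt0.
case: (ltnP b a) => [lba|gba]; last first.
  have {}gba : a < b by rewrite ltn_neqAle eq_sym ba gba.
  apply: (@tri_weaken _ _ _ 1 _ (fun st' =>
    vr st' 8 = fac S a x y b /\ same [:: 8; 9] st st')) => //; last by rewrite addnS.
  apply: (@tri_asn_evals _ _ _ (fac S a x y b)); last by split=> //; apply: same_set1.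
  have ex : evals W (EV 5) st x by apply: evals_V => //; apply: leqW_n; apply: ltnW.
  have ey : evals W (EV 6) st y by apply: evals_V => //; apply: leqW_n; apply: ltnW.
  rewrite fac_gt //; case: ifP => _; first exact: evals_cod ms _ _ _ _ xn yn ex ey.
  apply: evals_O (evals_eq W0 ex ey) _ => //.
  apply: (@evals_O _ _ _ _ _ n 2) => //.
    by apply: evals_V (mem0 ms) _; apply: leqW_n.
  by apply: evals_C; apply: leq_trans W_v; rewrite leq_addl.
have -> : k * 3 + 3 = 1 + (k * 1.+2).+2 by rewrite add1n addn3.
apply: tri_seq; apply: (@tri_asn_evals _ _ _ 0%R); first exact: evals_C.
set st1 := setv _ _ _.
have s1 : same [:: 8; 9] st st1 by apply: same_set1.
apply: (@tri_post _ _ _ _ (fun s => [/\ vr s 9 = k,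
    vr s 8 = (\sum_(i < k) (F a b x (S b i))%:R * (F a b y (S b i))%:R)%R &
    same [:: 8; 9] st s])); last first.
  by move=> s [_ -> ss]; split=> //; rewrite /fac (negPf ba) lba.
apply: (tri_for (N := k) (U := 1) (Inv := fun (t : nat) s => [/\ vr s 9 = t,
    vr s 8 = (\sum_(i < t) (F a b x (S b i))%:R * (F a b y (S b i))%:R)%R &
    same [:: 8; 9] st s])) => //.
- exact: W_k.
- by move=> t s [-> _ ss]; rewrite (sameE ss) // (mem4 ms).
- by split=> //; [rewrite big_ord0 | apply: same_setv s1].
move=> t s tk [v9 v8 ss].
have ms' : Mem S a j s by apply: Mem_same ss _ ms.
have e9 : evals W (EV 9) s t by apply: evals_V => //; apply: leqW_k; apply: ltnW.
have eS' : evals W (eS b (EV 9)) s (S b t) by apply: (evals_S Slt ms') => //;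
  rewrite lba.
have ex : evals W (EV 5) s x by apply: evals_V; [rewrite (sameE ss)|apply: leqW_n;
  apply: ltnW].
have ey : evals W (EV 6) s y by apply: evals_V; [rewrite (sameE ss)|apply: leqW_n;
  apply: ltnW].
have ab : a != b by rewrite eq_sym.
apply: tri_asn_evals.
  apply: evals_O; [apply: evals_V v8 _ | apply: evals_O | ].
  - have := sum01 t (fun i => F a b x (S b i)) (fun i => F a b y (S b i)).
    by have := leqW_k (ltnW tk); lia.
  - exact: (evals_F ms' ab xn (Slt _ _) ex eS').
  - exact: (evals_F ms' ab yn (Slt _ _) ey eS').
  - by [].
  - by [].
split=> //; split=> //; first by rewrite big_ord_recr.
by apply: (@same_setv [:: 8; 9]) => //; apply: same_setv ss.
Qed.

Definition Uk : nat := 1 + v * (k * 3 + 4).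

Lemma tri_kap S a j st (x y : nat) : (forall b i, S b i < n) -> Mem S a j st ->
  vr st 5 = x -> vr st 6 = y -> x < n -> y < n ->
  tri W (kapC a) st Uk (fun st' =>
    vr st' 7 = kapv n k v F S a x y /\ same [:: 7; 8; 9] st st').
Proof.
move=> Slt ms vx vy xn yn; rewrite kapvE /kapC /Uk.
have H : forall t, t <= v -> tri W (kapL a t) st (1 + t * (k * 3 + 4)) (fun st' =>
    vr st' 7 = (\prod_(b < t) fac S a x y b)%R /\ same [:: 7; 8; 9] st st').
  elim=> [_|t IH tv] /=.
    apply: tri_asn_evals; first by apply: evals_C; apply: W_gt0.
    by rewrite big_ord0; split=> //; apply: same_set1.
  have -> : 1 + t.+1 * (k * 3 + 4) = (1 + t * (k * 3 + 4)) + (k * 3 + 4) by lia.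
  apply: tri_seq; apply: tri_post (IH (ltnW tv)) _ => s [v7 ss].
  rewrite big_ord_recr /=; case: eqP => [ta|/eqP ta].
    apply: (@tri_weaken _ _ _ 0 _ (fun s' => s' = s)) => //; first exact: tri_skip.
    move=> s' ->; have -> : fac S a x y t = 1%R by rewrite /fac ta eqxx.
    by rewrite mulr1.
  have -> : k * 3 + 4 = (k * 3 + 3) + 1 by lia.
  have ms' : Mem S a j s by apply: Mem_same ss _ ms.
  apply: tri_seq; apply: tri_post (tri_fac (x := x) (y := y) Slt ms' tv ta _ _ xn yn)
    _ => //.
  - by rewrite (sameE ss).
  - by rewrite (sameE ss).
  move=> s1 [v8 ss1].
  have ss2 : same [:: 7; 8; 9] st s1 by apply: same_trans ss ss1.
  have v7' : vr s1 7 = (\prod_(b < t) fac S a x y b)%R by rewrite (sameE ss1).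
  apply: tri_asn_evals.
    apply: evals_O; [apply: evals_V v7' _ | apply: evals_V v8 _ | by []].
    + apply: leqW_P; case/andP: (facs_bounds S a x y t) => -> /= h; apply: le_trans h _.
      by rewrite lez_nat leq_pexp2l ?addn_gt0 ?n0 // ltnW.
    + have := fac_bounds S a x y t;
      have /leqW_P : (0 <= (n + k)%:Z <= ((n + k) ^ v)%:Z)%R.
        by rewrite lez_nat -[X in (X <= _)%N]expn1 leq_pexp2l ?addn_gt0 ?n0 //
          (leq_ltn_trans _ tv).
      by rewrite /=; lia.
  by split=> //; apply: same_setv ss2.
exact: H.
Qed.

(** * Scores and the choice of a minimizer *)

Definition Uh : nat := k * (Uk + 4) + n * (Uk + 3) + 5.

Lemma sum_kap_bounds t (f : nat -> int) :
  (forall i, 0 <= f i <= ((n + k) ^ v)%:Z)%R ->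
  (0 <= \sum_(i < t) f i <= (t * (n + k) ^ v)%:Z)%R.
Proof.
move=> h; elim: t => [|t IH]; first by rewrite big_ord0.
rewrite big_ord_recr /= mulSn PoszD addrC; move: IH (h t) => /andP[h1 h2] /andP[h3 h4].
by rewrite addr_ge0 //= lerD.
Qed.

(** A difference of two numbers between 0 and [n * k * (n + k) ^ v]. The free range [u] covers the
    running score in both loops. *)
Lemma hsum_bounds (t u : nat) (f g : nat -> int) : t <= k -> u <= n ->
  (forall i, 0 <= f i <= ((n + k) ^ v)%:Z)%R ->
  (forall i, 0 <= g i <= ((n + k) ^ v)%:Z)%R ->
  `|(n%:Z * \sum_(i < t) f i - t%:Z * \sum_(i < u) g i)%R| <= W.
Proof.
move=> tk un hf hg; apply: leq_trans W_p.
have := sum_kap_bounds t hf; have := sum_kap_bounds u hg.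
move: (\sum_(i < t) f i)%R (\sum_(i < u) g i)%R ((n + k) ^ v) => X Y P.
rewrite !PoszM => /andP[h1 h2] /andP[h3 h4].
have h5 : (n%:Z * X <= n%:Z * (k%:Z * P%:Z))%R.
  by apply: ler_wpM2l => //; apply: le_trans h4 _; apply: ler_wpM2r.
have h6 : (t%:Z * Y <= k%:Z * (n%:Z * P%:Z))%R.
  apply: ler_pM => //; apply: le_trans h2 _; exact: ler_wpM2r.
have h7 : (0 <= n%:Z * X)%R by apply: mulr_ge0.
have h8 : (0 <= t%:Z * Y)%R by apply: mulr_ge0.
have h9 : (k%:Z * (n%:Z * P%:Z) = n%:Z * (k%:Z * P%:Z))%R by ring.
have h10 : Posz (n * k * P) = (n%:Z * (k%:Z * P%:Z))%R by rewrite !PoszM mulrA.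
move: h5 h6 h7 h8; rewrite h9 -h10; lia.
Qed.

Lemma tri_h S a (j : nat) st (x : nat) : (forall b i, S b i < n) -> Mem S a j st -> a
  < v ->
  j <= k -> vr st 11 = j -> vr st 5 = x -> x < n ->
  tri W (hC a) st Uh (fun st' =>
    vr st' 10 = hval n k v F S a j x /\ same [:: 6; 7; 8; 9; 10; 14] st st').
Proof.
move=> Slt ms av jk vj vx xn.
have W0 := W_gt0.
apply: (@tri_weaken _ _ _ (1 + ((j * (1 + (Uk + 1)).+2).+2 + (n * (Uk + 1).+2).+2)) _
  (fun st' =>
    vr st' 10 = hval n k v F S a j x /\ same [:: 6; 7; 8; 9; 10; 14] st st')) => //;
      last first.
  rewrite /Uh; have : j * (Uk + 4) <= k * (Uk + 4) by rewrite leq_mul.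
  lia.
set X := [:: 6; 7; 8; 9; 10; 14].
have kb := kapv_bounds S a x.
apply: tri_seq; apply: (@tri_asn_evals _ _ _ 0%R); first exact: evals_C.
set st1 := setv _ _ _.
have s1 : same X st st1 by apply: same_set1.
apply: tri_seq.
apply: (@tri_post _ _ _ _ (fun s => [/\ vr s 14 = j,
    vr s 10 = (n%:Z * \sum_(i < j) kapv n k v F S a x (S a i) - j%:Z * \sum_(i < 0)
      kapv n k v F S a x i)%R &
    same X st s])).
- apply: tri_post (tri_for (N := j) (Inv := fun (t : nat) s => [/\ vr s 14 = t,
    vr s 10 = (n%:Z * \sum_(i < t) kapv n k v F S a x (S a i) - t%:Z * \sum_(i < 0)
      kapv n k v F S a x i)%R &
    same X st s]) _ _ _ _ _) _ => //.
  + exact: leqW_k.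
  + by move=> t s [-> _ ss]; rewrite (sameE ss).
  + by split=> //; [rewrite !big_ord0 !mulr0 subrr | apply: same_setv s1].
  move=> t s tj [v14 v10 ss].
  have ms' : Mem S a j s by apply: Mem_same ss _ ms.
  apply: tri_seq; apply: (@tri_asn_evals _ _ _ (S a t)).
    apply: (evals_S Slt ms') => //; first exact: leq_trans tj jk.
      by rewrite eqxx tj orbT.
    by apply: evals_V => //; apply: leqW_k; apply: leq_trans (ltnW tj) jk.
  set s2 := setv _ _ _.
  have ss2 : same X st s2 by apply: same_setv ss.
  have ms2 : Mem S a j s2 by apply: Mem_same ss2 _ ms.
  apply: tri_seq; apply: tri_post (tri_kap (x := x) (y := S a t) Slt ms2 _ _ xn (Slt
    _ _)) _ => //.
    by rewrite (sameE ss2).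
  move=> s3 [v7 ss3].
  have ss4 : same X st s3 by apply: same_trans ss2 ss3.
  have v10' : vr s3 10 = vr s 10 by rewrite (sameE ss3).
  rewrite v10 in v10'.
  have v0' : vr s3 0 = n by rewrite (sameE ss4) // (mem0 ms).
  apply: tri_asn_evals.
    apply: evals_O; [apply: evals_V v10' _ | apply: evals_O;
      [apply: evals_V v0' _|apply: evals_V v7 _|by []] | by []].
    + apply: (@hsum_bounds t 0 (fun i => kapv n k v F S a x (S a i)) (kapv n k v F S
      a x)) => //.
      exact: leq_trans (ltnW tj) jk.
    + exact: leqW_n.
    + exact: (leqW_P (kb _)).
  split; first by rewrite /= /upd /= (sameE ss3).
  split=> //; last by apply: (@same_setv X) => //; apply: same_setv ss4.
  by rewrite /= /upd /= big_ord_recr /= !big_ord0 !mulr0 !subr0 mulrDr.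
move=> s [v14 v10 ss].
apply: (@tri_post _ _ _ _ (fun s => [/\ vr s 6 = n,
    vr s 10 = (n%:Z * \sum_(i < j) kapv n k v F S a x (S a i) - j%:Z * \sum_(i < n)
      kapv n k v F S a x i)%R &
    same X st s])); last by move=> s' [_ -> ss'].
apply: (tri_for (N := n) (Inv := fun (t : nat) s => [/\ vr s 6 = t,
    vr s 10 = (n%:Z * \sum_(i < j) kapv n k v F S a x (S a i) - j%:Z * \sum_(i < t)
      kapv n k v F S a x i)%R &
    same X st s])) => //.
- exact: leqW_n.
- by move=> t s' [-> _ ss']; rewrite (sameE ss') // (mem0 ms).
- by split=> //; apply: same_setv ss.
move=> t s' tn [v6 v10' ss'].
have ms' : Mem S a j s' by apply: Mem_same ss' _ ms.
apply: tri_seq; apply: tri_post (tri_kap (x := x) (y := t) Slt ms' _ _ xn tn) _ => //.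
  by rewrite (sameE ss').
move=> s3 [v7 ss3].
have ss4 : same X st s3 by apply: same_trans ss' ss3.
have v10'' : vr s3 10 = vr s' 10 by rewrite (sameE ss3).
rewrite v10' in v10''.
have vj' : vr s3 11 = j by rewrite (sameE ss4).
apply: tri_asn_evals.
  apply: evals_O; [apply: evals_V v10'' _ | apply: evals_O;
    [apply: evals_V vj' _|apply: evals_V v7 _|by []] | by []].
  + apply: (@hsum_bounds j t (fun i => kapv n k v F S a x (S a i)) (kapv n k v F S a
    x)) => //.
    exact: ltnW.
  + exact: leqW_k.
  + exact: (leqW_P (kb _)).
split; first by rewrite /= /upd /= (sameE ss3).
split=> //; last by apply: (@same_setv X) => //; apply: same_setv ss4.
by rewrite /= /upd /= big_ord_recr /=; ring.
Qed.

Definition Ua : nat := Uh + 5 + n * (Uh + 5).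

Lemma hval_bounds S a j x : j <= k -> `|hval n k v F S a j x| <= W.
Proof.
move=> jk.
apply: (@hsum_bounds j n (fun i => kapv n k v F S a x (S a i)) (kapv n k v F S a x))
  => // i;
  exact: kapv_bounds.
Qed.

Lemma tri_arg S a (j : nat) st : (forall b i, S b i < n) -> Mem S a j st -> a < v ->
  j < k -> vr st 11 = j ->
  tri W (argC a) st Ua (fun st' => exists best : nat, [/\ best < n, vr st' 12 = best,
    forall x, x < n -> (hval n k v F S a j best <= hval n k v F S a j x)%R &
    same [:: 5; 6; 7; 8; 9; 10; 12; 13; 14] st st']).
Proof.
move=> Slt ms av jk vj; set Y := [:: 5; 6; 7; 8; 9; 10; 12; 13; 14].
have W0 := W_gt0.
have hb x := hval_bounds S a x (ltnW jk).
have -> : Ua = 1 + (Uh + (1 + (1 + (n * (Uh + 3).+2).+2))) by rewrite /Ua; lia.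
apply: tri_seq; apply: (@tri_asn_evals _ _ _ 0%R); first exact: evals_C.
set s1 := setv _ _ _.
have ss1 : same Y st s1 by apply: same_set1.
have ms1 : Mem S a j s1 by apply: Mem_same ss1 _ ms.
apply: tri_seq; apply: tri_post (tri_h (x := 0) Slt ms1 av (ltnW jk) vj _ n0) _ => //.
move=> s2 [v10 ss2].
have ss2' : same Y st s2 by apply: same_trans ss1 ss2.
apply: tri_seq; apply: (@tri_asn_evals _ _ _ 0%R); first exact: evals_C.
apply: tri_seq; apply: tri_asn_evals; first by apply: (@evals_V _ _ _ _ v10).
set s3 := setv _ _ _.
have ss3 : same Y st s3 by apply: (@same_setv Y) => //; apply: same_setv ss2'.
pose Inv (t : nat) s := exists best : nat, [/\ best < n, vr s 12 = best,
    vr s 13 = hval n k v F S a j best,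
    forall x, x < t -> (hval n k v F S a j best <= hval n k v F S a j x)%R &
    vr s 5 = t /\ same Y st s].
apply: (@tri_post _ _ _ _ (Inv n)); last first.
  by move=> s [best [b1 b2 b3 b4 [_ b5]]]; exists best.
apply: (tri_for (N := n) (Inv := Inv)) => //.
- exact: leqW_n.
- by move=> t s [best [_ _ _ _ [-> ss]]]; rewrite (sameE ss) // (mem0 ms).
(* Vertex 0, scored before the loop, is the initial candidate; it exists because [0 < n]. *)
- by exists 0; split=> //; split=> //; apply: same_setv ss3.
move=> t s tn [best [bn v12 v13 bmin [v5 ss]]].
have ms' : Mem S a j s by apply: Mem_same ss _ ms.
apply: tri_seq; apply: tri_post (tri_h (x := t) Slt ms' av (ltnW jk) _ v5 tn) _.
  by rewrite (sameE ss).
move=> s' [v10' ss'].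
have ss4 : same Y st s' by apply: same_trans ss ss'.
have v13' : vr s' 13 = hval n k v F S a j best by rewrite (sameE ss').
have v12' : vr s' 12 = best by rewrite (sameE ss').
have v5' : vr s' 5 = t by rewrite (sameE ss').
have [sf E] : evals W (EO Bsub (EV 13) (EV 10)) s'
    (hval n k v F S a j best - hval n k v F S a j t)%R.
  by apply: evals_O (evals_V v13' _) (evals_V v10' _) _.
apply: tri_if => //; rewrite E => cmp.
  apply: (@tri_seq _ _ _ _ 1 1).
  apply: tri_asn_evals; first by apply: evals_V v5' _; apply: leqW_n; apply: ltnW.
  apply: tri_asn_evals; first by apply: (@evals_V _ _ _ _ v10').
  split=> //; exists t; split=> //; last first.
    split=> //; apply: (@same_setv Y) => //; apply: (@same_setv Y) => //.
    exact: same_setv ss4.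
  move=> x; rewrite ltnS leq_eqVlt => /orP[/eqP->//|xt].
  by apply: le_trans (bmin x xt); apply: ltW; rewrite -subr_gt0.
split=> //; exists best; split=> //; last by split=> //; apply: same_setv ss4.
move=> x; rewrite ltnS leq_eqVlt => /orP[/eqP->|xt]; last exact: bmin.
by rewrite -subr_le0.
Qed.

(** * Herding one coordinate after the other *)

Definition greedy (S : nat -> nat -> nat) (a m : nat) : Prop :=
  forall j, j < m -> forall x, x < n ->
    (hval n k v F S a j (S a j) <= hval n k v F S a j x)%R.

Lemma kapv_ext S S' a x y : (forall b i, b < a -> i < k -> S b i = S' b i) ->
  kapv n k v F S a x y = kapv n k v F S' a x y.
Proof.
move=> h; apply: eq_bigr => b _; case: eqP => // _; case: ifP => // ba.
by apply: eq_bigr => i _; rewrite h.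
Qed.

(** A score reads only the samples of earlier coordinates and the first [j] of its own, so later
    choices cannot spoil earlier greedy ones. *)
Lemma hval_ext S S' a j x : (forall b i, b < a -> i < k -> S b i = S' b i) ->
  (forall i, i < j -> S a i = S' a i) ->
  hval n k v F S a j x = hval n k v F S' a j x.
Proof.
move=> h1 h2; rewrite /hval; congr (_ * _ - _ * _)%R; apply: eq_bigr => i _.
  by rewrite h2 // (kapv_ext _ _ h1).
exact: kapv_ext.
Qed.

Lemma greedy_ext S S' a m : (forall b i, b < a -> i < k -> S b i = S' b i) ->
  (forall i, i < m -> S a i = S' a i) -> greedy S a m -> greedy S' a m.
Proof.
move=> h1 h2 g j jm x xn.
have h3 i : i < j -> S a i = S' a i by move=> ij; apply: h2; apply: ltn_trans jm.
by rewrite -h2 // -!(hval_ext _ h1 h3); apply: g.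
Qed.

Lemma tri_herd S a st : (forall b i, S b i < n) -> Mem S a 0 st ->
  (forall b, b < a -> greedy S b k) -> a < v ->
  tri W (herdC a) st (k * (Ua + 3)).+2 (fun st' => exists S',
    [/\ forall b i, S' b i < n, Mem S' a.+1 0 st' &
        forall b, b < a.+1 -> greedy S' b k]).
Proof.
move=> Slt ms gr av.
pose Inv (t : nat) s := vr s 11 = t /\ exists S', [/\ forall b i, S' b i < n,
  Mem S' a t s, forall b, b < a -> greedy S' b k & greedy S' a t].
apply: (@tri_post _ _ _ _ (Inv k)); last first.
  move=> s [_ [S' [h1 [m0 m2 m3 m4 mM mS mT] h3 h4]]]; exists S'; split=> //.
    split=> // b i; rewrite ltnS leq_eqVlt => /orP[/eqP->|ba] ik; [exact: mT|exact: mS].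
  by move=> b; rewrite ltnS leq_eqVlt => /orP[/eqP->//|]; apply: h3.
have -> : k * (Ua + 3) = k * (Ua + 1).+2 by rewrite addn1 addn3.
apply: (tri_for (Inv := Inv)) => //.
- exact: W_gt0.
- exact: W_k.
- by move=> t s [-> [S' [_ m _ _]]]; rewrite (mem4 m).
- split=> //; exists S; split=> //.
  by apply: Mem_same ms; [apply: (@same_set1 [:: 11])|].
move=> t s tk [v11 [S' [Slt' m g1 g2]]].
apply: tri_seq; apply: tri_post (tri_arg Slt' m av tk v11) _.
move=> s1 [best [bn v12 bmin ss]].
have m1 : Mem S' a t s1 by apply: Mem_same ss _ m.
have v11' : vr s1 11 = t by rewrite (sameE ss).
apply: (@tri_st_evals _ _ _ (n * n + (a * k + t)) best).
- apply: evals_O; [apply: evals_V (mem3 m1) W_nn | apply: evals_O (evals_V v11' _) _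
  | ].
  + apply: evals_O; [apply: (@evals_C _ _ a) | apply: evals_V (mem4 m1) W_k | by []].
    by apply: leq_trans W_v; rewrite (leq_trans (ltnW av)) // leq_addr.
  + exact: leqW_k (ltnW tk).
  + by [].
  + by rewrite /= -PoszM -!PoszD.
- by apply: evals_V v12 _; apply: leqW_n; apply: ltnW.
split=> //; split=> //.
pose S2 b i := if (b == a) && (i == t) then best else S' b i.
have ext b i : b < a -> S' b i = S2 b i by move=> ba; rewrite /S2 (ltn_eqF ba).
have ext2 i : i < t -> S' a i = S2 a i by move=> it; rewrite /S2 (ltn_eqF it) andbF.
exists S2; split.
- by move=> b i; rewrite /S2; case: ifP.
- case: m1 => h0 h2 h3 h4 hM hS hT; split=> //=.
  + move=> x y xn yn; rewrite /upd ifF ?hM //.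
    have : x * n + y < n * n.
      apply: (@leq_trans (x.+1 * n)); first by rewrite mulSn addnC ltn_add2r.
      by rewrite leq_mul2r xn orbT.
    by move=> lt; apply/negbTE; rewrite neq_ltn (leq_trans lt) // leq_addr.
  + move=> b i ba ik; rewrite -ext // /upd ifF ?hS // eqn_add2l.
    have : b * k + i < a * k.
      apply: (@leq_trans (b.+1 * k)); first by rewrite mulSn addnC ltn_add2r.
      by rewrite leq_mul2r ba orbT.
    by move=> lt; apply/negbTE; rewrite neq_ltn (leq_trans lt) // leq_addr.
  + move=> i; rewrite ltnS leq_eqVlt /upd !eqn_add2l => /orP[/eqP->|it].
      by rewrite eqxx /S2 !eqxx.
    by rewrite (ltn_eqF it) hT // ext2.
- move=> b ba; apply: greedy_ext (g1 b ba) => [b' i b'b _|i _]; apply: ext => //.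
  exact: ltn_trans ba.
move=> j; rewrite ltnS leq_eqVlt => /orP[/eqP->|jt] x xn; last first.
  by apply: (greedy_ext (S := S') (m := t)) => //; move=> b i ba _; apply: ext.
have e1 b i : b < a -> i < k -> S' b i = S2 b i by move=> ba _; apply: ext.
have -> : S2 a t = best by rewrite /S2 !eqxx.
by rewrite -!(hval_ext _ e1 ext2); apply: bmin.
Qed.

Lemma tri_herdL S t st : (forall b i, S b i < n) -> Mem S 0 0 st -> t <= v ->
  tri W (herdL t) st (t * (k * (Ua + 3)).+2) (fun st' => exists S',
    [/\ forall b i, S' b i < n, Mem S' t 0 st' &
        forall b, b < t -> greedy S' b k]).
Proof.
move=> Slt ms; elim: t => [_|t IH tv] /=; first by apply: tri_skip; exists S.
rewrite mulSn addnC; apply: tri_seq; apply: tri_post (IH (ltnW tv)) _.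
by move=> s [S' [h1 h2 h3]]; exact: (tri_herd h1 h2 h3 tv).
Qed.

(** * The sum over tuples of samples *)

Lemma sum_divmod (m l : nat) (g : nat -> nat -> int) : 0 < l ->
  (\sum_(i < m * l) g (i %/ l)%N (i %% l)%N = \sum_(r < m) \sum_(i < l) g r i)%R.
Proof.
move=> l0; elim: m => [|m IH]; first by rewrite !big_ord0.
rewrite big_ord_recr /= -IH mulSn addnC big_split_ord /=; congr (_ + _)%R.
apply: eq_bigr => i _.
by rewrite divnMDl // divn_small // addn0 modnMDl modn_small.
Qed.

Definition digits (S : nat -> nat -> nat) (w i : nat) : seq nat :=
  mkseq (fun b => S b ((i %/ k ^ b) %% k)) w.

Lemma mkseqS T (f : nat -> T) m : mkseq f m.+1 = f 0 :: mkseq (fun b => f b.+1) m.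
Proof. by rewrite /mkseq /= -[1]addn0 iotaDl -map_comp. Qed.

(** Base-[k] digits, least significant first, replace [w] nested loops by one counter; the induction
    strips digit 0. *)
Lemma sum_digits S w (f : seq nat -> int) :
  (\sum_(i < k ^ w) f (digits S w i) =
   \sum_(l <- cart (mkseq (fun b => mkseq (S b) k) w)) f l)%R.
Proof.
elim: w S f => [|w IH] S f; first by rewrite big_cart_nil big_ord1.
rewrite mkseqS big_cart_cons sum_mkseq expnSr.
pose g r j := f (S 0 j :: digits (fun b => S b.+1) w r).
have -> : (\sum_(i < k ^ w * k) f (digits S w.+1 i) =
  \sum_(i < k ^ w * k) g (i %/ k)%N (i %% k)%N)%R.
  apply: eq_bigr => i _; rewrite /digits mkseqS expn0 divn1; congr (f (_ :: _)).
  by apply/eq_map => b; rewrite expnS divnMA.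
rewrite sum_divmod // exchange_big /=; apply: eq_bigr => j _.
exact: (IH (fun b => S b.+1) (fun l => f (S 0 j :: l))).
Qed.

Lemma mixed_sum_digits S :
  (mixed_sum n k v F S v = \sum_(i < k ^ v) (pairs_ok v F (digits S v i))%:R)%R.
Proof.
rewrite (sum_digits S v (fun l => (pairs_ok v F l)%:R)%R) /mixed_sum.
congr (\sum_(l <- cart _) _)%R.
apply: (@eq_from_nth _ [::]) => [|b]; rewrite !size_mkseq // => bv.
by rewrite !nth_mkseq // /mixed bv.
Qed.

Lemma W_kv : k ^ v <= W.
Proof.
have : (0 <= (k ^ v)%:Z <= ((n + k) ^ v)%:Z)%R.
  by rewrite /= lez_nat; elim: (v) => // w IH; rewrite !expnS leq_mul // leq_addl.
exact: leqW_P.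
Qed.

Lemma evals_pairs S s (i : nat) : (forall b i, S b i < n) -> Mem S v 0 s ->
  vr s 16 = i -> i < k ^ v -> evals W (epairs) s (pairs_ok v F (digits S v i))%:R%R.
Proof.
move=> Slt ms vi ik; have W0 := W_gt0.
have v4 : evals W (EV 4) s k by apply: evals_V (mem4 ms) W_k.
have v16 : evals W (EV 16) s i by apply: evals_V vi _; apply: leq_trans (ltnW ik) W_kv.
have vd b : evals W (edig b) s ((i %/ k ^ b) %% k)%N.
  have d1 : evals W (EO Bdiv (EV 16) (epow (EV 4) b)) s (i %/ k ^ b)%N.
    by apply: (evals_O v16 (evals_pow _ W0 v4)); rewrite /= divz_nat.
  apply: (evals_O d1).
    apply: (evals_O v4); first by apply: (evals_O d1 v4).
    by [].
  rewrite /= divz_nat; have := divn_eq (i %/ k ^ b) k; nia.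
have vS b : b < v -> evals W (eS b (edig b)) s (S b ((i %/ k ^ b) %% k)).
  by move=> bv; apply: (evals_S Slt ms) => //; rewrite ?ltn_pmod // bv.
set l := digits S v i.
rewrite /pairs_ok all_natr; apply: (@evals_prod _ _ _ _
  (fun b => (all (fun d => F b d (nth 0 l b) (nth 0 l d)) (iota 0 v))%:R%R)) => // b bv.
rewrite all_natr; apply: (@evals_prod _ _ _ _
  (fun d => (F b d (nth 0 l b) (nth 0 l d))%:R%R)) => // d dv.
rewrite !nth_mkseq //; case: eqP => [->|/eqP bd];
  last exact: (evals_F ms bd (Slt _ _) (Slt _ _) (vS b bv) (vS d dv)).
by rewrite /F eqxx; apply: evals_C.
Qed.

Lemma tri_count S st : (forall b i, S b i < n) -> Mem S v 0 st ->
  tri W countC st (k ^ v * 3 + 4) (fun st' =>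
    [/\ vr st' 15 = mixed_sum n k v F S v, vr st' 17 = (k ^ v)%N & Mem S v 0 st']).
Proof.
move=> Slt ms; have W0 := W_gt0.
have -> : k ^ v * 3 + 4 = 1 + (1 + (k ^ v * 1.+2).+2) by lia.
apply: tri_seq; apply: (@tri_asn_evals _ _ _ (k ^ v)%N).
  by apply: evals_pow => //; apply: evals_V (mem4 ms) W_k.
apply: tri_seq; apply: (@tri_asn_evals _ _ _ 0%R); first exact: evals_C.
set s1 := setv _ _ _; set Z := [:: 15; 16; 17].
have ss1 : same Z st s1 by apply: (@same_setv Z) => //; apply: same_set1.
pose Inv (t : nat) s := [/\ vr s 16 = t, vr s 17 = (k ^ v)%N,
  vr s 15 = (\sum_(i < t) (pairs_ok v F (digits S v i))%:R)%R & same Z st s].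
apply: (@tri_post _ _ _ _ (Inv (k ^ v))); last first.
  move=> s [_ h1 h2 h3]; split=> //; first by rewrite mixed_sum_digits.
  exact: Mem_same h3 _ ms.
apply: (tri_for (U := 1) (Inv := Inv)) => //.
- exact: W_kv.
- by move=> t s [-> -> _ _].
- by split=> //; [rewrite big_ord0 | apply: same_setv ss1].
move=> t s tk [h1 h2 h3 h4].
have ms' : Mem S v 0 s by apply: Mem_same h4 _ ms.
apply: tri_asn_evals.
  apply: evals_O (evals_V h3 _) (evals_pairs Slt ms' h1 tk) _; last by [].
  have := sum01 t (fun i => pairs_ok v F (digits S v i)) (fun=> true).
  have -> : (\sum_(i < t) (pairs_ok v F (digits S v i))%:R * true%:R =
    \sum_(i < t) (pairs_ok v F (digits S v i))%:R :> int)%R.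
    by apply: eq_bigr => i _; rewrite mulr1.
  have := leq_trans (ltnW tk) W_kv; move: (\sum_(i < t) _)%R => X; lia.
split=> //; split=> //; first by rewrite big_ord_recr.
by apply: (@same_setv Z) => //; apply: same_setv h4.
Qed.

(** * Input of the multiplication and final estimate *)

Lemma tri_prep st : vr st 0 = n -> (forall i, i < n * n -> `|hp st i| <= 1) ->
  tri W prepC st (n * n * 3 + 4) (fun st' =>
    [/\ vr st' 0 = n /\ vr st' 1 = vr st 1, vr st' 2 = n.+1, vr st' 3 = (n * n)%N,
      forall i, i < n * n -> hp st' (n * n + i) =
        (hp st i + n.+1%:Z * (i %/ n == i %% n)%N%:R)%R &
      forall i, i < n * n \/ n * n + n * n <= i -> hp st' i = hp st i]).
Proof.
move=> v0 hb; have W0 := W_gt0.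
have -> : n * n * 3 + 4 = 1 + (1 + (n * n * 1.+2).+2) by lia.
have e0 : evals W (EV 0) st n by apply: evals_V v0 _; apply: leqW_n.
apply: tri_seq; apply: (@tri_asn_evals _ _ _ n.+1).
  by apply: (evals_O e0 (evals_C _ _)) => //=; rewrite -PoszD addn1.
set s1 := setv _ _ _.
have e1 : evals W (EV 0) s1 n by apply: evals_V v0 _; apply: leqW_n.
apply: tri_seq; apply: (@tri_asn_evals _ _ _ (n * n)%N).
  by apply: (evals_O e1 e1); rewrite /= -PoszM.
set s2 := setv _ _ _.
pose Inv (t : nat) s := [/\ (vr s 0 = n /\ vr s 1 = vr st 1) /\ vr s 16 = t, vr s 2 =
  n.+1, vr s 3 = (n * n)%N,
      forall i, i < t -> hp s (n * n + i) =
        (hp st i + n.+1%:Z * (i %/ n == i %% n)%N%:R)%R &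
      forall i, i < n * n \/ n * n + t <= i -> hp s i = hp st i].
apply: (@tri_post _ _ _ _ (Inv (n * n))); last by move=> s [[h _] h2 h3 h4 h5].
apply: (tri_for (U := 1) (Inv := Inv)) => //.
- exact: W_nn.
- by move=> t s [[_ ->] _ -> _ _].
move=> t s tn [[[h0 h1] h16] h2 h3 h4 h5].
have e16 : evals W (EV 16) s t by apply: evals_V h16 _; apply: leq_trans (ltnW tn) W_nn.
have f0 : evals W (EV 0) s n by apply: evals_V h0 _; apply: leqW_n.
have ed : evals W (EO Bdiv (EV 16) (EV 0)) s (t %/ n)%N.
  by apply: (evals_O e16 f0); rewrite /= divz_nat.
apply: (@tri_st_evals _ _ _ (n * n + t)%N).
- by apply: (evals_O (evals_V h3 W_nn) e16); rewrite /= -PoszD.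
- apply: evals_O; [apply: (evals_L e16) | apply: (evals_O (evals_V h2 W_S)) | by []].
  + by rewrite h5; [|left].
  + exact: leq_trans (hb t tn) W0.
  + apply: (evals_eq W0 ed);
    apply: (@evals_O _ _ _ _ _ t (n * (t %/ n))%N (t %% n)%N) => //.
      by apply: (evals_O f0 ed); rewrite /= -PoszM.
    by rewrite /=; have := divn_eq t n; nia.
  + by [].
split=> //; split=> //=.
- move=> i; rewrite ltnS leq_eqVlt /upd eqn_add2l => /orP[/eqP->|it];
  first by rewrite eqxx.
  by rewrite (ltn_eqF it) h4.
- move=> i hi; rewrite /upd ifF; last by apply/eqP; lia.
  by apply: h5; lia.
Qed.

Variable E : nat.
Hypothesis W_c : n_iso + aut_H + c + E + v + 2 <= W.
Hypothesis kE : k = c * E * (c * E).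

Definition Um : nat := 1 + (v * (k * (Ua + 3)).+2 + (k ^ v * 3 + 4 + 1)).

Definition estimate (m : int) : int :=
  let num := (m * (n ^ v)%N%:Z * \prod_(j < n_iso) (n%:Z - (v + j)%N%:Z))%R in
  let den := Posz (k ^ v * aut_H) in
  ((2 * num + den)%R %/ (2 * den)%R)%Z.

Lemma mixed_sum_bounds S : (0 <= mixed_sum n k v F S v <= (k ^ v)%N%:Z)%R.
Proof.
have := sum01 (k ^ v) (fun i => pairs_ok v F (digits S v i)) (fun=> true).
rewrite mixed_sum_digits;
  suff -> : (\sum_(i < k ^ v) (pairs_ok v F (digits S v i))%:R * true%:R =
    \sum_(i < k ^ v) (pairs_ok v F (digits S v i))%:R :> int)%R by [].
by apply: eq_bigr => i _; rewrite mulr1.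
Qed.

(** The length bound on the result pays for copying it to the output register. *)
Lemma tri_main st : vr st 0 = n -> vr st 1 = E -> vr st 2 = n.+1 -> vr st 3 = (n *
  n)%N ->
  (forall x y, x < n -> y < n -> hp st (x * n + y) = (cod x y + n.+1 * A x y)%N) ->
  tri W mainC st Um (fun st' => exists S,
    [/\ forall b, b < v -> greedy S b k, vr st' 18 = estimate (mixed_sum n k v F S v) &
        bitlen `|vr st' 18| <= (esize eout).+1 * bitlen W]).
Proof.
move=> v0 v1 v2 v3 hM; have W0 := W_gt0.
have e1 : evals W (EO Bmul (EC c) (EV 1)) st (c * E)%N.
  apply: evals_O; [apply: (@evals_C _ _ c) | apply: evals_V v1 _ | by rewrite /=
    -PoszM];
    by rewrite /=; lia.
apply: tri_seq; apply: (@tri_asn_evals _ _ _ k).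
  by apply: (evals_O e1 e1); rewrite /= -PoszM kE.
set s1 := setv _ _ _.
(* No sample is stored yet, so any [S] with values below [n] describes the table. *)
have ms1 : Mem (fun _ _ => 0) 0 0 s1 by split.
apply: tri_seq; apply: tri_post (tri_herdL (S := fun _ _ => 0) _ ms1 (leqnn v)) _ => //.
move=> s2 [S [Slt ms gr]].
apply: tri_seq; apply: tri_post (tri_count Slt ms) _ => s3 [h15 h17 ms3].
suff vo : evals W eout s3 (estimate (mixed_sum n k v F S v)).
  apply: (tri_asn_evals vo); exists S; split=> //; rewrite /= /upd /=.
  by case: vo => sf <-; apply: bitlen_ev sf => //; apply: ltnW; apply: ltn_bitlen.
have e0 : evals W (EV 0) s3 n by apply: evals_V (mem0 ms3) _; apply: leqW_n.
have eden : evals W (EO Bmul (EV 17) (EC aut_H)) s3 (k ^ v * aut_H)%N.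
  apply: evals_O; [apply: evals_V h17 W_kv | apply: (@evals_C _ _ aut_H) | by rewrite
    /= -PoszM].
  by rewrite /=; lia.
have e2 : evals W (EC 2) s3 2 by apply: evals_C; rewrite /=; lia.
apply: evals_O; last by [].
  apply: (fun h => evals_O h eden); last by [].
  apply: (evals_O e2); last by [].
  apply: evals_O; last by [].
    apply: (evals_O (evals_V h15 _) (evals_pow v W0 e0)); last by [].
    by have := mixed_sum_bounds S; have := W_kv; move: (mixed_sum _ _ _ _ _ _) => X;
      lia.
  apply: (evals_prod (g := fun j => (n%:Z - (v + j)%N%:Z)%R)) => // j ji.
  apply: (evals_O e0); last by [].
  by apply: evals_C; rewrite /=; lia.
by apply: (evals_O e2 eden).
Qed.

End Verification.
End Program.

(** * The complete machine program *)

Lemma size_rowmajor n (A : 'M[int]_n) : size (rowmajor A) = n * n.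
Proof. by rewrite /rowmajor size_allpairs size_enum_ord. Qed.

Lemma nth_rowmajor n (A : 'M[int]_n) (i j : 'I_n) :
  nth 0%R (rowmajor A) (i * n + j) = A i j.
Proof.
have gen (s : seq 'I_n) m : m < size s ->
    nth 0%R [seq A i j | i <- s, j <- enum 'I_n] (m * n + j) = A (nth i s m) j.
  elim: s m => [|x s IH] [|m] //=.
    move=> _; rewrite mul0n add0n nth_cat size_map size_enum_ord ltn_ord.
    by rewrite (nth_map i) ?size_enum_ord // nth_ord_enum.
  rewrite ltnS => ms; rewrite nth_cat size_map size_enum_ord mulSn -addnA ltnNge
    leq_addr /=.
  by rewrite addKn; apply: IH.
by rewrite /rowmajor gen ?size_enum_ord // nth_ord_enum.
Qed.

Definition shifted (n : nat) (G : graph 'I_n) : 'M[int]_n :=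
  (adjmx G + (n.+1)%:R%:M)%R.

Lemma mulmx_shifted n (G : graph 'I_n) (i j : 'I_n) :
  (adjmx G *m shifted G)%R i j = (cod n (adjn G) i j + n.+1 * adjn G i j)%N.
Proof.
rewrite /shifted mulmxDr mxE PoszD; congr (_ + _)%R.
  rewrite mxE /cod -natz natr_sum; apply: eq_bigr => z _.
  by rewrite !mxE adjn_ord [adjn G j z]adjnC adjn_ord natrM.
rewrite mul_mx_scalar !mxE adjn_ord PoszM -natz; congr (_ * _)%R.
by rewrite -natz.
Qed.

Lemma layout (Q : program) (i0 i1 : instr) (prep : program) (mid : instr)
    (rel body : program) (t0 t1 : instr) :
  Q = [:: i0; i1] ++ prep ++ [:: mid] ++ rel ++ body ++ [:: t0; t1] ->
  [/\ onth Q 0 = Some i0, onth Q 1 = Some i1 & code_at Q 2 prep] /\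
  [/\ onth Q (2 + size prep) = Some mid, code_at Q (2 + size prep + 1) rel &
      code_at Q (2 + size prep + 1 + size rel) body] /\
  [/\ onth Q (2 + size prep + 1 + size rel + size body) = Some t0,
      onth Q (2 + size prep + 1 + size rel + size body).+1 = Some t1 &
      onth Q (2 + size prep + 1 + size rel + size body).+2 = None].
Proof.
move=> QE.
have : code_at Q 0 ([:: i0; i1] ++ prep ++ [:: mid] ++ rel ++ body ++ [:: t0; t1]).
  by exists [::], [::]; rewrite cats0.
case/code_at_cat=> /code_at_cons[h0 /code_at_cons[h1 _]] /code_at_cat[h2].
case/code_at_cat=> /code_at_cons[h3 _] /code_at_cat[h4] /code_at_cat[h5].
case/code_at_cons=> h6 /code_at_cons[h7 _]; do !split => //.
by apply: onth_default; rewrite QE !size_cat /=; lia.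
Qed.

Section Assembly.

Variables (v : nat) (ef : nat -> nat -> bool) (n_iso aut_H c : nat) (P : program) (T0
  : nat).
Hypotheses (T2 : 2 <= T0) (usP : uses_below T0 P).

(** The inputs are added to variables that are initially 0. Register 1 is cleared before the call,
    since the multiplication program expects [n] as its only register input. *)
Definition full_program : program :=
  let v0 := vreg T0 0 in
  let v1 := vreg T0 1 in
  let prep := ccom T0 prepC 2 in
  let p := 2 + size prep + 1 in
  [:: IAdd v0 v0 0; IAdd v1 v1 1] ++ prep ++ [:: IConst 1 0] ++ relocate P p ++
  ccom T0 (mainC v ef n_iso aut_H c) (p + size (relocate P p)) ++
  [:: IConst 0 0; IAdd 0 0 (vreg T0 18)].

Lemma full_run : exists K, forall n E W (G : graph 'I_n) tP sP,
  let k := c * E * (c * E) in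
  0 < n -> 0 < k -> n.+1 * n.+1 <= W -> n * k * (n + k) ^ v <= W ->
  v + 2 <= W -> n_iso + aut_H + c + E + v + 2 <= W ->
  exec P (init [:: n%:Z%R] (rowmajor (adjmx G) ++ rowmajor (shifted G))) tP sP ->
  mkseq (heap sP) (n * n) = rowmajor (adjmx G *m shifted G)%R ->
  exists t s S,
  [/\ exec full_program (init [:: n%:Z%R; E%:Z%R] (rowmajor (adjmx G))) t s,
      forall b, b < v -> greedy v ef n k (adjn G) S b k,
      reg s 0 = estimate v n_iso aut_H n k (mixed_sum n k v (F ef (adjn G)) S v) &
      t <= tP + K * bitlen W * (n * n * 3 + 4 + Um v n k)].
Proof.
have [K1 H1] := ccom_correct T0 prepC.
have [K2 H2] := ccom_correct T0 (mainC v ef n_iso aut_H c).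
pose v0 := vreg T0 0; pose v1 := vreg T0 1.
pose b0 := bitlen v0 + bitlen v0 + 1 + bitlen 0 + bitlen v1 + bitlen v1 + bitlen 1 +
  3 + bitlen 1 + 1.
pose b1 := bitlen 0 + 1 + bitlen 0 + bitlen 0 + 1 + bitlen (vreg T0 18) + (esize
  (eout v n_iso aut_H)).+1.
exists (K1 + K2 + b0 + b1) => n E W G tP sP k n0 k0 Wn Wp Wv Wc exP hP.
have W0 : 0 < W by apply: leq_trans Wn.
have WB : 0 < W <= 2 ^ bitlen W by rewrite W0 ltnW // ltn_bitlen.
have := layout (Q := full_program) erefl.
move: full_program => Q.
set prep := ccom T0 prepC 2 => -[[i0 i1 cprep] [[imid crel cbody] [it0 it1 itN]]].
rewrite size_relocate in cbody it0 it1 itN.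
set p1 := 2 + size prep in imid crel cbody it0 it1 itN.
set st0 := init _ _.
have nv01 : v0 != v1 by rewrite /v0 /v1 vreg_inj.
have v0T i : (vreg T0 i < 2) = false by rewrite /vreg; apply/negbTE; lia.
have regv i : reg st0 (vreg T0 i) = 0%R.
  by rewrite /= nth_default // leqNgt v0T.
have lowv r i : r < T0 -> (r == vreg T0 i) = false.
  by move=> lr; apply/negbTE; rewrite neq_ltn /vreg (leq_trans lr) // leq_addr.
pose s1 := step (IAdd v0 v0 0) st0.
pose s2 := step (IAdd v1 v1 1) s1.
have g1 : goes Q st0 (bitlen v0 + (bitlen v0 + 1) + (bitlen 0 + bitlen n)) s1.
  apply: (@goes_step _ st0 _ _ _ i0) => //=.
  by rewrite -[nth _ _ v0]/(reg st0 v0) regv.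
have r1v1 : reg s1 v1 = 0%R.
  by rewrite /= /upd [v1 == _]eq_sym (negPf nv01) -[nth _ _ v1]/(reg st0 v1) regv.
have r11 : reg s1 1 = E by rewrite /= /upd lowv.
have g2 : goes Q s1 (bitlen v1 + (bitlen v1 + 1) + (bitlen 1 + bitlen E)) s2.
  apply: (@goes_step _ s1 _ _ _ i1) => //.
  by rewrite /cost r1v1 r11.
pose a0 := Ast (fun i => if i == 0 then n%:Z else if i == 1 then E%:Z else 0)%R
  (nth 0%R (rowmajor (adjmx G))).
have sm2 : sim T0 a0 s2.
  split=> // i; rewrite /= /upd !vreg_inj /=; case: (eqVneq i 0) => [->|i0'] /=.
    by rewrite -[nth _ _ v0]/(reg st0 v0) regv add0r.
  case: eqVneq => [_|i1'] /=; last exact: (regv i).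
  by rewrite -[nth _ _ v1]/(reg st0 v1) regv add0r lowv.
have low2 r : r < T0 -> reg s2 r = reg st0 r.
  by move=> lr; rewrite /= /upd !lowv.
have hb i : i < n * n -> `|hp a0 i| <= 1.
  move=> li /=; have dn : i %/ n < n by rewrite ltn_divLR.
  rewrite (divn_eq i n) -[i %/ n]/(val (Ordinal dn)) -[i %% n]/(val (Ordinal
    (ltn_pmod i n0))).
  by rewrite nth_rowmajor mxE; case: (adj G _ _).
have [u1 [a1 [ru1 lu1 [[q0 q1] q2 q3 q4 q5]]]] :=
  tri_prep n0 k0 Wn Wp Wv (st := a0) erefl hb.
have [s3 [g3 p3 sm3 low3]] := H1 _ _ Q s2 _ _ _ (bitlen_gt0 W) WB cprep sm2 ru1.
pose s4 := step (IConst 1 0) s3.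
have {}p3 : pc s3 = p1 by rewrite p3.
rewrite -p3 in imid.
have g4 : goes Q s3 (bitlen 1 + 1) s4 by apply: (@goes_step _ s3 _ _ _ imid).
(* The heap, with its zero cells beyond the two matrices, is exactly an initial heap of the
   multiplication program. *)
have h4 : heap s4 =1 heap (init [:: n%:Z%R] (rowmajor (adjmx G) ++ rowmajor (shifted
  G))).
  move=> i; rewrite /= (proj2 sm3) nth_cat size_rowmajor.
  case: (ltnP i (n * n)) => [li|gi]; first by rewrite q5 //; left.
  case: (ltnP i (n * n + n * n)) => [li|gi2]; last first.
    rewrite q5; last by right.
    by rewrite /= !nth_default // size_rowmajor // leq_subRL.
  rewrite -{1}(subnKC gi) q4; last by rewrite ltn_subLR.
  have : i - n * n < n * n by rewrite ltn_subLR.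
  move: (i - n * n) => m lm /=; have dn : m %/ n < n by rewrite ltn_divLR.
  rewrite {1 4}(divn_eq m n) -[m %/ n]/(val (Ordinal dn)) -[m %% n]/(val (Ordinal
    (ltn_pmod m n0))).
  rewrite !nth_rowmajor /shifted !mxE; congr (_ + _)%R.
  by rewrite -val_eqE /=; case: eqP; rewrite ?mulr0 ?mulr1 ?mulr0n ?mulr1n ?natz.
have r4 r : r < T0 -> reg s4 r = reg (init [:: n%:Z%R] (rowmajor (adjmx G) ++
  rowmajor (shifted G))) r.
  move=> lr; rewrite /= /upd; case: eqP => [->//|/eqP r1].
  rewrite low3 // low2 //=; move: r1; case: r lr => [|[|r]] //= lr _.
  by rewrite !nth_nil.
have p4 : pc s4 = p1 + 1 + minn 0 (size P) by rewrite /= p3 min0n addn0 addn1.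
have [s5 [g5 p5 h5 r5]] := exec_relocate exP usP crel p4 r4 h4.
rewrite -p5 in cbody it0 it1 itN.
(* The call may leave anything beyond the first [n * n] cells; the sample table overwrites what it
   needs there. *)
pose a5 := Ast (vr a1) (heap s5).
have sm5 : sim T0 a5 s5.
  split=> // i; rewrite r5; last by rewrite /vreg leq_addr.
  rewrite /= /upd ifF; first by rewrite (proj1 sm3).
  by rewrite eq_sym lowv.
have hM x y : x < n -> y < n ->
    hp a5 (x * n + y) = (cod n (adjn G) x y + n.+1 * adjn G x y)%N.
  move=> xn yn; rewrite /= h5.
  have lxy : x * n + y < n * n.
    apply: (@leq_trans (x.+1 * n)); first by rewrite mulSn addnC ltn_add2r.
    by rewrite leq_mul2r xn orbT.
  rewrite -(nth_mkseq 0%R (heap sP) lxy) hP.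
  rewrite -[x]/(val (Ordinal xn)) -[y]/(val (Ordinal yn)) nth_rowmajor.
  exact: mulmx_shifted.
have q1' : vr a5 1 = E by rewrite /= q1.
have [u2 [a2 [ru2 lu2 [S [gr outE outb]]]]] :=
  tri_main ef n0 k0 Wn Wp Wv (E := E) Wc erefl (st := a5) q0 q1' q2 q3 hM.
have [s6 [g6 p6 sm6 low6]] := H2 _ _ Q s5 _ _ _ (bitlen_gt0 W) WB cbody sm5 ru2.
pose s7 := step (IConst 0 0) s6.
pose s8 := step (IAdd 0 0 (vreg T0 18)) s7.
have v18 : reg s7 (vreg T0 18) = vr a2 18.
  by rewrite /= /upd eq_sym lowv ?(leq_trans _ T2) // (proj1 sm6).
rewrite -p6 in it0 it1 itN.
have g7 : goes Q s6 (bitlen 0 + 1) s7 by apply: (@goes_step _ s6 _ _ _ it0).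
have g8 : goes Q s7 (bitlen 0 + (bitlen 0 + 1) + (bitlen (vreg T0 18) + bitlen `|vr
  a2 18|)) s8.
  by apply: (@goes_step _ s7 _ _ _ it1) => //; rewrite /cost v18.
have [t rt lt] := goes_trans g1 (goes_trans g2 (goes_trans g3 (goes_trans g4
  (goes_trans g5 (goes_trans g6 (goes_trans g7 g8)))))).
exists t, s8, S; split=> //.
- exact: exec_reach rt itN.
- by rewrite -outE -v18 -[RHS]add0r.
apply: leq_trans lt _.
have bn : bitlen n <= bitlen W.
  by apply: leq_bitlen; apply: leq_trans Wn; apply: leq_trans (leqnSn _) _;
    rewrite leq_pmulr.
have bE : bitlen E <= bitlen W by apply: leq_bitlen; lia.
have bW := bitlen_gt0 W.
set U := n * n * 3 + 4 + Um v n k.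
have k1 : K1 * bitlen W * u1 <= K1 * bitlen W * U.
  by rewrite leq_mul2l (leq_trans lu1) ?orbT // leq_addr.
have k2 : K2 * bitlen W * u2 <= K2 * bitlen W * U.
  by rewrite leq_mul2l (leq_trans lu2) ?orbT // leq_addl.
have k3 : (b0 + b1) * bitlen W <= (b0 + b1) * bitlen W * U.
  by apply: leq_pmulr; rewrite /U !addn_gt0 orbT.
have k4 := leq_pmulr (bitlen v0 + (bitlen v0 + 1) + bitlen 0 + (bitlen v1 + (bitlen
  v1 + 1) + bitlen 1)
  + (bitlen 1 + 1) + (bitlen 0 + 1) + (bitlen 0 + (bitlen 0 + 1)) + bitlen (vreg T0
    18)) bW.
have k5 : (K1 + K2 + b0 + b1) * bitlen W * U =
  K1 * bitlen W * U + K2 * bitlen W * U + (b0 + b1) * bitlen W * U.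
  by rewrite -!mulnDl !addnA.
rewrite k5; move: k1 k2 k3 k4 outb bn bE; clear.
move: (K1 * bitlen W * U) (K2 * bitlen W * U) ((b0 + b1) * bitlen W * U) => X1 X2 X3.
move: (K1 * bitlen W * u1) (K2 * bitlen W * u2) => x1 x2.
rewrite /b0 /b1 -![bitlen 0]/1 -![bitlen 1]/1; lia.
Qed.

End Assembly.

Local Open Scope ring_scope.

(** * Accuracy *)

Lemma mixed_size_full n k v S : mixed_size n k v S v = (k ^ v)%N.
Proof.
rewrite /mixed_size.
have gen ss : all (fun s => size s == k) ss -> size (cart ss) = (k ^ size ss)%N.
  elim: ss => [|s ss IH] //= /andP[/eqP sk /IH h].
  by rewrite -[cart _]/[seq x :: l | x <- s, l <- cart ss] size_allpairs sk h expnS.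
rewrite gen ?size_mkseq //; apply/allP => s /mapP[b];
  rewrite mem_iota /= add0n => bv ->.
by rewrite /mixed bv size_mkseq.
Qed.

(* Nearest-integer rounding at most doubles the distance to an integer. *)
Lemma round_dist (num den N : int) : 0 < den ->
  den * `|((2 * num + den) %/ (2 * den))%Z - N| <= 2 * `|num - N * den|.
Proof.
move=> d0; set r := (_ %/ _)%Z.
have d2 : 2 * den != 0 by lia.
have := divz_eq (2 * num + den) (2 * den); rewrite -/r.
have := modz_ge0 (2 * num + den) d2; have := ltz_mod (2 * num + den) d2.
move: (_ %% _)%Z => m m1 m2 E.
have [->|rN] := eqVneq r N; first by rewrite subrr normr0 mulr0 mulr_ge0.
have h : 1 <= `|r - N| by lia.
have E2 : 2 * (num - N * den) = 2 * den * (r - N) + (m - den) by lia.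
have -> : 2 * `|num - N * den| = `|2 * den * (r - N) + (m - den)| by rewrite -E2 normrM.
have h2 : `|2 * den * (r - N)| = 2 * den * `|r - N| by rewrite normrM gtr0_norm //; lia.
have h3 : `|m - den| <= den by lia.
have h4 := lerB_normD (2 * den * (r - N)) (m - den).
rewrite h2 in h4; nia.
Qed.

Lemma prod_shift_bound n (v w d : nat) : (0 < n)%N -> (v + w <= d)%N ->
  `|\prod_(j < w) (n%:Z - (v + j)%N%:Z)| <= ((d * n) ^ w)%N%:Z.
Proof.
move=> n0; elim: w => [|w IH] h; first by rewrite big_ord0.
rewrite big_ord_recr /= normrM expnSr PoszM; apply: ler_pM => //.
  by apply: IH; lia.
nia.
Qed.

Section Accuracy.

Variables (R : realType) (V : finType) (H : graph V).

Let v := size (core H).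

(** Compensates the [v] replacements, the factor [|V|^n_iso] in the bound on the placements of
    isolated vertices, and the 2 of the rounding. The successor keeps it positive, also when
    [v = 0]. *)
Definition oversampling : nat := (2 * (v * #|V| ^ n_iso H)).+1.

Lemma estimate_error n (G : graph 'I_n) E S : (0 < n)%N -> (0 < E)%N ->
  let c := oversampling in
  let k := (c * E * (c * E))%N in
  (forall b, (b < v)%N -> greedy v (adjo H (core H)) n k (adjn G) S b k) ->
  `|(estimate v (n_iso H) (aut H) n k
       (mixed_sum n k v (F (adjo H (core H)) (adjn G)) S v))%:~R - (copies H G)%:R|
   <= n%:R ^+ #|V| / E%:R :> R.
Proof.
move=> n0 E0 c k gr.
have c0 : (0 < c)%N by [].
have m0 : (0 < c * E)%N by rewrite muln_gt0 c0.
have k0 : (0 < k)%N by rewrite muln_gt0 m0.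
have FE : F (adjo H (core H)) (adjn G) = Fh H (core H) G by [].
rewrite FE in gr *.
have := @sampling_error n k v (Fh H (core H) G) (@Fh_id _ H n G _) (@Fh_sym _ H n G _)
  R (c * E)%N S n0 m0 erefl gr.
rewrite mixed_size_full mixed_sum_core.
have := list_count_core H G n0; rewrite -/v.
set X := list_count H G (core H); set T := mixed_sum _ _ _ _ _ _.
set Pi := \prod_(j < n_iso H) _ => HX err.
have piB : `|Pi| <= ((#|V| * n) ^ n_iso H)%N%:Z.
  by apply: prod_shift_bound => //; rewrite -(core_iso_card H).
have d0 : 0 < (k ^ v * aut H)%N%:Z.
  by rewrite ltz_nat muln_gt0 expn_gt0 k0 aut_gt0.
have := @round_dist (T * (n ^ v)%N%:Z * Pi) (k ^ v * aut H)%N%:Z (copies H G)%:Z d0.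
rewrite -/(estimate v (n_iso H) (aut H) n k T).
set r := estimate _ _ _ _ _ _.
have -> : T * (n ^ v)%N%:Z * Pi - (copies H G)%:Z * (k ^ v * aut H)%N%:Z =
    Pi * (T * (n ^ v)%N%:Z - X * (k ^ v)%N%:Z).
  rewrite PoszM [(k ^ v)%N%:Z * _]mulrC mulrA -PoszM HX; ring.
rewrite normrM -(ler_int R) !rmorphM /= !intr_norm !rmorphB /= !rmorphM /= -!pmulrn
  => rd.
have nR : 0 < n%:R :> R by rewrite ltr0n.
have kR : 0 < k%:R :> R by rewrite ltr0n.
have ER : 0 < E%:R :> R by rewrite ltr0n.
have cR : 0 < c%:R :> R by rewrite ltr0n.
have nvR : 0 < (n ^ v)%:R :> R by rewrite ltr0n expn_gt0 n0.
have kvR : 0 < (k ^ v)%:R :> R by rewrite ltr0n expn_gt0 k0.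
have aR : 1 <= (aut H)%:R :> R by rewrite ler1n aut_gt0.
have e1 : `|T%:~R * (n ^ v)%:R - X%:~R * (k ^ v)%:R| <=
    v%:R / (c * E)%:R * (n ^ v)%:R * (k ^ v)%:R :> R.
  have -> : T%:~R * (n ^ v)%:R - X%:~R * (k ^ v)%:R =
    - ((X%:~R / (n ^ v)%:R - T%:~R / (k ^ v)%:R) * ((n ^ v)%:R * (k ^ v)%:R)) :> R.
    by field; rewrite !gt_eqF.
  rewrite normrN normrM [`|_ * (k ^ v)%:R|]gtr0_norm ?mulr_gt0 // -mulrA ler_pM2r
    ?mulr_gt0 //.
have piR : `|Pi%:~R| <= (#|V| ^ n_iso H)%:R * n%:R ^+ n_iso H :> R.
  move: piB; rewrite -(ler_int R) intr_norm -pmulrn expnMn natrM !natrX.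
  by [].
set D := `|r%:~R - _| in rd *.
have D0 : 0 <= D by apply: normr_ge0.
have cE : (2 * (v * #|V| ^ n_iso H))%:R <= c%:R :> R by rewrite ler_nat leqnSn.
have fin : D * (k ^ v)%:R <= 
   (2 * (v * #|V| ^ n_iso H))%:R / c%:R * (n%:R ^+ #|V| / E%:R) * (k ^ v)%:R.
  (* As [1 <= aut H], dividing by it only shrinks the error. *)
  apply: (@le_trans _ _ ((k ^ v * aut H)%:R * D)).
    rewrite natrM mulrAC mulrC; apply: ler_peMr => //.
    by rewrite mulr_ge0 // ltW.
  rewrite natrM; apply: le_trans rd _; rewrite -[(1 + 1)%:R]/(2 : R).
  apply: (@le_trans _ _ (2 * ((#|V| ^ n_iso H)%:R * n%:R ^+ n_iso H *
     (v%:R / (c * E)%:R * (n ^ v)%:R * (k ^ v)%:R)))).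
    by rewrite ler_pM2l // ler_pM.
  rewrite le_eqVlt; apply/orP; left; apply/eqP.
  rewrite -(core_iso_card H) -/v exprD !natrM !natrX; field.
  by rewrite !gt_eqF.
have : D <= (2 * (v * #|V| ^ n_iso H))%:R / c%:R * (n%:R ^+ #|V| / E%:R).
  by rewrite -(ler_pM2r kvR).
move=> h; apply: le_trans h _.
apply: ler_piMl; first by rewrite divr_ge0 ?exprn_ge0 // ltW.
by rewrite ler_pdivrMr // mul1r.
Qed.

End Accuracy.

(** * Running time *)

Lemma bitlen_mul x y : (bitlen (x * y) <= bitlen x + bitlen y + 1)%N.
Proof.
rewrite addn1; apply: bitlen_le; rewrite expnD.
by apply: leq_mul; apply: ltnW; apply: ltn_bitlen.
Qed.

Lemma bitlen_exp m r : (bitlen (m ^ r) <= r * bitlen m + 1)%N.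
Proof.
rewrite addn1 mulnC; apply: bitlen_le; rewrite expnM.
move: (2 ^ bitlen m)%N (ltnW (ltn_bitlen m)) => X mX.
by elim: r => // r IH; rewrite !expnS; apply: leq_mul mX IH.
Qed.

Lemma bitlen_leS x : (bitlen x <= x.+1)%N.
Proof. by apply: bitlen_le; apply: ltnW; apply: ltn_expl. Qed.

(** A kernel value costs [O(k)], a score [O(k (k + n))], a minimization [n] times that, repeated [k]
    times per coordinate; [k^3 n^2] dominates both resulting terms. *)
Lemma Um_le v : exists beta, forall n k, (0 < n)%N -> (0 < k)%N ->
  (n * n * 3 + 4 + Um v n k <= beta * (k ^ 3 * n ^ 2) + 3 * k ^ v)%N.
Proof.
pose al := (1 + v * 7)%N.
exists (13 + v * (4 * al + 41))%N => n k n0 k0.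
have h1 : (Uk v k <= al * k)%N by rewrite /Uk /al; nia.
have h2 : (Uh v n k <= (2 * al + 12) * (k * k * n))%N.
  have a1 : (k * (Uk v k + 4) <= (al + 4) * (k * k * n))%N.
    apply: (@leq_trans ((al + 4) * (k * k))%N);
      last by rewrite leq_mul2l leq_pmulr ?orbT.
    by rewrite mulnCA leq_mul2l; apply/orP; right; nia.
  have a2 : (n * (Uk v k + 3) <= (al + 3) * (k * k * n))%N.
    rewrite [(k * k * n)%N]mulnC mulnCA leq_mul2l; apply/orP; right.
    apply: (@leq_trans ((al + 3) * k)%N); first by nia.
    by rewrite leq_mul2l leq_pmulr ?orbT.
  have a3 : (0 < k * k * n)%N by rewrite !muln_gt0 k0 n0.
  by rewrite /Uh; nia.
have h3 : (Ua v n k <= (4 * al + 34) * (k * k * (n * n)))%N.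
  have a3 : (0 < k * k * n)%N by rewrite !muln_gt0 k0 n0.
  have a4 : (Ua v n k <= 2 * n * (Uh v n k + 5))%N by rewrite /Ua; nia.
  apply: leq_trans a4 _.
  apply: (@leq_trans (2 * n * ((2 * al + 17) * (k * k * n)))%N); last by nia.
  by rewrite leq_mul2l; apply/orP; right; nia.
have h4 : ((k * (Ua v n k + 3)).+2 <= (4 * al + 39) * (k ^ 3 * n ^ 2))%N.
  have a3 : (0 < k * k * (n * n))%N by rewrite !muln_gt0 k0 n0.
  have -> : (k ^ 3 * n ^ 2 = k * (k * k * (n * n)))%N by rewrite !expnS !expn0; ring.
  by nia.
have a3 : (0 < k ^ 3 * n ^ 2)%N by rewrite muln_gt0 !expn_gt0 k0 n0.
have a5 : (n * n <= k ^ 3 * n ^ 2)%N by rewrite mulnn leq_pmull // expn_gt0 k0.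
rewrite /Um; move: h4 a3 a5;
  move: (k ^ 3 * n ^ 2)%N (k ^ v)%N (k * (Ua v n k + 3)).+2 => X Y Z.
nia.
Qed.

(** The length of the cap is crudely bounded by a multiple of [bitlen n * E], which costs one power
    of [E] beyond those of [k ^ 3] and [k ^ v]. *)
Lemma time_le v d c K : (0 < c)%N -> exists K', forall n E k, (0 < n)%N -> (0 < E)%N ->
  k = (c * E * (c * E))%N ->
  (K * bitlen ((n + k + d) ^ (v + 3)) * (n * n * 3 + 4 + Um v n k)
   <= K' * (bitlen n * E ^ 7 * n ^ 2 + bitlen n * E ^ (2 * v + 1)))%N.
Proof.
move=> c0; have [beta hb] := Um_le v.
pose D := (bitlen (d + 2) + bitlen (c * c) + 10)%N.
pose D' := ((v + 3) * (3 + D) + 1)%N.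
exists (K * D' * (beta * c ^ 6 + 3 * c ^ (2 * v)))%N => n E k n0 E0 kdef.
have k0 : (0 < k)%N by rewrite kdef !muln_gt0 c0 E0.
have bn := bitlen_gt0 n.
have hW : (bitlen ((n + k + d) ^ (v + 3)) <= D' * (bitlen n * E))%N.
  have hm : (bitlen (n + k + d) <= (3 + D) * (bitlen n * E))%N.
    have m1 : (n + k + d <= (d + 2) * (n * k))%N.
      have : (n <= n * k)%N by rewrite leq_pmulr.
      have : (k <= n * k)%N by rewrite leq_pmull.
      have : (0 < n * k)%N by rewrite muln_gt0 n0.
      move: (n * k)%N => X; nia.
    have m2 := leq_trans (leq_bitlen m1) (bitlen_mul _ _).
    have m3 := bitlen_mul n k.
    have kE : k = ((c * c) * (E * E))%N by rewrite kdef; ring.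
    have m4 : (bitlen k <= bitlen (c * c) + bitlen (E * E) + 1)%N by rewrite kE
      bitlen_mul.
    have m5 := bitlen_mul E E; have m6 := bitlen_leS E.
    have : (bitlen (n + k + d) <= bitlen n + 2 * E + D)%N by rewrite /D; lia.
    move: (bitlen (n + k + d)) (bitlen n) bn => x y y0 h; clear -y0 h E0; nia.
  apply: leq_trans (bitlen_exp _ _) _; rewrite /D'.
  have : (0 < bitlen n * E)%N by rewrite muln_gt0 bn.
  move: hm; move: (bitlen (n + k + d)) (bitlen n * E)%N (3 + D)%N => x y z h1 h2.
  have : ((v + 3) * x <= (v + 3) * (z * y))%N by rewrite leq_mul2l h1 orbT.
  rewrite mulnDl mulnA; lia.
have hU := hb n k n0 k0.
have kE3 : (k ^ 3 = c ^ 6 * E ^ 6)%N by rewrite kdef !expnS !expn0; ring.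
have kEv : (k ^ v = c ^ (2 * v) * E ^ (2 * v))%N.
  by rewrite kdef mulnn -expnM expnMn.
rewrite kE3 kEv in hU.
apply: leq_trans (leq_mul (leq_mul (leqnn K) hW) hU) _.
have e7 : (E ^ 7 = E * E ^ 6)%N by rewrite expnS.
have e2v : (E ^ (2 * v + 1) = E * E ^ (2 * v))%N by rewrite addn1 expnS.
set p := (bitlen n * E ^ 7 * n ^ 2)%N; set q := (bitlen n * E ^ (2 * v + 1))%N.
have -> : (K * (D' * (bitlen n * E)) *
    (beta * (c ^ 6 * E ^ 6 * n ^ 2) + 3 * (c ^ (2 * v) * E ^ (2 * v))) =
    K * D' * (beta * c ^ 6 * p + 3 * c ^ (2 * v) * q))%N.
  by rewrite /p /q e7 e2v; ring.
rewrite -[X in (_ <= X)%N]mulnA leq_mul2l; apply/orP; right.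
move: p q (beta * c ^ 6)%N (3 * c ^ (2 * v))%N => x y z w; nia.
Qed.

(** * Absorbing logarithms into the exponent *)

Section Analysis.

Variable R : realType.

(** [exp(-1/2) >= 1 - 1/2] inverts to [exp(1/2) <= 2]. *)
Lemma half_le_ln2 : 2^-1 <= ln 2 :> R.
Proof.
rewrite -ler_expR lnK ?posrE //.
have h := expR_ge1Dx (- 2^-1 : R).
rewrite expRN in h.
have e0 : 0 < expR (2^-1 : R) by exact: expR_gt0.
have h2 : 2^-1 <= (expR (2^-1 : R))^-1 by lra.
by rewrite -lef_pV2 ?posrE.
Qed.

Lemma bitlen_sqrt_ln n : (0 < n)%N ->
  (bitlen n + 3)%:R <= 4 * (1 + Num.sqrt (ln n%:R)) ^+ 2 :> R.
Proof.
move=> n0; set u := Num.sqrt _.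
have l0 : 0 <= ln (n%:R : R) by rewrite ln_ge0 // ler1n.
have u2 : u ^+ 2 = ln n%:R by rewrite sqr_sqrtr.
have u0 : 0 <= u by apply: sqrtr_ge0.
have tl : (trunc_log 2 n)%:R * ln 2 <= ln n%:R :> R.
  rewrite mulr_natl -lnXn // ler_ln ?posrE ?exprn_gt0 ?ltr0n // -natrX ler_nat.
  exact: trunc_logP.
have t0 : 0 <= (trunc_log 2 n)%:R :> R by [].
have h := half_le_ln2.
have : (trunc_log 2 n)%:R * 2^-1 <= u ^+ 2 by rewrite u2; apply: le_trans tl;
  rewrite ler_wpM2l.
have -> : (bitlen n + 3 = trunc_log 2 n + 4)%N by rewrite /bitlen addSnnS.
rewrite natrD sqrrD expr1n mul1r.
have : 0 <= u ^+ 2 by rewrite u2.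
by move: (trunc_log 2 n)%:R (u ^+ 2) => x y; lra.
Qed.

(** Raise [1 + u <= (m+1) (1 + u/(m+1)) <= (m+1) exp(u/(m+1))] to the power [m.+1]; the successor
    avoids a division by 0. *)
Lemma pow_le_exp m (u : R) : 0 <= u -> (1 + u) ^+ m <= m.+1%:R ^+ m.+1 * expR u.
Proof.
move=> u0; have m0 : 0 < m.+1%:R :> R by [].
apply: (@le_trans _ _ ((1 + u) ^+ m.+1)).
  by rewrite exprS ler_peMl ?exprn_ge0 ?addr_ge0 // lerDl.
have -> : expR u = expR (u / m.+1%:R) ^+ m.+1.
  by rewrite -expRM_natl mulrC mulrAC -mulrA mulfV ?mulr1 ?gt_eqF.
rewrite -exprMn; apply: lerXn2r; rewrite ?nnegrE ?addr_ge0 ?mulr_ge0 ?expR_ge0 //.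
apply: (@le_trans _ _ (m.+1%:R * (1 + u / m.+1%:R))).
  rewrite mulrDr mulr1 mulrCA mulfV ?mulr1 ?gt_eqF // lerD2r ler1n //.
by rewrite ler_pM2l // expR_ge1Dx.
Qed.

Lemma polylog_le c : exists2 C : R, 0 <= C & forall n, (0 < n)%N ->
  (bitlen n + 3)%:R ^+ c <= C * expR (Num.sqrt (ln n%:R)).
Proof.
exists (4 ^+ c * (2 * c)%N.+1%:R ^+ (2 * c)%N.+1); first by rewrite mulr_ge0 ?exprn_ge0.
move=> n n0; set u := Num.sqrt _.
have u0 : 0 <= u by apply: sqrtr_ge0.
apply: (@le_trans _ _ ((4 * (1 + u) ^+ 2) ^+ c)).
  apply: lerXn2r; rewrite ?nnegrE ?mulr_ge0 ?exprn_ge0 ?addr_ge0 //.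
  exact: bitlen_sqrt_ln.
rewrite exprMn -exprM -mulrA ler_pM2l ?exprn_gt0 //.
exact: pow_le_exp.
Qed.

(** At [n = 1] the inverse of 0 is 0 and [exp 0 = 1], so the identity persists. *)
Lemma powR_sqrt_ln n (a : R) : (0 < n)%N ->
  n%:R `^ (a + (Num.sqrt (ln n%:R))^-1) = n%:R `^ a * expR (Num.sqrt (ln n%:R)).
Proof.
move=> n0; have nR : n%:R != 0 :> R by rewrite pnatr_eq0 -lt0n.
rewrite powRD ?nR ?implybT //; congr (_ * _).
rewrite /powR (negPf nR); congr expR.
have l0 : 0 <= ln (n%:R : R) by rewrite ln_ge0 // ler1n.
have [s0|s0] := eqVneq (Num.sqrt (ln (n%:R : R))) 0.
  by rewrite s0 invr0 mul0r.
by rewrite -{2}(sqr_sqrtr l0) expr2 mulKf.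
Qed.

Lemma cvg_inv_sqrt_ln :
  ((Num.sqrt (ln (n%:R : R)))^-1 @[n --> \oo] --> (0 : R))%classic.
Proof.
apply/cvgrPdist_lt => eps e0.
near=> n.
have hn : expR (eps^-1 ^+ 2) < n%:R by near: n; exact: nbhs_infty_gtr.
have ei : 0 < eps^-1 by rewrite invr_gt0.
have n0 : 0 < n%:R :> R by apply: lt_trans hn; exact: expR_gt0.
have hl : eps^-1 ^+ 2 < ln n%:R by rewrite -ltr_expR lnK ?posrE.
have hs : eps^-1 < Num.sqrt (ln n%:R).
  rewrite -(ltr_pXn2r (n := 2)) ?nnegrE ?sqrtr_ge0 ?(ltW ei) //.
  by rewrite sqr_sqrtr // ltW // (lt_trans _ hl) // exprn_gt0.
have s0 := lt_trans ei hs.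
by rewrite sub0r normrN gtr0_norm ?invr_gt0 // invf_plt ?posrE.
Unshelve. all: by end_near.
Qed.

(* The program must overwrite all cells of a constant input. *)
Lemma matmul_quadratic (omega : R) (P : program) (C : R) (c : nat) (o : nat -> R) :
  (forall (n b : nat) (A B : 'M[int]_n), (0 < n)%N ->
      (forall i j, (`|A i j| < 2 ^ b)%N /\ (`|B i j| < 2 ^ b)%N) ->
      exists (t : nat) (s : state),
        [/\ exec P (init [:: n%:Z] (rowmajor A ++ rowmajor B)) t s,
            mkseq (heap s) (n * n) = rowmajor (A *m B)
          & t%:R <= C * b.+1%:R ^+ c * n%:R `^ (omega + o n)]) ->
  forall n, (0 < n)%N -> (n ^ 2)%:R <= C * 3 ^+ c * n%:R `^ (omega + o n).
Proof.
move=> hP n n0.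
(* Every entry of the product is [4 * n], never 2, so no output cell keeps its input value; entries
   1 would fail at [n = 1]. *)
pose A : 'M[int]_n := const_mx 2.
have [i j|t [s [ex hs ht]]] := hP n 2%N A A n0; first by rewrite !mxE.
apply: le_trans ht; rewrite ler_nat.
apply: leq_trans (exec_writes (n * n) ex).
rewrite -mulnn -[X in (X <= _)%N]muln1 -[X in (X * 1)%N]card_ord -sum_nat_const.
apply: leq_sum => m _; rewrite lt0b.
have dn : (m %/ n < n)%N by rewrite ltn_divLR.
have -> : heap s m = (A *m A) (Ordinal dn) (Ordinal (ltn_pmod m n0)).
  rewrite -nth_rowmajor /= -divn_eq -hs nth_mkseq //.
have -> : heap (init [:: n%:Z] (rowmajor A ++ rowmajor A)) m =
    A (Ordinal dn) (Ordinal (ltn_pmod m n0)).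
  by rewrite -nth_rowmajor /= -divn_eq nth_cat size_rowmajor ltn_ord.
rewrite !mxE (eq_bigr (fun=> 4)); last by move=> k _; rewrite !mxE.
rewrite sumr_const card_ord -mulr_natl natz; apply/eqP; lia.
Qed.

End Analysis.

Lemma bound_conditions n k v d : (0 < n)%N -> (0 < k)%N -> (v + 2 <= d)%N ->
  let W := ((n + k + d) ^ (v + 3))%N in
  [/\ (n.+1 * n.+1 <= W)%N, (n * k * (n + k) ^ v <= W)%N & (n + k + d <= W)%N].
Proof.
move=> n0 k0 vd; set m := (n + k + d)%N => W.
have m0 : (0 < m)%N by rewrite /m !addn_gt0 n0.
have mv : (0 < m ^ v)%N by rewrite expn_gt0 m0.
have WE : W = (m * m * (m * m ^ v))%N by rewrite /W addn3 !expnS; ring.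
have mm : (m <= m * m ^ v)%N by rewrite leq_pmulr.
split.
- rewrite WE; apply: (@leq_trans (m * m)%N); first by apply: leq_mul; rewrite /m; lia.
  by rewrite leq_pmulr // muln_gt0 m0.
- rewrite WE; apply: leq_mul; first by apply: leq_mul; rewrite /m; lia.
  apply: (@leq_trans (m ^ v)%N); last by rewrite leq_pmull.
  by rewrite /m; elim: (v) => // w IH; rewrite !expnS leq_mul // leq_addr.
- rewrite WE; apply: leq_trans mm _; rewrite leq_pmull // muln_gt0 m0 //.
Qed.

Lemma sum_slack a b c e v n k : (e <= k)%N ->
  (a + b + c + e + v + 2 <= n + k + (a + b + c + v + 2))%N.
Proof. by move=> ek; lia. Qed.

(** [Z] stands for [n ^ (omega + o n)], [X] for [exp(sqrt(ln n))], [M] for [max 1 eps^-1]. The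
    premise with [C3] is the quadratic lower bound, which lets the [n ^ 2] work hide behind the
    multiplication. *)
Lemma time_real (R : realFieldType) (C0 C1 C3 Z X M : R) (t tP K b n E v e : nat) :
  (t <= tP + K * (b * E ^ 7 * n ^ 2 + b * E ^ (2 * v + 1)))%N ->
  (0 < n)%N -> (0 < E)%N -> (v <= 2 * e)%N -> (b <= 2 * n)%N ->
  [/\ 0 <= C0, 0 <= C1, 0 <= C3, 0 <= Z & 0 <= X] -> 1 <= M ->
  tP%:R <= C0 * (Z * X) -> b%:R <= C1 * X -> n%:R ^+ 2 <= C3 * Z -> E%:R <= 2 * M ->
  t%:R <= (C0 + 2 * K%:R * (C1 * 2 ^+ 7 * C3) + K%:R * (2 * 2 ^+ (5 * e))) *
    (M ^+ 7 * (Z * X) + M ^+ (5 * e) * n%:R).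
Proof.
move=> tle n0 E0 ve bn [C00 C10 C30 Z0 X0] M1 tPE bE nE EM.
have M0 : 0 <= M by apply: le_trans M1.
have EX j : E%:R ^+ j <= 2 ^+ j * M ^+ j.
  by rewrite -exprMn; apply: lerXn2r; rewrite ?nnegrE ?mulr_ge0.
set A1 := M ^+ 7 * (Z * X); set A2 := M ^+ (5 * e) * n%:R.
have A10 : 0 <= A1 by rewrite !mulr_ge0 ?exprn_ge0.
have A20 : 0 <= A2 by rewrite !mulr_ge0 ?exprn_ge0.
set p := C1 * 2 ^+ 7 * C3; set q := 2 * 2 ^+ (5 * e).
have p0 : 0 <= p by rewrite !mulr_ge0 ?exprn_ge0.
have q0 : 0 <= q by rewrite mulr_ge0 ?exprn_ge0.
have first : (b * E ^ 7 * n ^ 2)%:R <= p * A1.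
  rewrite natrM [(b * _)%:R]natrM !natrX.
  have -> : p * A1 = (C1 * X) * (2 ^+ 7 * M ^+ 7) * (C3 * Z).
    by rewrite /p /A1; move: (2 ^+ 7) (M ^+ 7) => y z; ring.
  by apply: ler_pM; rewrite ?mulr_ge0 ?exprn_ge0 //; apply: ler_pM; rewrite ?exprn_ge0.
have second : (b * E ^ (2 * v + 1))%:R <= p * A1 + q * A2.
  (* If [v = 0], then [e] may be 0 and the second term of the bound may carry no power of [M], so
     the first one pays. Otherwise [e >= 1] and [2 v + 1 <= 4 e + 1 <= 5 e]. *)
  case: (posnP v) => [v0|v0].
    apply: (@le_trans _ _ (b * E ^ 7 * n ^ 2)%:R).
      rewrite ler_nat v0 muln0 add0n -mulnA leq_mul2l; apply/orP; right.
      apply: (@leq_trans (E ^ 7)); first by rewrite leq_pexp2l.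
      by rewrite leq_pmulr // expn_gt0 n0.
    by apply: le_trans first _; rewrite lerDl mulr_ge0.
  apply: (@le_trans _ _ (q * A2)); last by rewrite lerDr mulr_ge0.
  rewrite natrM natrX.
  have -> : q * A2 = (2 * n%:R) * (2 ^+ (5 * e) * M ^+ (5 * e)).
    by rewrite /q /A2 mulrACA [_ * n%:R]mulrC mulrACA [_ * n%:R]mulrC mulrACA [n%:R *
      _]mulrC.
  apply: ler_pM; rewrite ?exprn_ge0 //; first by rewrite -natrM ler_nat.
  apply: le_trans (EX _); apply: ler_weXn2l; first by rewrite ler1n.
  by move: v0 ve; clear; lia.
have tR : t%:R <= tP%:R + K%:R * ((b * E ^ 7 * n ^ 2)%:R + (b * E ^ (2 * v + 1))%:R)
  :> R.
  by rewrite -natrD -natrM -natrD ler_nat.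
apply: le_trans tR _.
have tPA : tP%:R <= C0 * A1.
  by apply: le_trans tPE _; rewrite ler_wpM2l // /A1 ler_peMl ?mulr_ge0 // exprn_ege1.
apply: le_trans (lerD tPA (ler_wpM2l (ler0n R K) (lerD first second))) _.
rewrite -subr_ge0.
have -> : (C0 + 2 * K%:R * p + K%:R * q) * (A1 + A2) -
    (C0 * A1 + K%:R * (p * A1 + (p * A1 + q * A2))) =
    C0 * A2 + 2 * K%:R * p * A2 + K%:R * q * A1.
  by move: p q A1 A2 (K%:R) {first second tPA A10 A20 p0 q0} => p q A1 A2 k; ring.
have h1 := mulr_ge0 C00 A20.
have h2 := mulr_ge0 (mulr_ge0 (mulr_ge0 (ler0n R 2) (ler0n R K)) p0) A20.
have h3 := mulr_ge0 (mulr_ge0 (ler0n R K) q0) A10.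
exact: addr_ge0 (addr_ge0 h1 h2) h3.
Qed.

Theorem theorem1p5 (R : realType) (omega : R) :
  matmul_exponent omega ->
  exists (c1 c2 : nat) (o : nat -> R),
    (o n @[n --> \oo] --> (0 : R))%classic /\
    forall (V : finType) (H : graph V),
    exists (C : R) (P : program),
    forall eps : R, 0 < eps ->
    forall (n : nat) (G : graph 'I_n), (0 < n)%N ->
    exists (t : nat) (s : state),
      [/\ exec P (init [:: n%:Z; Num.ceil eps^-1] (rowmajor (adjmx G))) t s,
          `|(reg s 0%N)%:~R - (copies H G)%:R| <= eps * n%:R ^+ #|V|
        & t%:R <= C * (Num.max 1 eps^-1 ^+ c1 * n%:R `^ (omega + o n)
                       + Num.max 1 eps^-1 ^+ (c2 * #|edges H|) * n%:R)].
Proof.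
move=> [P [C [c [o [ho hP]]]]].
have [T0 T2 us] := uses_below_ex P.
exists 7%N, 5%N, (fun n => o n + (Num.sqrt (ln n%:R))^-1); split.
  have h : ((o n + (Num.sqrt (ln (n%:R : R)))^-1) @[n --> \oo] --> (0 + 0 : R))%classic.
    by apply: cvgD => //; apply: cvg_inv_sqrt_ln.
  by rewrite addr0 in h.
move=> V H.
pose v := size (core H); pose cc := oversampling H.
pose d := (n_iso H + aut H + cc + v + 2)%N.
have [K HK] := @full_run v (adjo H (core H)) (n_iso H) (aut H) cc P T0 T2 us.
have [K' HK'] := @time_le v d cc K isT.
have [C1 C10 HC1] := polylog_le R 1.
have [C2 C20 HC2] := polylog_le R c.
have sq := matmul_quadratic hP.
pose C3 := `|C| * 3 ^+ c.
have C30 : 0 <= C3 by rewrite mulr_ge0 ?exprn_ge0.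
exists (`|C| * C2 + 2 * K'%:R * (C1 * 2 ^+ 7 * C3) + K'%:R * (2 * 2 ^+ (5 * #|edges
  H|))).
exists (full_program v (adjo H (core H)) (n_iso H) (aut H) cc P T0).
move=> eps e0 n G n0.
have ei : 0 < eps^-1 by rewrite invr_gt0.
pose E := `|Num.ceil eps^-1|%N.
have ceil0 : 0 < Num.ceil eps^-1 by rewrite ltNge ceil_le0 -ltNge.
have EE : Num.ceil eps^-1 = E%:Z by rewrite /E gez0_abs // ltW.
have E0 : (0 < E)%N by rewrite -ltz_nat -EE.
have Ege : eps^-1 <= E%:R by have := ceil_ge eps^-1; rewrite EE.
have Elt : E%:R < eps^-1 + 1.
  have := ceilB1_lt eps^-1; rewrite EE intrB /= -pmulrn; lra.
rewrite EE.
pose M := Num.max 1 eps^-1.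
have M1 : 1 <= M by rewrite le_max lexx.
have M0 : 0 <= M by apply: le_trans M1.
(* The ceiling is below [eps^-1 + 1], and both summands are at most [M], also for [eps > 1]. *)
have EM : E%:R <= 2 * M.
  have : eps^-1 <= M by rewrite le_max lexx orbT.
  by move: M1 Elt; rewrite -/M; lra.
pose k := (cc * E * (cc * E))%N.
have k0 : (0 < k)%N by rewrite !muln_gt0 E0.
have vd : (v + 2 <= d)%N by rewrite /d -addnA leq_addl.
have [W1 W2 W3] := bound_conditions (n := n) (k := k) (v := v) n0 k0 vd.
set W := ((n + k + d) ^ (v + 3))%N in W1 W2 W3.
have Ek : (E <= k)%N by rewrite /k -mulnA mulnCA leq_pmulr // !muln_gt0 E0.
(* The diagonal entries [n + 1] are the largest; their length is logarithmic, so the factor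
   polynomial in it is absorbed by [exp(sqrt(ln n))]. *)
have hA (i j : 'I_n) : (`|adjmx G i j| < 2 ^ bitlen n.+1)%N /\
    (`|shifted G i j| < 2 ^ bitlen n.+1)%N.
  have b1 : (n.+1 < 2 ^ bitlen n.+1)%N := ltn_bitlen n.+1.
  split; apply: leq_ltn_trans b1.
    by rewrite mxE; case: (adj G i j).
  rewrite !mxE; case: (eqVneq i j) => [->|_].
    by rewrite adj_irr /= add0r mulr1n natz.
  by case: (adj G i j).
have [tP [sP [exP heapP timeP]]] := hP n (bitlen n.+1) (adjmx G) (shifted G) n0 hA.
have W4 : (v + 2 <= W)%N by apply: leq_trans W3; apply: leq_trans vd (leq_addl _ _).
have W5 : (n_iso H + aut H + cc + E + v + 2 <= W)%N.
  by apply: leq_trans W3; apply: sum_slack.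
have [t [s [S [ex gr out tle]]]] := HK n E W G tP sP n0 k0 W1 W2 W4 W5 exP heapP.
exists t, s; split=> //.
  have := @estimate_error R V H n G E S n0 E0 gr; rewrite -/v -/cc -/k -out => h.
  apply: le_trans h _; rewrite mulrC ler_pM2r ?exprn_gt0 ?ltr0n //.
  by rewrite invf_ple ?posrE ?ltr0n.
have {}tle : (t <= tP + K' * (bitlen n * E ^ 7 * n ^ 2 + bitlen n * E ^ (2 * v + 1)))%N.
  by apply: leq_trans tle _; rewrite leq_add2l; apply: HK'.
rewrite addrA powR_sqrt_ln //.
have b2 : (bitlen n <= 2 * n)%N.
  by apply: leq_trans (bitlen_leS n) _; rewrite mul2n -addnn -addn1 leq_add2l.
apply: (time_real tle n0 E0 (size_core H) b2) => //.
- by split=> //; [rewrite mulr_ge0 | exact: powR_ge0 | exact: expR_ge0].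
- apply: le_trans timeP _.
  have h1 : (bitlen n.+1).+1%:R ^+ c <= C2 * expR (Num.sqrt (ln (n%:R : R))).
    apply: le_trans (HC2 n n0); apply: lerXn2r; rewrite ?nnegrE // ler_nat.
    by rewrite addn3 ltnS; apply: leq_trans (bitlen_le (ltn_bitlen n)) _;
      rewrite leqnSn.
  rewrite [n%:R `^ _ * _]mulrC !mulrA ler_wpM2r ?powR_ge0 // -mulrA.
  apply: (@le_trans _ _ (`|C| * (bitlen n.+1).+1%:R ^+ c)).
    by rewrite ler_wpM2r ?exprn_ge0 // ler_norm.
  by rewrite ler_wpM2l.
- by have := HC1 n n0; rewrite expr1; apply: le_trans; rewrite ler_nat leq_addr.
- have := sq n n0; rewrite natrX => h; apply: le_trans h _.
  by rewrite ler_wpM2r ?powR_ge0 // ler_wpM2r ?exprn_ge0 // ler_norm.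
Qed.
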